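(* Let $\mathcal M=(\mathcal S,\mathcal A,r,P,\rho)$ be a finite average-reward MDP with parametrized policy class $\{\pi_\theta\}_{\theta\in\Theta}$, $\Theta\subset\mathbb R^d$, and feature map $\phi:\mathcal S\to\mathbb R^m$. Consider the algorithm NAC-B (Natural Actor-Critic with Batching) described in the context, run for $T=2KHB$ steps. Suppose the following hold. (1) (Unichain) For every policy in the class, the induced Markov chain on $\mathcal S$ has a single recurrent class. (2) There is a constant $\lambda>0$ such that for all $\theta$ and all $x\in\ker(M_\theta)^\perp$, $x^\top M_\theta x\ge\lambda\|x\|^2$, where $M_\theta=\mathbb E_\theta[\phi(s)(\phi(s)-\phi(s'))^\top]$ with $s\sim d^{\pi_\theta}$, $s'\sim P^{\pi_\theta}(s,\cdot)$. (3) There are constants $G_1,G_2$ such that for all $\theta,\theta_1,\theta_2$ and all $(s,a)$: $\|\nabla_\theta\log\pi_\theta(a|s)\|\le G_1$ and $\|\nabla_\theta\log\pi_{\theta_1}(a|s)-\nabla_\theta\log\pi_{\theta_2}(a|s)\|\le G_2\|\theta_1-\theta_2\|$. (4) There is a constant $\mu>0$ such that $F(\theta)-\mu I_d$ is positive semidefinite for all $\theta$. (5) The function $J$ is $L$-smooth. Set $K=\Theta(\sqrt T/\log T)$, $B=\Theta(\sqrt T)$, $H=\Theta(\log T)$. Then, for a suitable choice of the learning parameters $\alpha,\beta,c_\beta,\gamma$, the expected regret of the algorithm satisfies $$\mathbb E[\mathrm{Reg}_T]\le\tilde{\mathcal O}\Big(T\big(\sqrt{\epsilon_{\mathrm{bias}}}+\sqrt{\epsilon_{\mathrm{app}}}\big)+\sqrt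 T\,\big(C^2C_{\mathrm{tar}}+C_{\mathrm{tar}}\big)\Big),$$ where $C=C_{\mathrm{tar}}+C_{\mathrm{hit}}$.
   Context: **MDP.** $\mathcal S,\mathcal A$ are finite, $r:\mathcal S\times\mathcal A\to[0,1]$, $P(\cdot|s,a)$ is the transition kernel, $\rho$ the initial state distribution. Policies $\pi_\theta(\cdot|s)$ are differentiable in $\theta\in\Theta\subset\mathbb R^d$. $P^{\pi_\theta}(s,s')=\sum_aP(s'|s,a)\pi_\theta(a|s)$. Under the unichain assumption (transient states and periodicity are allowed), $d^{\pi_\theta}$ is the unique stationary distribution of $P^{\pi_\theta}$, and $\nu^{\pi_\theta}(s,a)=d^{\pi_\theta}(s)\pi_\theta(a|s)$. The average reward is $J(\theta)=\mathbb E_{(s,a)\sim\nu^{\pi_\theta}}[r(s,a)]$, and $J^*=\sup_{\theta\in\Theta}J(\theta)$. $V^{\pi_\theta},Q^{\pi_\theta}$ satisfy $Q^{\pi_\theta}(s,a)=r(s,a)-J(\theta)+\mathbb E_{s'\sim P(\cdot|s,a)}[V^{\pi_\theta}(s')]$, $V^{\pi_\theta}(s)=\sum_a\pi_\theta(a|s)Q^{\pi_\theta}(s,a)$, normalized by $\sum_sd^{\pi_\theta}(s)V^{\pi_\theta}(s)=0$; $A^{\pi_\theta}=Q^{\pi_\theta}-V^{\pi_\theta}$. The regret is $\mathrm{Reg}_T=\sum_{t=0}^{T-1}(J^*-r(s_t,a_t))$ along the trajectory generated by the algorithm. **Hitting constants.** $\mathcal S_R^\theta$ is the recurrent class under $\pi_\theta$;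 $T_\theta=\inf\{t\ge0:s_t\in\mathcal S_R^\theta\}$; $C_{\mathrm{hit}}^\theta=\max_{s\in\mathcal S}\mathbb E_s^\theta[T_\theta]$; for $s'\in\mathcal S$, $T_{s'}=\inf\{t\ge0:s_t=s'\}$; $C_{\mathrm{tar}}^\theta=\sum_{s'}d^{\pi_\theta}(s')\mathbb E_s^\theta[T_{s'}]$ for a fixed $s\in\mathcal S_R^\theta$ (the value does not depend on this $s$). Here $\mathbb E^\theta_s$ is expectation for the chain under $\pi_\theta$ started at $s$. $C_{\mathrm{hit}}=\sup_\theta C_{\mathrm{hit}}^\theta$, $C_{\mathrm{tar}}=\sup_\theta C_{\mathrm{tar}}^\theta$. **Fisher matrix, NPG direction, errors.** $F(\theta)=\mathbb E_{(s,a)\sim\nu^{\pi_\theta}}[\nabla_\theta\log\pi_\theta(a|s)\nabla_\theta\log\pi_\theta(a|s)^\top]$, $\omega_\theta^*=F(\theta)^\dagger\nabla_\theta J(\theta)$. For a distribution $\nu$ on $\mathcal S\times\mathcal A$, $L_\nu(\omega,\theta)=\frac12\mathbb E_{(s,a)\sim\nu}[(A^{\pi_\theta}(s,a)-\omega^\top\nabla_\theta\log\pi_\theta(a|s))^2]$. With $\pi^*$ the optimal policy, $\epsilon_{\mathrm{bias}}=\sup_\theta L_{\nu^{\pi^*}}(\omega_\theta^*,\theta)$. The feature map satisfies $\|\phi(s)\|\le1$ for all $s$, and the features are linearly independent (the matrix $\Phi$ with rows $\phi(s)^\top$ has full rank). $\epsilon_{\mathrm{app}}=\sup_\theta\inf_{\zeta\in\mathbb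 R^m}\frac12\mathbb E_{s\sim d^{\pi_\theta}}[(V^{\pi_\theta}(s)-\zeta^\top\phi(s))^2]$. **Algorithm NAC-B.** Inputs: initial policy parameter $\theta_0$, initial critic iterates $\xi_0^k\in\mathbb R^{1+m}$ and NPG iterates $\omega_0^k\in\mathbb R^d$, stepsizes $\alpha$ (policy), $\beta,c_\beta$ (critic), $\gamma$ (NPG), number of epochs $K$, inner loop size $H$, batch size $B$, initial state $s_0\sim\rho$. It uses one uninterrupted trajectory. In each epoch $k=0,\dots,K-1$, $2HB$ consecutive transitions are generated under $\pi_{\theta_k}$, starting from the last state of the previous epoch; they are split into $2H$ consecutive batches of size $B$. The first $H$ batches are used for the critic, the next $H$ for the NPG. Denote by $z_b^{kh}=(s_b^{kh},a_b^{kh},s_{b+1}^{kh})$, $b=1,\dots,B$, the transitions of the $h$-th batch ($h=0,\dots,H-1$) of the relevant phase. Critic: for $h=0,\dots,H-1$, $\xi_{h+1}^k=\xi_h^k-\beta\,\frac1B\sum_{b=1}^B\big(A_v(\theta_k,z_b^{kh})\xi_h^k-b_v(\theta_k,z_b^{kh})\big)$, where for $z=(s,a,s')$ $$A_v(\theta,z)=\begin{bmatrix}c_\beta&0\\ \phi(s)&\phi(s)(\phi(s)-\phi(s'))^\top\end{bmatrix},\qquad b_v(\theta,z)=\begin{bmatrix}c_\beta r(s,a)\\ r(s,a)\phi(s)\end{bmatrix}.$$ Set $\xi_k=[\eta_k,\zeta_k^\top]^\top=\xi_H^k$. NPG: for $h=0,\dots,H-1$, $\omega_{h+1}^k=\omega_h^k-\gamma\,\frac1B\sum_{b=1}^B\big(A_u(\theta_k,z_b^{kh})\omega_h^k-b_u(\theta_k,\xi_k,z_b^{kh})\big)$,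 where $A_u(\theta,z)=\nabla_\theta\log\pi_\theta(a|s)\nabla_\theta\log\pi_\theta(a|s)^\top$ and $b_u(\theta,\xi,z)=\big(r(s,a)-\eta+\zeta^\top(\phi(s')-\phi(s))\big)\nabla_\theta\log\pi_\theta(a|s)$ for $\xi=[\eta,\zeta^\top]^\top$. Set $\omega_k=\omega_H^k$. Policy update: $\theta_{k+1}=\theta_k+\alpha\omega_k$. **Notation.** $\tilde{\mathcal O}$ hides factors polylogarithmic in $T$ and factors depending only on problem parameters not displayed in the bound (such as $G_1,G_2,L,\mu,\lambda,d,m$ and the initialization).
   Formalization: Assumes C_tar > 0 (claim fails if all policies have one recurrent state), Θ open, and that policy updates (with their segments) stay in Θ for all α, β, γ up to a fixed cap and all c_β > 0 (automatic for Θ = R^d); the lower constant in H = Θ(log T) must be large enough. *)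

(* Defs.v *)
From HB Require Import structures.
From mathcomp Require Import all_boot all_order all_algebra.
From mathcomp Require Import all_classical all_reals all_analysis.

Set Implicit Arguments.
Unset Strict Implicit.
Unset Printing Implicit Defensive.

Import Order.TTheory GRing.Theory Num.Theory.
Import numFieldNormedType.Exports.
Local Open Scope classical_set_scope.
Local Open Scope ring_scope.

(* Vectors of R^n are columns 'cV[R]_n.  The library norm on matrices is the sup
   norm, hence the Euclidean [enorm]. *)

Definition dotp (R : realType) (n : nat) (x y : 'cV[R]_n) : R :=
  (x^T *m y) 0 0.

Definition enorm (R : realType) (n : nat) (x : 'cV[R]_n) : R :=
  Num.sqrt (\sum_i x i 0 ^+ 2).

Definition psd (R : realType) (n : nat) (A : 'M[R]_n) : Prop :=
  A^T = A /\ forall x : 'cV[R]_n, 0 <= dotp x (A *m x).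

(* Partial derivatives; used at points where f is differentiable. *)
Definition grad (R : realType) (n : nat) (f : 'cV[R]_n -> R) (x : 'cV[R]_n) :
  'cV[R]_n := \col_i 'D_(delta_mx i 0) f x.

Definition is_moore_penrose (R : realType) (n : nat) (A X : 'M[R]_n) : Prop :=
  [/\ A *m X *m A = A, X *m A *m X = X,
      (A *m X)^T = A *m X & (X *m A)^T = X *m A].

(* The library's [pinvmx] is only a generalized inverse, not the Moore-Penrose
   one. *)
Definition moore_penrose (R : realType) (n : nat) (A : 'M[R]_n) : 'M[R]_n :=
  xget 0 [set X | is_moore_penrose A X].

Definition is_dist (R : realType) (T : finType) (p : T -> R) : Prop :=
  (forall x, 0 <= p x) /\ \sum_x p x = 1.

Definition accessible (R : realType) (S : finType) (P : S -> S -> R) : rel S :=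
  connect (fun s s' => 0 < P s s').

(* A state of a finite chain is recurrent when it is accessible from every
   state accessible from it. *)
Definition recurrent_states (R : realType) (S : finType) (P : S -> S -> R) :
  {set S} :=
  [set s | [forall s', accessible P s s' ==> accessible P s' s]].

(* Accessibility is an equivalence on recurrent states; its classes are the
   recurrent classes. *)
Definition unichain (R : realType) (S : finType) (P : S -> S -> R) : Prop :=
  (exists s, s \in recurrent_states P) /\
  {in recurrent_states P &, forall s s', accessible P s s'}.

Definition is_stationary (R : realType) (S : finType) (P : S -> S -> R)
    (d : S -> R) : Prop :=
  is_dist d /\ forall s', \sum_s d s * P s s' = d s'.

(* Uniquely determined when P is unichain. *)
Definition stat_dist (R : realType) (S : finType) (P : S -> S -> R) : S -> R :=
  xget (fun=> 0) [set d : S -> R | is_stationary P d].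

(* Law of (s_0, ..., s_t) for the chain started at s. *)
Definition path_prob (R : realType) (S : finType) (P : S -> S -> R) (s : S)
    (t : nat) (x : {ffun 'I_t.+1 -> S}) : R :=
  (x ord0 == s)%:R *
  \prod_(i < t) P (x (widen_ord (leqnSn t) i)) (x (lift ord0 i)).

(* P_s(T = t), where T = inf {t >= 0 : s_t \in X}. *)
Definition hit_prob (R : realType) (S : finType) (P : S -> S -> R)
    (X : {set S}) (s : S) (t : nat) : R :=
  \sum_(x : {ffun 'I_t.+1 -> S} |
      (x ord_max \in X) && [forall i : 'I_t, x (widen_ord (leqnSn t) i) \notin X])
    path_prob P s x.

(* E_s[T] = \sum_t t P_s(T = t) + (+oo) P_s(T = +oo), with 0 * +oo = 0. *)
Definition hit_time (R : realType) (S : finType) (P : S -> S -> R)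
    (X : {set S}) (s : S) : \bar R :=
  (\sum_(0 <= t <oo) (t%:R * hit_prob P X s t)%:E +
   +oo * (1 - \sum_(0 <= t <oo) (hit_prob P X s t)%:E))%E.

Definition chit_chain (R : realType) (S : finType) (P : S -> S -> R) : \bar R :=
  \big[maxe/-oo%E]_(s : S) hit_time P (recurrent_states P) s.

(* The terms with d(s') = 0 vanish, again because 0 * +oo = 0. *)
Definition ctar_chain (R : realType) (S : finType) (P : S -> S -> R) : \bar R :=
  if [pick s in recurrent_states P] is Some s
  then (\sum_(s' : S) (stat_dist P s')%:E * hit_time P [set s'] s)%E
  else 0%E.

Record mdp (R : realType) (S A : finType) := MDP {
  reward : S -> A -> R;
  kernel : S -> A -> S -> R;
  init : S -> R;
  reward_ge0_le1 : forall s a, 0 <= reward s a <= 1;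
  kernel_dist : forall s a, is_dist (kernel s a);
  init_dist : is_dist init }.

Definition is_policy (R : realType) (S A : finType) (pi : S -> A -> R) : Prop :=
  forall s, is_dist (pi s).

Definition pol_chain (R : realType) (S A : finType) (M : mdp R S A)
    (pi : S -> A -> R) (s s' : S) : R :=
  \sum_a kernel M s a s' * pi s a.

Definition pol_stat (R : realType) (S A : finType) (M : mdp R S A)
    (pi : S -> A -> R) : S -> R := stat_dist (pol_chain M pi).

Definition occ (R : realType) (S A : finType) (d : S -> R) (pi : S -> A -> R)
    (s : S) (a : A) : R := d s * pi s a.

Definition esa (R : realType) (S A : finType) (nu : S -> A -> R)
    (V : lmodType R) (f : S -> A -> V) : V :=
  \sum_s \sum_a nu s a *: f s a.

Definition avg_reward (R : realType) (S A : finType) (M : mdp R S A)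
    (pi : S -> A -> R) : R :=
  esa (occ (pol_stat M pi) pi) (fun s a => reward M s a : R^o).

Definition q_of (R : realType) (S A : finType) (M : mdp R S A)
    (pi : S -> A -> R) (V : S -> R) (s : S) (a : A) : R :=
  reward M s a - avg_reward M pi + \sum_s' kernel M s a s' * V s'.

Definition is_value (R : realType) (S A : finType) (M : mdp R S A)
    (pi : S -> A -> R) (V : S -> R) : Prop :=
  (forall s, V s = \sum_a pi s a * q_of M pi V s a) /\
  \sum_s pol_stat M pi s * V s = 0.

(* Uniquely determined when the chain induced by pi is unichain. *)
Definition value (R : realType) (S A : finType) (M : mdp R S A)
    (pi : S -> A -> R) : S -> R :=
  xget (fun=> 0) [set V : S -> R | is_value M pi V].

Definition qvalue (R : realType) (S A : finType) (M : mdp R S A)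
    (pi : S -> A -> R) : S -> A -> R := q_of M pi (value M pi).

Definition advantage (R : realType) (S A : finType) (M : mdp R S A)
    (pi : S -> A -> R) (s : S) (a : A) : R :=
  qvalue M pi s a - value M pi s.

Definition Jfun (R : realType) (S A : finType) (M : mdp R S A) (d : nat)
    (pi : 'cV[R]_d -> S -> A -> R) (theta : 'cV[R]_d) : R :=
  avg_reward M (pi theta).

Definition Jstar (R : realType) (S A : finType) (M : mdp R S A) (d : nat)
    (Theta : set 'cV[R]_d) (pi : 'cV[R]_d -> S -> A -> R) : R :=
  sup [set Jfun M pi theta | theta in Theta].

Definition score (R : realType) (S A : finType) (d : nat)
    (pi : 'cV[R]_d -> S -> A -> R) (theta : 'cV[R]_d) (s : S) (a : A) :
  'cV[R]_d := grad (fun t => ln (pi t s a)) theta.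

Definition fisher (R : realType) (S A : finType) (M : mdp R S A) (d : nat)
    (pi : 'cV[R]_d -> S -> A -> R) (theta : 'cV[R]_d) : 'M[R]_d :=
  esa (occ (pol_stat M (pi theta)) (pi theta))
    (fun s a => score pi theta s a *m (score pi theta s a)^T).

Definition npg (R : realType) (S A : finType) (M : mdp R S A) (d : nat)
    (pi : 'cV[R]_d -> S -> A -> R) (theta : 'cV[R]_d) : 'cV[R]_d :=
  moore_penrose (fisher M pi theta) *m grad (Jfun M pi) theta.

Definition compat_loss (R : realType) (S A : finType) (M : mdp R S A) (d : nat)
    (pi : 'cV[R]_d -> S -> A -> R) (nu : S -> A -> R)
    (omega theta : 'cV[R]_d) : R :=
  2^-1 * esa nu (fun s a =>
    (advantage M (pi theta) s a - dotp omega (score pi theta s a)) ^+ 2 : R^o).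

(* The suprema over Theta below are taken in \bar R: they may be infinite. *)
Definition eps_bias (R : realType) (S A : finType) (M : mdp R S A) (d : nat)
    (Theta : set 'cV[R]_d) (pi : 'cV[R]_d -> S -> A -> R)
    (nustar : S -> A -> R) : \bar R :=
  ereal_sup [set (compat_loss M pi nustar (npg M pi theta) theta)%:E
            | theta in Theta].

Definition eps_app (R : realType) (S A : finType) (M : mdp R S A) (d m : nat)
    (Theta : set 'cV[R]_d) (pi : 'cV[R]_d -> S -> A -> R)
    (phi : S -> 'cV[R]_m) : \bar R :=
  ereal_sup [set (inf [set 2^-1 * \sum_s pol_stat M (pi theta) s *
                         (value M (pi theta) s - dotp zeta (phi s)) ^+ 2
                      | zeta in [set: 'cV[R]_m]])%:E
            | theta in Theta].

Definition C_hit (R : realType) (S A : finType) (M : mdp R S A) (d : nat)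
    (Theta : set 'cV[R]_d) (pi : 'cV[R]_d -> S -> A -> R) : \bar R :=
  ereal_sup [set chit_chain (pol_chain M (pi theta)) | theta in Theta].

Definition C_tar (R : realType) (S A : finType) (M : mdp R S A) (d : nat)
    (Theta : set 'cV[R]_d) (pi : 'cV[R]_d -> S -> A -> R) : \bar R :=
  ereal_sup [set ctar_chain (pol_chain M (pi theta)) | theta in Theta].

Definition feature_mx (R : realType) (S : finType) (m : nat)
    (phi : S -> 'cV[R]_m) : 'M[R]_(#|S|, m) :=
  \matrix_(i < #|S|, j < m) phi (enum_val i) j 0.

Definition critic_mx (R : realType) (S A : finType) (M : mdp R S A) (m : nat)
    (pi : S -> A -> R) (phi : S -> 'cV[R]_m) : 'M[R]_m :=
  \sum_s \sum_s' (pol_stat M pi s * pol_chain M pi s s') *: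
    (phi s *m (phi s - phi s')^T).

Definition in_ker_orth (R : realType) (n : nat) (A : 'M[R]_n) (x : 'cV[R]_n) :
  Prop := forall y : 'cV[R]_n, A *m y = 0 -> dotp y x = 0.

(* (s, a, s') *)
Definition transition (S A : finType) : Type := (S * A * S)%type.

Record nac_steps (R : realType) := NacSteps {
  alpha : R; beta : R; cbeta : R; gamma : R }.

Record nac_init (R : realType) (d m : nat) := NacInit {
  theta0 : 'cV[R]_d;
  xi0 : nat -> 'cV[R]_(1 + m);
  omega0 : nat -> 'cV[R]_d }.

Definition Av (R : realType) (S A : finType) (m : nat) (phi : S -> 'cV[R]_m)
    (cb : R) (z : transition S A) : 'M[R]_(1 + m) :=
  let: (s, a, s') := z in
  block_mx cb%:M 0 (phi s) (phi s *m (phi s - phi s')^T).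

Definition bv (R : realType) (S A : finType) (M : mdp R S A) (m : nat)
    (phi : S -> 'cV[R]_m) (cb : R) (z : transition S A) : 'cV[R]_(1 + m) :=
  let: (s, a, s') := z in
  col_mx (cb * reward M s a)%:M (reward M s a *: phi s).

Definition Au (R : realType) (S A : finType) (d : nat)
    (pi : 'cV[R]_d -> S -> A -> R) (theta : 'cV[R]_d) (z : transition S A) :
  'M[R]_d :=
  let: (s, a, s') := z in score pi theta s a *m (score pi theta s a)^T.

Definition bu (R : realType) (S A : finType) (M : mdp R S A) (d m : nat)
    (pi : 'cV[R]_d -> S -> A -> R) (phi : S -> 'cV[R]_m) (theta : 'cV[R]_d)
    (xi : 'cV[R]_(1 + m)) (z : transition S A) : 'cV[R]_d :=
  let: (s, a, s') := z in
  let eta := usubmx xi 0 0 in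
  let zeta := dsubmx xi in
  (reward M s a - eta + dotp zeta (phi s' - phi s)) *: score pi theta s a.

(* [z] lists the transitions of the run in order; the batches of size B are
   numbered consecutively from 0 along the whole run. *)
Definition batch (S A : finType) (B : nat) (z : seq (transition S A)) (j : nat) :
  seq (transition S A) := take B (drop (j * B) z).

(* One averaged step x - eta / B * \sum_b (A(z_b) x - b(z_b)). *)
Definition batch_step (R : realType) (S A : finType) (n B : nat)
    (eta : R) (mA : transition S A -> 'M[R]_n) (vb : transition S A -> 'cV[R]_n)
    (zs : seq (transition S A)) (x : 'cV[R]_n) : 'cV[R]_n :=
  x - eta *: (B%:R^-1 *: \sum_(z <- zs) (mA z *m x - vb z)).

(* Epoch k uses batches 2Hk, ..., 2Hk + H - 1 for the critic and
   2Hk + H, ..., 2Hk + 2H - 1 for the NPG. *)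
Fixpoint critic_iter (R : realType) (S A : finType) (M : mdp R S A) (m : nat)
    (phi : S -> 'cV[R]_m) (p : nac_steps R) (H B : nat)
    (z : seq (transition S A)) (k : nat) (x0 : 'cV[R]_(1 + m)) (h : nat) :
  'cV[R]_(1 + m) :=
  if h is h'.+1 then
    batch_step B (beta p) (Av phi (cbeta p)) (bv M phi (cbeta p))
      (batch B z (2 * H * k + h'))
      (critic_iter M phi p H B z k x0 h')
  else x0.

Fixpoint npg_iter (R : realType) (S A : finType) (M : mdp R S A) (d m : nat)
    (pi : 'cV[R]_d -> S -> A -> R) (phi : S -> 'cV[R]_m) (p : nac_steps R)
    (H B : nat) (z : seq (transition S A)) (k : nat) (theta : 'cV[R]_d)
    (xi : 'cV[R]_(1 + m)) (w0 : 'cV[R]_d) (h : nat) : 'cV[R]_d :=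
  if h is h'.+1 then
    batch_step B (gamma p) (Au pi theta) (bu M pi phi theta xi)
      (batch B z (2 * H * k + H + h'))
      (npg_iter M pi phi p H B z k theta xi w0 h')
  else w0.

(* omega_k, as a function of theta_k. *)
Definition nac_dir (R : realType) (S A : finType) (M : mdp R S A) (d m : nat)
    (pi : 'cV[R]_d -> S -> A -> R) (phi : S -> 'cV[R]_m) (p : nac_steps R)
    (i0 : nac_init R d m) (H B : nat) (z : seq (transition S A)) (k : nat)
    (theta : 'cV[R]_d) : 'cV[R]_d :=
  npg_iter M pi phi p H B z k theta
    (critic_iter M phi p H B z k (xi0 i0 k) H) (omega0 i0 k) H.

(* theta_k: depends on z only through its first 2HBk transitions. *)
Fixpoint nac_theta (R : realType) (S A : finType) (M : mdp R S A) (d m : nat)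
    (pi : 'cV[R]_d -> S -> A -> R) (phi : S -> 'cV[R]_m) (p : nac_steps R)
    (i0 : nac_init R d m) (H B : nat) (z : seq (transition S A)) (k : nat) :
  'cV[R]_d :=
  if k is k'.+1 then
    let theta := nac_theta M pi phi p i0 H B z k' in
    theta + alpha p *: nac_dir M pi phi p i0 H B z k' theta
  else theta0 i0.

Definition cur_state (S : finType) (T : nat) (x : {ffun 'I_T.+1 -> S})
    (t : 'I_T) : S := x (widen_ord (leqnSn T) t).

Definition next_state (S : finType) (T : nat) (x : {ffun 'I_T.+1 -> S})
    (t : 'I_T) : S := x (lift ord0 t).

Definition transitions (S A : finType) (T : nat) (x : {ffun 'I_T.+1 -> S})
    (a : {ffun 'I_T -> A}) : seq (transition S A) :=
  [seq (cur_state x t, a t, next_state x t) | t <- enum 'I_T].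

(* Probability of s_0, a_0, s_1, ..., a_(T-1), s_T; step t belongs to epoch
   t %/ (2HB). *)
Definition run_prob (R : realType) (S A : finType) (M : mdp R S A) (d m : nat)
    (pi : 'cV[R]_d -> S -> A -> R) (phi : S -> 'cV[R]_m) (p : nac_steps R)
    (i0 : nac_init R d m) (H B T : nat) (x : {ffun 'I_T.+1 -> S})
    (a : {ffun 'I_T -> A}) : R :=
  init M (x ord0) *
  \prod_(t < T)
    (pi (nac_theta M pi phi p i0 H B (transitions x a) (t %/ (2 * H * B)))
       (cur_state x t) (a t) *
     kernel M (cur_state x t) (a t) (next_state x t)).

Definition expected_regret (R : realType) (S A : finType) (M : mdp R S A)
    (d m : nat) (Theta : set 'cV[R]_d) (pi : 'cV[R]_d -> S -> A -> R)
    (phi : S -> 'cV[R]_m) (p : nac_steps R) (i0 : nac_init R d m)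
    (H B T : nat) : R :=
  \sum_(x : {ffun 'I_T.+1 -> S}) \sum_(a : {ffun 'I_T -> A})
    run_prob M pi phi p i0 H B x a *
    \sum_(t < T) (Jstar M Theta pi - reward M (cur_state x t) (a t)).

Definition feasible (R : realType) (S A : finType) (M : mdp R S A) (T : nat)
    (x : {ffun 'I_T.+1 -> S}) (a : {ffun 'I_T -> A}) : Prop :=
  0 < init M (x ord0) /\
  forall t : 'I_T, 0 < kernel M (cur_state x t) (a t) (next_state x t).

Definition admissible_steps (R : realType) (cap : R) (p : nac_steps R) : Prop :=
  [/\ 0 < alpha p <= cap, 0 < beta p <= cap, 0 < cbeta p & 0 < gamma p <= cap].

(* The algorithm has no projection step, so it is meaningful only if the policy
   updates never leave Theta (automatic when Theta is the whole space). *)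
Definition updates_stay (R : realType) (S A : finType) (M : mdp R S A)
    (d m : nat) (Theta : set 'cV[R]_d) (pi : 'cV[R]_d -> S -> A -> R)
    (phi : S -> 'cV[R]_m) (i0 : nac_init R d m) (cap : R) (K H B T : nat) :
  Prop :=
  forall p : nac_steps R, admissible_steps cap p ->
  forall (x : {ffun 'I_T.+1 -> S}) (a : {ffun 'I_T -> A}), feasible M x a ->
  forall (k : nat) (u : R), (k < K)%N -> 0 <= u <= 1 ->
  let z := transitions x a in
  let theta := nac_theta M pi phi p i0 H B z k in
  Theta (theta + (u * alpha p) *: nac_dir M pi phi p i0 H B z k theta).

Definition is_Theta (R : realType) (c1 c2 x y : R) : Prop :=
  c1 * y <= x <= c2 * y.

(* Theta is open, so that derivatives on Theta make sense; positivity is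
   implicit in the use of log pi. *)
Definition policy_class (R : realType) (S A : finType) (d : nat)
    (Theta : set 'cV[R]_d) (pi : 'cV[R]_d -> S -> A -> R) : Prop :=
  open Theta /\
  forall theta, Theta theta ->
    [/\ is_policy (pi theta), forall s a, 0 < pi theta s a &
        forall s a, differentiable (fun t => pi t s a) theta].

Definition bounded_lipschitz_score (R : realType) (S A : finType) (d : nat)
    (Theta : set 'cV[R]_d) (pi : 'cV[R]_d -> S -> A -> R) (G1 G2 : R) : Prop :=
  (forall theta s a, Theta theta -> enorm (score pi theta s a) <= G1) /\
  (forall theta1 theta2 s a, Theta theta1 -> Theta theta2 ->
     enorm (score pi theta1 s a - score pi theta2 s a) <=
       G2 * enorm (theta1 - theta2)).

Definition smooth_on (R : realType) (d : nat) (Theta : set 'cV[R]_d)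
    (f : 'cV[R]_d -> R) (L : R) : Prop :=
  (forall theta, Theta theta -> differentiable f theta) /\
  (forall theta1 theta2, Theta theta1 -> Theta theta2 ->
     enorm (grad f theta1 - grad f theta2) <= L * enorm (theta1 - theta2)).

(* [pistar], with stationary distribution [dstar], is at least as good as every
   policy of the class; it need not belong to the class. *)
Definition optimal_policy (R : realType) (S A : finType) (M : mdp R S A)
    (d : nat) (Theta : set 'cV[R]_d) (pi : 'cV[R]_d -> S -> A -> R)
    (pistar : S -> A -> R) (dstar : S -> R) : Prop :=
  [/\ is_policy pistar, is_stationary (pol_chain M pistar) dstar &
      forall theta, Theta theta ->
        Jfun M pi theta <=
          esa (occ dstar pistar) (fun s a => reward M s a : R^o)].

(* Main.v *)
(* Mixing is used only through the Poisson equation g - P g = f - d(f): with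
   h_x(s) = E_s[T_x], the function - sum_x d(x) f(x) h_x solves it, whence a
   solution bounded by 2 (C_tar + C_hit) |f|.  By the martingale decomposition,
   the mean of a batch of size B has bias O(C / B) and variance O(C^2 / B),
   whatever the initial state, periodicity included.

   With c_beta = 1 / beta the reward estimate is the mean reward of the last
   batch.  On ker(M)^perp the critic contracts, its bias being controlled by
   duality; only this component matters, because a v with M v = 0 has
   v . phi(s) constant on the recurrent states.  Conditionally on the critic,
   the NPG iteration contracts towards F^-1 times the mean TD direction.  Hence,
   in one epoch and up to logarithms, E|omega_k - omega*|^2 = O(C^2 / B + eps_app)
   and |E[omega_k - omega*]| = O(C^2 / B + sqrt eps_app).

   For the cross-entropy Phi(theta) = E_{nu*}[- ln pi_theta], the score bounds
   and the performance difference formula give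
     J* - J(theta_k) <= (Phi(theta_k) - E Phi(theta_(k+1))) / alpha
                        + sqrt(2 eps_bias) + O(errors) + O(alpha |omega*|^2),
   and the last term is absorbed by the increase of J, of order
   alpha mu |omega*|^2.  So Phi / alpha - const * J telescopes over the epochs;
   within an epoch the rewards deviate from J(theta_k) by O(C) in total. *)

Require Import Defs.
From HB Require Import structures.
From mathcomp Require Import all_boot all_order all_algebra.
From mathcomp Require Import all_classical all_reals all_analysis.
From mathcomp Require Import ring lra.
Set Implicit Arguments.
Unset Strict Implicit.
Unset Printing Implicit Defensive.
Import Order.TTheory GRing.Theory Num.Theory.
Import numFieldNormedType.Exports.
Local Open Scope classical_set_scope.
Local Open Scope ring_scope.
(* mathcomp-analysis has another [kernel]. *)
Local Notation kernel := (@Defs.kernel _ _ _).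

(** * Euclidean vectors *)

(** The sensitive quantity is the bias. The cross-entropy step is linear in the error of omega_k,
    and an error of the size of the standard deviation, C / sqrt B, would cost T^(3/4) over the run.
    Hence the separate estimate of the mean, in which each step is moved onto the test vector
    through the adjoint matrix, so that only batch biases accumulate. The critic component along
    ker(M) is not damped; its second moment is only shown to be O(H^2), which suffices because it
    always appears multiplied by the batch error. All constants must be uniform in the MDP, so each
    is fixed before the chain appears: alpha, beta and gamma do not depend on T, and h0 is so large
    that H >= h0 ln T contracts the initial errors to O(1 / T). The batch error must moreover be
    small against 1 / H and gamma mu, which no hypothesis provides; where this fails, the claimed
    bound exceeds T, and T always bounds the regret. Extended values come last: an infinite constant
    makes the right side infinite because C_tar > 0. *)

Section Euclid.
Variables (R : realType) (n : nat).
Implicit Types (x y z : 'cV[R]_n) (a : R).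

Lemma dotpE x y : dotp x y = \sum_i x i 0 * y i 0.
Proof. by rewrite /dotp mxE; apply: eq_bigr => i _; rewrite mxE. Qed.

Lemma dotpC x y : dotp x y = dotp y x.
Proof. by rewrite !dotpE; apply: eq_bigr => i _; rewrite mulrC. Qed.

Lemma dotpDl x y z : dotp (x + y) z = dotp x z + dotp y z.
Proof. by rewrite /dotp linearD mulmxDl mxE. Qed.

Lemma dotpDr x y z : dotp z (x + y) = dotp z x + dotp z y.
Proof. by rewrite /dotp mulmxDr mxE. Qed.

Lemma dotpZl a x y : dotp (a *: x) y = a * dotp x y.
Proof. by rewrite /dotp linearZ -scalemxAl mxE. Qed.

Lemma dotpZr a x y : dotp y (a *: x) = a * dotp y x.
Proof. by rewrite /dotp -scalemxAr mxE. Qed.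

Lemma dotpNl x y : dotp (- x) y = - dotp x y.
Proof. by rewrite -scaleN1r dotpZl mulN1r. Qed.

Lemma dotpNr x y : dotp x (- y) = - dotp x y.
Proof. by rewrite -scaleN1r dotpZr mulN1r. Qed.

Lemma dotpBl x y z : dotp (x - y) z = dotp x z - dotp y z.
Proof. by rewrite dotpDl dotpNl. Qed.

Lemma dotpBr x y z : dotp z (x - y) = dotp z x - dotp z y.
Proof. by rewrite dotpDr dotpNr. Qed.

Lemma dotp0l x : dotp 0 x = 0.
Proof. by rewrite -(scale0r x) dotpZl mul0r. Qed.

Lemma dotp0r x : dotp x 0 = 0.
Proof. by rewrite dotpC dotp0l. Qed.

Lemma dotp_suml (I : Type) (r : seq I) (Q : pred I) (f : I -> 'cV[R]_n) y :
  dotp (\sum_(i <- r | Q i) f i) y = \sum_(i <- r | Q i) dotp (f i) y.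
Proof.
by elim/big_ind2: _ => [|a u b v <- <-|//]; rewrite ?dotp0l ?dotpDl.
Qed.

Lemma dotp_sumr (I : Type) (r : seq I) (Q : pred I) (f : I -> 'cV[R]_n) y :
  dotp y (\sum_(i <- r | Q i) f i) = \sum_(i <- r | Q i) dotp y (f i).
Proof. by rewrite dotpC dotp_suml; apply: eq_bigr => i _; rewrite dotpC. Qed.

Lemma dotp_ge0 x : 0 <= dotp x x.
Proof. by rewrite dotpE sumr_ge0// => i _; rewrite -expr2 sqr_ge0. Qed.

Lemma dotp_eq0 x : dotp x x = 0 -> x = 0.
Proof.
rewrite dotpE => /eqP; rewrite psumr_eq0 => [/allP h|i _]; last first.
  by rewrite -expr2 sqr_ge0.
apply/colP => i; rewrite mxE; have := h i (mem_index_enum _).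
by rewrite -expr2 sqrf_eq0 => /eqP.
Qed.

Lemma enorm_sqr x : enorm x ^+ 2 = dotp x x.
Proof.
rewrite /enorm sqr_sqrtr ?dotpE; first by apply: eq_bigr => i _; rewrite expr2.
by apply: sumr_ge0 => i _; rewrite sqr_ge0.
Qed.

Lemma enorm_ge0 x : 0 <= enorm x.
Proof. exact: sqrtr_ge0. Qed.

Lemma enorm_le a x : 0 <= a -> dotp x x <= a ^+ 2 -> enorm x <= a.
Proof.
by move=> a0 h; rewrite -(ler_pXn2r (n:=2)) ?nnegrE ?enorm_ge0// enorm_sqr.
Qed.

Lemma enormZ a x : enorm (a *: x) = `|a| * enorm x.
Proof.
apply/eqP; rewrite -(eqrXn2 (n:=2))// ?mulr_ge0 ?enorm_ge0//.
by rewrite exprMn !enorm_sqr dotpZl dotpZr mulrA -expr2 real_normK ?num_real.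
Qed.

Lemma enormN x : enorm (- x) = enorm x.
Proof. by rewrite -scaleN1r enormZ normrN1 mul1r. Qed.

Lemma dotp_sqr_le x y : dotp x y ^+ 2 <= dotp x x * dotp y y.
Proof.
have [y0|y0] := eqVneq (dotp y y) 0.
  by rewrite (dotp_eq0 y0) !dotp0r expr0n mulr0.
have yp : 0 < dotp y y by rewrite lt_neqAle eq_sym y0 dotp_ge0.
have := dotp_ge0 (dotp y y *: x - dotp x y *: y).
rewrite !(dotpBl, dotpBr, dotpZl, dotpZr) (dotpC y x) => h.
by rewrite -(ler_pM2l yp); nra.
Qed.

Lemma dotp_norm_le x y : `|dotp x y| <= enorm x * enorm y.
Proof.
rewrite -(ler_pXn2r (n:=2)) ?nnegrE ?mulr_ge0 ?enorm_ge0//.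
by rewrite real_normK ?num_real// exprMn !enorm_sqr dotp_sqr_le.
Qed.

Lemma dotp_le_enorm x y : dotp x y <= enorm x * enorm y.
Proof. exact: le_trans (ler_norm _) (dotp_norm_le x y). Qed.

Lemma enormD x y : enorm (x + y) <= enorm x + enorm y.
Proof.
apply: enorm_le; first by rewrite addr_ge0 ?enorm_ge0.
rewrite !(dotpDl, dotpDr) (dotpC y x) sqrrD -!enorm_sqr.
by have := dotp_le_enorm x y; lra.
Qed.

Lemma enormB x y : enorm (x - y) <= enorm x + enorm y.
Proof. by rewrite -(enormN y) enormD. Qed.

Lemma sqr_enormD x y : enorm (x + y) ^+ 2 <= 2 * enorm x ^+ 2 + 2 * enorm y ^+ 2.
Proof.
have h := enormD x y; have := enorm_ge0 (x + y).
have := enorm_ge0 x; have := enorm_ge0 y; have := sqr_ge0 (enorm x - enorm y).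
by rewrite sqrrB => h1 h2 h3 h4; have : enorm (x + y) ^+ 2 <= (enorm x + enorm y) ^+ 2;
   [rewrite ler_pXn2r ?nnegrE ?addr_ge0|rewrite sqrrD; lra].
Qed.

Lemma enorm_coord x i : `|x i 0| <= enorm x.
Proof.
rewrite -(ler_pXn2r (n:=2)) ?nnegrE ?enorm_ge0// enorm_sqr dotpE real_normK ?num_real//.
by rewrite (bigD1 i)//= -expr2 lerDl sumr_ge0// => j _; rewrite -expr2 sqr_ge0.
Qed.

Lemma dotp_delta x i : dotp (delta_mx i 0) x = x i 0.
Proof.
rewrite dotpE (bigD1 i)//= mxE !eqxx mul1r big1 ?addr0// => j ji.
by rewrite mxE (negPf ji) mul0r.
Qed.

Lemma dotp_inj x y : (forall u, dotp u x = dotp u y) -> x = y.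
Proof. by move=> h; apply/colP => i; rewrite -!dotp_delta h. Qed.

(** Test with [u = x]. Through this lemma, norms of means and of matrix products are bounded by
    scalar expectations, in which adjoints and stationarity can be used. *)
Lemma enorm_dual x a : 0 <= a -> (forall u, dotp u x <= a * enorm u) -> enorm x <= a.
Proof.
move=> a0 /(_ x); rewrite -enorm_sqr => h.
have [->//|x0] := eqVneq (enorm x) 0.
by rewrite -(ler_pM2r (x:=enorm x)) ?lt_neqAle 1?eq_sym ?x0 ?enorm_ge0// -expr2.
Qed.

End Euclid.

Section MxDotp.
Variable R : realType.

Lemma dotp_mulmx n k (x : 'cV[R]_n) (A : 'M[R]_(n, k)) (y : 'cV[R]_k) :
  dotp x (A *m y) = dotp (A^T *m x) y.
Proof. by rewrite /dotp trmx_mul trmxK mulmxA. Qed.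

Lemma mulmx_dotp n k (x : 'cV[R]_n) (u v : 'cV[R]_k) :
  x *m u^T *m v = dotp u v *: x.
Proof. by rewrite -mulmxA [u^T *m v]mx11_scalar mul_mx_scalar. Qed.

(* The orthogonal projection onto the range of N is N (N^T N)^-1 N^T. *)
Lemma orth_proj_kernel n (A : 'M[R]_n) :
  exists Q : 'M[R]_n, [/\ Q^T = Q, Q *m Q = Q, A *m Q = 0 &
    forall x : 'cV[R]_n, A *m x = 0 -> Q *m x = x].
Proof.
pose K := row_base (kermx A^T); pose N := K^T.
have AN : A *m N = 0.
  apply: trmx_inj; rewrite trmx_mul trmxK trmx0; apply/sub_kermxP.
  by rewrite eq_row_base.
have NN : N^T *m N \in unitmx.
  rewrite unitmxE unitfE -det_tr; apply/det0P => -[v v0 hv].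
  have hv' : N^T *m N *m v^T = 0.
    by apply: trmx_inj; rewrite trmx_mul trmxK trmx0.
  have Nv : N *m v^T = 0.
    apply: dotp_eq0; rewrite dotp_mulmx mulmxA hv'.
    by rewrite dotp0l.
  have : v *m K = 0 by apply: trmx_inj; rewrite trmx_mul trmx0.
  by move/eqP; rewrite mulmx_free_eq0 ?row_base_free// (negPf v0).
exists (N *m invmx (N^T *m N) *m N^T); split.
- by rewrite !trmx_mul trmxK trmx_inv trmx_mul trmxK mulmxA.
- by rewrite -!mulmxA (mulmxA N^T) (mulmxA (N^T *m N)) mulmxV// mul1mx.
- by rewrite !mulmxA AN !mul0mx.
- move=> x Ax.
  have : (x^T <= K)%MS.
    by rewrite eq_row_base; apply/sub_kermxP; rewrite -trmx_mul Ax trmx0.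
  case/submxP => w xw; have -> : x = N *m w^T.
    by apply: trmx_inj; rewrite trmx_mul !trmxK.
  by rewrite -!mulmxA (mulmxA N^T) (mulmxA (invmx _)) mulVmx// mul1mx.
Qed.

End MxDotp.

(** * Finite Markov chains and hitting times *)

Definition fcons (T : finType) (n : nat) (t : T) (y : {ffun 'I_n -> T}) :
  {ffun 'I_n.+1 -> T} := [ffun i => if unlift ord0 i is Some j then y j else t].

Lemma fcons0 (T : finType) n t (y : {ffun 'I_n -> T}) : fcons t y ord0 = t.
Proof. by rewrite ffunE unlift_none. Qed.

Lemma fconsS (T : finType) n t (y : {ffun 'I_n -> T}) i :
  fcons t y (lift ord0 i) = y i.
Proof. by rewrite ffunE liftK. Qed.

(** Splits off the first state of a path: the basis of every first-step analysis below. *)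
Lemma big_ffun_cons (V : nmodType) (T : finType) n (F : {ffun 'I_n.+1 -> T} -> V) :
  \sum_x F x = \sum_t \sum_(y : {ffun 'I_n -> T}) F (fcons t y).
Proof.
rewrite pair_big /= (reindex (fun p : T * {ffun 'I_n -> T} => fcons p.1 p.2)) //=.
exists (fun x => (x ord0, [ffun i => x (lift ord0 i)])) => [[t y] _|x _] /=.
  by rewrite fcons0; congr pair; apply/ffunP => i; rewrite ffunE fconsS.
by apply/ffunP => i; rewrite ffunE; case: unliftP => [j|] ->; rewrite ?ffunE.
Qed.

Lemma big_ffun0 (V : nmodType) (T : finType) (F : {ffun 'I_0 -> T} -> V) x :
  \sum_x F x = F x.
Proof.
rewrite (bigD1 x)//= big1 ?addr0// => y /eqP; case.
by apply/ffunP => -[].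
Qed.

Lemma fcons_widen (T : finType) n t (y : {ffun 'I_n.+1 -> T}) (i : 'I_n) :
  fcons t y (widen_ord (leqnSn n.+1) (lift ord0 i)) = y (widen_ord (leqnSn n) i).
Proof.
have -> : widen_ord (leqnSn n.+1) (lift ord0 i) = lift ord0 (widen_ord (leqnSn n) i).
  exact: val_inj.
by rewrite fconsS.
Qed.

Lemma fcons_widen0 (T : finType) n t (y : {ffun 'I_n.+1 -> T}) :
  fcons t y (widen_ord (leqnSn n.+1) ord0) = t.
Proof. by rewrite (_ : widen_ord _ _ = ord0) ?fcons0//; exact: val_inj. Qed.

(** * Square linear systems indexed by a finite type *)

Section LinSolve.
Variables (R : realType) (S : finType).

Lemma sum_enum_val (F : S -> R) : \sum_(i < #|S|) F (enum_val i) = \sum_s F s.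
Proof. by rewrite -big_enum_val. Qed.

(** For a square system uniqueness implies existence; uniqueness will come from a maximum
    principle. *)
Lemma fun_solve (Q : S -> S -> R) :
  (forall v : S -> R, (forall s, \sum_u Q s u * v u = 0) -> forall s, v s = 0) ->
  forall c : S -> R, exists v : S -> R, forall s, \sum_u Q s u * v u = c s.
Proof.
move=> inj c.
pose A : 'M[R]_#|S| := \matrix_(i, j) Q (enum_val i) (enum_val j).
have Au : A \in unitmx.
  rewrite unitmxE unitfE -det_tr; apply/det0P => -[v v0 hv].
  have h : forall s, v 0 (enum_rank s) = 0.
    apply: (inj (fun s => v 0 (enum_rank s))) => s.
    have := congr1 (fun w : 'rV_#|S| => w 0 (enum_rank s)) hv.
    rewrite !mxE -sum_enum_val => hs; rewrite -[RHS]hs; apply: eq_bigr => i _.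
    by rewrite !mxE enum_rankK enum_valK mulrC.
  by case/eqP: v0; apply/rowP => i; rewrite mxE -(enum_valK i) h.
exists (fun s => (invmx A *m \col_i c (enum_val i)) (enum_rank s) 0) => s.
transitivity ((A *m (invmx A *m \col_i c (enum_val i))) (enum_rank s) 0).
  rewrite mxE -sum_enum_val; apply: eq_bigr => i _.
  by rewrite !mxE enum_rankK enum_valK.
by rewrite mulmxA mulmxV// mul1mx mxE enum_rankK.
Qed.

(** A matrix is singular together with its transpose. For [I - P], the constant right null vector
    yields a left one. *)
Lemma left_null (Q : S -> S -> R) (v : S -> R) :
  (exists s, v s != 0) -> (forall s, \sum_u Q s u * v u = 0) ->
  exists2 w : S -> R, (exists s, w s != 0) & forall u, \sum_s w s * Q s u = 0.
Proof.
move=> [s0 vs0] hv.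
pose A : 'M[R]_#|S| := \matrix_(i, j) Q (enum_val i) (enum_val j).
have : \det A == 0.
  rewrite -det_tr; apply/det0P; exists (\row_i v (enum_val i)).
    apply/eqP => /rowP /(_ (enum_rank s0)); rewrite !mxE enum_rankK.
    by move/eqP: vs0.
  apply/rowP => i; rewrite !mxE -[RHS](hv (enum_val i)) -sum_enum_val.
  by apply: eq_bigr => j _; rewrite !mxE mulrC.
move=> /det0P[w w0 hw]; exists (fun s => w 0 (enum_rank s)).
  apply: contrapT => h; case/eqP: w0; apply/rowP => i; rewrite mxE.
  apply/eqP; apply: contrapT => wi; apply: h; exists (enum_val i).
  by rewrite enum_valK; exact/negP.
move=> u; have := congr1 (fun x : 'rV_#|S| => x 0 (enum_rank u)) hw.
rewrite !mxE -sum_enum_val => hs; rewrite -[RHS]hs; apply: eq_bigr => i _.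
by rewrite !mxE enum_rankK enum_valK.
Qed.
End LinSolve.

Lemma connect_preserved (T : finType) (e : rel T) (Q : T -> Prop) x y :
  (forall u v, Q u -> e u v -> Q v) -> connect e x y -> Q x -> Q y.
Proof.
move=> h /connectP[p]; elim: p x => [x _ -> //|a p IH x /= /andP[xa pa] ly Qx].
exact: (IH a pa ly (h _ _ Qx xa)).
Qed.

Section Chain.
Variables (R : realType) (S : finType) (P : S -> S -> R).
Hypothesis Pdist : forall s, is_dist (P s).

Lemma kerP_ge0 s u : 0 <= P s u. Proof. by case: (Pdist s). Qed.
Lemma kerP_sum1 s : \sum_u P s u = 1. Proof. by case: (Pdist s). Qed.

Lemma kerP_cst s c : \sum_u P s u * c = c.
Proof. by rewrite -mulr_suml kerP_sum1 mul1r. Qed.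

Lemma kerP_le s f g : (forall u, f u <= g u) ->
  \sum_u P s u * f u <= \sum_u P s u * g u.
Proof. by move=> h; apply: ler_sum => u _; rewrite ler_wpM2l ?kerP_ge0. Qed.

(** At a positive maximum outside [X], the averaging inequality forces every successor to be a
    maximum too. Along a path to [X] this contradicts the sign on [X]. *)
Lemma max_principle (X : {set S}) (v : S -> R) :
  (forall s, exists2 x, x \in X & accessible P s x) ->
  (forall s, s \in X -> v s <= 0) ->
  (forall s, s \notin X -> v s <= \sum_u P s u * v u) ->
  forall s, v s <= 0.
Proof.
move=> acc vX vP s0; rewrite leNgt; apply/negP => vs0.
pose s1 := [arg max_(s > s0) v s]%O.
have s1max u : v u <= v s1.
  by rewrite /s1; case: arg_maxP => //= i _ h; exact: h.
have s1p : 0 < v s1 by exact: lt_le_trans vs0 (s1max _).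
have [x xX sx] := acc s1.
have vx : v x = v s1.
  apply: (connect_preserved (Q := fun u => v u = v s1) _ sx) => // u w vu Puw.
  have uX : u \notin X by apply: contraL s1p => /vX; rewrite vu leNgt.
  have := vP u uX; rewrite -(kerP_cst u (v u)) -subr_ge0 -sumrB => h.
  have h0 : \sum_i P u i * (v u - v i) == 0.
    rewrite eq_le; apply/andP; split; last first.
      apply: sumr_ge0 => i _; rewrite mulr_ge0 ?kerP_ge0// subr_ge0 vu.
      exact: s1max.
    rewrite -oppr_ge0 -sumrN; apply: le_trans h _; apply: ler_sum => i _.
    by rewrite mulrBr opprB.
  move: h0; rewrite psumr_eq0 => [/allP/(_ w (mem_index_enum _))|i _]; last first.
    by rewrite mulr_ge0 ?kerP_ge0// subr_ge0 vu s1max.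
  rewrite mulf_eq0 (gt_eqF Puw)/= subr_eq0 => /eqP <-; exact: vu.
by move: (vX x xX); rewrite vx leNgt s1p.
Qed.

Lemma max_principle_eq (X : {set S}) (v : S -> R) :
  (forall s, exists2 x, x \in X & accessible P s x) ->
  (forall s, s \in X -> v s = 0) ->
  (forall s, s \notin X -> v s = \sum_u P s u * v u) ->
  forall s, v s = 0.
Proof.
move=> acc vX vP s; apply/eqP; rewrite eq_le; apply/andP; split.
  apply: (max_principle acc) => [u /vX ->//|u /vP ->//].
rewrite -oppr_le0; apply: (max_principle (v := \- v) acc) => [u /vX /= ->|u /vP h].
  by rewrite oppr0.
by rewrite /= h -sumrN; apply: ler_sum => i _; rewrite mulrN.
Qed.

Lemma dirichlet_solve (X : {set S}) (f : S -> R) :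
  (forall s, exists2 x, x \in X & accessible P s x) ->
  exists v : S -> R, (forall s, s \in X -> v s = 0) /\
    (forall s, s \notin X -> v s = f s + \sum_u P s u * v u).
Proof.
move=> acc.
(* The boundary condition (rows in [X]) and the equation (other rows) form one square system. *)
pose Q s u : R := (s == u)%:R - (s \notin X)%:R * P s u.
have QE v s : \sum_u Q s u * v u = v s - (s \notin X)%:R * \sum_u P s u * v u.
  rewrite mulr_sumr (bigD1 s)//= [in RHS](bigD1 s)//= opprD addrA; congr (_ + _).
    by rewrite /Q eqxx mulrBl mul1r mulrA.
  rewrite -sumrN; apply: eq_bigr => u us.
  by rewrite /Q eq_sym (negPf us) sub0r mulNr mulrA.
have [|v hv] := @fun_solve R S Q _ (fun s => (s \notin X)%:R * f s).
  move=> v hv; apply: (max_principle_eq acc) => [s sX|s sX].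
    by have := hv s; rewrite QE sX/= mul0r subr0.
  by have /eqP := hv s; rewrite QE sX/= mul1r subr_eq0 => /eqP.
exists v; split=> s sX; have := hv s; rewrite QE ?sX/=.
  by rewrite !mul0r subr0.
by rewrite !mul1r => /eqP; rewrite subr_eq => /eqP.
Qed.

(** The hitting time serves as a barrier: [v - b * h] vanishes on [X] and is subharmonic outside. *)
Lemma dirichlet_bound (X : {set S}) (f h v : S -> R) (b : R) :
  (forall s, exists2 x, x \in X & accessible P s x) ->
  (forall s, s \in X -> h s = 0) ->
  (forall s, s \notin X -> h s = 1 + \sum_u P s u * h u) ->
  (forall s, s \in X -> v s = 0) ->
  (forall s, s \notin X -> v s = f s + \sum_u P s u * v u) ->
  (forall s, f s <= b) -> forall s, v s <= b * h s.
Proof.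
move=> acc hX hP vX vP fb s; rewrite -subr_le0.
apply: (max_principle (v := fun s => v s - b * h s) acc) => u uX.
  by rewrite vX// hX// mulr0 subr0.
rewrite vP// hP// mulrDr mulr1 mulr_sumr.
have -> : \sum_i P u i * (v i - b * h i) =
    \sum_i P u i * v i - \sum_i b * (P u i * h i).
  by rewrite -sumrB; apply: eq_bigr => i _; ring.
by have := fb u; lra.
Qed.

(** The solution is the mean hitting time of [X], produced here from its equation alone;
    [le_hit_time] compares it with the series [hit_time]. *)
Lemma hit_fun (X : {set S}) :
  (forall s, exists2 x, x \in X & accessible P s x) ->
  exists h : S -> R, [/\ forall s, s \in X -> h s = 0,
    forall s, s \notin X -> h s = 1 + \sum_u P s u * h u & forall s, 0 <= h s].
Proof.
move=> acc; have [h [hX hP]] := dirichlet_solve (fun=> 1) acc.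
exists h; split=> // s; rewrite -oppr_le0.
apply: (max_principle (v := fun s => - h s) acc) => u uX.
  by rewrite hX// oppr0.
rewrite hP//; have -> : \sum_w P u w * - h w = - \sum_w P u w * h w.
  by rewrite -sumrN; apply: eq_bigr => w _; rewrite mulrN.
by lra.
Qed.

(** For a left null vector [w] of [I - P], [|w| <= |w| P] entrywise. Both sides have the same total,
    hence are equal, and [|w|] can be normalized. *)
Lemma exists_stationary (s0 : S) : exists d, is_stationary P d.
Proof.
have [||w [s1 ws1] hw] :=
    @left_null R S (fun s u => (s == u)%:R - P s u) (fun=> 1).
- by exists s0; rewrite oner_neq0.
- move=> s; rewrite -mulr_suml mulr1 sumrB kerP_sum1 (bigD1 s)//= eqxx big1 ?addr0 ?subrr//.
  by move=> u us; rewrite eq_sym (negPf us).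
have {}hw u : \sum_s w s * P s u = w u.
  move/eqP: (hw u); under eq_bigr do rewrite mulrBr.
  rewrite sumrB subr_eq0 (bigD1 u)//= eqxx mulr1 big1 ?addr0 => [/eqP//|s su].
  by rewrite (negPf su) mulr0.
have le u : `|w u| <= \sum_s `|w s| * P s u.
  rewrite -{1}hw; apply: le_trans (ler_norm_sum _ _ _) _.
  by apply: ler_sum => s _; rewrite normrM (ger0_norm (kerP_ge0 _ _)).
have tot : \sum_u \sum_s `|w s| * P s u = \sum_s `|w s|.
  rewrite exchange_big/=; apply: eq_bigr => s _.
  by rewrite -mulr_sumr kerP_sum1 mulr1.
have eq u : \sum_s `|w s| * P s u = `|w u|.
  have : \sum_u (\sum_s `|w s| * P s u - `|w u|) == 0 by rewrite sumrB tot subrr.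
  rewrite psumr_eq0 => [/allP/(_ u (mem_index_enum _))|i _]; last by rewrite subr_ge0.
  by rewrite subr_eq0 => /eqP.
have Wp : 0 < \sum_s `|w s|.
  by rewrite (bigD1 s1)//= ltr_wpDr ?normr_gt0// sumr_ge0.
exists (fun s => `|w s| / \sum_s `|w s|); split; first split.
- by move=> s; rewrite divr_ge0 ?sumr_ge0.
- by rewrite -mulr_suml divff ?gt_eqF.
- move=> u; rewrite -(eq u) mulr_suml; apply: eq_bigr => s _; ring.
Qed.

End Chain.

(** * The law of a hitting time *)

Section Hitting.
Variables (R : realType) (S : finType) (P : S -> S -> R).
Hypothesis Pdist : forall s, is_dist (P s).
Variable X : {set S}.

Lemma path_prob_fcons s t u (y : {ffun 'I_t.+1 -> S}) :
  path_prob P s (fcons u y) = (u == s)%:R * P u (y ord0) * path_prob P (y ord0) y.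
Proof.
rewrite /path_prob fcons0 big_ord_recl fcons_widen0 fconsS eqxx mul1r !mulrA.
by congr (_ * _); apply: eq_bigr => i _; rewrite fcons_widen fconsS.
Qed.

Lemma forall_ordS n (Q : pred 'I_n.+1) :
  [forall i, Q i] = Q ord0 && [forall i : 'I_n, Q (lift ord0 i)].
Proof.
apply/forallP/andP => [h|[h0 /forallP h] i]; first by split=> //; apply/forallP.
by case: (unliftP ord0 i) => [j|] ->.
Qed.

Lemma hit_prob0 s : hit_prob P X s 0 = (s \in X)%:R.
Proof.
rewrite /hit_prob big_mkcond/= big_ffun_cons (bigD1 s)//= [X in _ + X]big1 ?addr0.
  pose y : {ffun 'I_0 -> S} := [ffun _ => s].
  rewrite (big_ffun0 _ y) /path_prob fcons0 eqxx big_ord0 mulr1.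
  have -> : ord_max = ord0 :> 'I_1 by exact: val_inj.
  rewrite fcons0; case: (s \in X) => //=.
  by have -> : [forall i : 'I_0, fcons s y (widen_ord (leqnSn 0) i) \notin X];
    [apply/forallP => -[]|].
move=> u us; rewrite big1// => y _; rewrite /path_prob fcons0 (negPf us) mul0r.
by case: ifP.
Qed.

Lemma hit_probS s t :
  hit_prob P X s t.+1 = (s \notin X)%:R * \sum_u P s u * hit_prob P X u t.
Proof.
rewrite /hit_prob big_mkcond/= big_ffun_cons (bigD1 s)//= [X in _ + X]big1 ?addr0.
  transitivity ((s \notin X)%:R * \sum_(y : {ffun 'I_t.+1 -> S} |
     (y ord_max \in X) && [forall i : 'I_t, y (widen_ord (leqnSn t) i) \notin X])
     P s (y ord0) * path_prob P (y ord0) y).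
    rewrite mulr_sumr [RHS]big_mkcond/=; apply: eq_bigr => y _.
    have -> : ord_max = lift ord0 ord_max :> 'I_t.+2 by exact: val_inj.
    rewrite forall_ordS fcons_widen0 fconsS path_prob_fcons eqxx mul1r.
    have -> : [forall i, fcons s y (widen_ord (leqnSn t.+1) (lift ord0 i)) \notin X] =
        [forall i : 'I_t, y (widen_ord (leqnSn t) i) \notin X].
      by apply: eq_forallb => i; rewrite fcons_widen.
    by rewrite andbCA; case: (s \notin X); rewrite /= ?mul1r ?mul0r// if_same.
  congr (_ * _); rewrite (eq_bigr (fun u => \sum_(y : {ffun 'I_t.+1 -> S} |
     (y ord_max \in X) && [forall i : 'I_t, y (widen_ord (leqnSn t) i) \notin X])
     P s u * path_prob P u y)); last by move=> u _; rewrite mulr_sumr.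
  rewrite exchange_big/=; apply: eq_bigr => y _.
  rewrite (bigD1 (y ord0))//= [X in _ + X]big1 ?addr0// => u uy.
  by rewrite /path_prob eq_sym (negPf uy) mul0r mulr0.
move=> u us; rewrite big1// => y _; rewrite path_prob_fcons (negPf us) !mul0r.
by case: ifP.
Qed.

Lemma hit_prob_ge0 s t : 0 <= hit_prob P X s t.
Proof.
elim: t s => [|t IH] s; rewrite ?hit_prob0 ?hit_probS ?ler0n//.
by rewrite mulr_ge0// sumr_ge0// => u _; rewrite mulr_ge0 ?kerP_ge0.
Qed.

(** This is [P_s(T >= n)], which includes the event that [X] is never reached. *)
Definition hit_after s n : R := 1 - \sum_(i < n) hit_prob P X s i.

Lemma hit_afterS s n :
  hit_after s n.+1 = (s \notin X)%:R * \sum_u P s u * hit_after u n.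
Proof.
rewrite /hit_after big_ord_recl hit_prob0.
under eq_bigr do rewrite hit_probS.
rewrite -mulr_sumr exchange_big/=.
have -> : \sum_u P s u * (1 - \sum_(i < n) hit_prob P X u i) =
    1 - \sum_u \sum_(i < n) P s u * hit_prob P X u i.
  rewrite -[X in X - _](kerP_cst Pdist s 1) -sumrB; apply: eq_bigr => u _.
  by rewrite mulrBr mulr_sumr.
by case: (s \in X); rewrite /= ?mul0r ?mul1r ?addr0 ?add0r ?subrr.
Qed.

Lemma hit_after_ge0 s n : 0 <= hit_after s n.
Proof.
elim: n s => [|n IH] s; first by rewrite /hit_after big_ord0 subr0.
by rewrite hit_afterS mulr_ge0// sumr_ge0// => u _; rewrite mulr_ge0 ?kerP_ge0.
Qed.

(** This is [E_s[min(T, n)]], written as a sum of tail probabilities. *)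
Definition hit_trunc s n : R := \sum_(t < n) hit_after s t.+1.

Lemma hit_truncS s n :
  hit_trunc s n.+1 = (s \notin X)%:R * (1 + \sum_u P s u * hit_trunc u n).
Proof.
rewrite /hit_trunc big_ord_recl.
have -> : \sum_u P s u * (\sum_(t < n) hit_after u t.+1) =
    \sum_(t < n) \sum_u P s u * hit_after u t.+1.
  by rewrite exchange_big/=; apply: eq_bigr => u _; rewrite mulr_sumr.
rewrite hit_afterS mulrDr mulr1; congr (_ + _).
  rewrite (eq_bigr (fun u => P s u * 1)) ?kerP_cst ?mulr1// => u _.
  by rewrite /hit_after big_ord0 subr0.
by rewrite mulr_sumr; apply: eq_bigr => i _; exact: hit_afterS.
Qed.

Lemma hit_trunc_by_parts s n :
  hit_trunc s n = \sum_(t < n) t%:R * hit_prob P X s t + n%:R * hit_after s n.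
Proof.
elim: n => [|n IH]; first by rewrite /hit_trunc !big_ord0 mul0r addr0.
rewrite /hit_trunc big_ord_recr/= -/(hit_trunc s n) IH [in RHS]big_ord_recr/=.
rewrite {2 3}/hit_after !big_ord_recr/= /hit_after -natr1; ring.
Qed.

(** The truncated means increase, stay below [h], and their limit solves the same Dirichlet problem
    as [h]; by uniqueness the limit is [h]. *)
Lemma hit_trunc_cvg h :
  (forall s, exists2 x, x \in X & accessible P s x) ->
  (forall s, s \in X -> h s = 0) ->
  (forall s, s \notin X -> h s = 1 + \sum_u P s u * h u) ->
  (forall s, 0 <= h s) ->
  forall s (b : R), (forall n, hit_trunc s n <= b) -> h s <= b.
Proof.
move=> acc hX hP h0.
have le s n : hit_trunc s n <= h s.
  elim: n s => [|n IH] s; first by rewrite /hit_trunc big_ord0.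
  rewrite hit_truncS; have [sX|sX] := boolP (s \in X); first by rewrite mul0r.
  by rewrite mul1r (hP s sX) lerD2l; apply: kerP_le.
have nd s : nondecreasing_seq (hit_trunc s).
  apply/nondecreasing_seqP => n.
  by rewrite /hit_trunc [in X in _ <= X]big_ord_recr/= lerDl hit_after_ge0.
have cv s : cvgn (hit_trunc s).
  by apply: nondecreasing_is_cvgn => //; exists (h s) => _ [n _ <-].
pose r s : R := h s - limn (hit_trunc s).
have lim_eq s : limn (hit_trunc s) =
    (s \notin X)%:R * (1 + \sum_u P s u * limn (hit_trunc u)).
  apply/cvg_lim => //; rewrite -(cvg_shiftS (hit_trunc s)) /=.
  under eq_fun do rewrite hit_truncS.
  apply: cvgMl_tmp; apply: cvgD; first exact: cvg_cst.
  apply: cvg_big => [|u _]; first exact: add_continuous.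
  by apply: cvgMl_tmp; exact: cv.
have r0 s : r s = 0.
  apply: (max_principle_eq Pdist acc) => {}s sX; rewrite /r lim_eq sX/=.
    by rewrite mul0r hX// subr0.
  rewrite mul1r hP// opprD addrACA subrr add0r -sumrB.
  by apply: eq_bigr => u _; rewrite mulrBr.
move=> s b hb; have /eqP := r0 s; rewrite subr_eq0 => /eqP ->.
by apply: limr_le; [exact: cv|near=> n; exact: hb].
Unshelve. all: by end_near. Qed.

(** This direction suffices: the constants of the theorem are upper bounds for [hit_time], and the
    estimates use [h]. *)
Lemma le_hit_time h :
  (forall s, exists2 x, x \in X & accessible P s x) ->
  (forall s, s \in X -> h s = 0) ->
  (forall s, s \notin X -> h s = 1 + \sum_u P s u * h u) ->
  (forall s, 0 <= h s) ->
  forall s, ((h s)%:E <= hit_time P X s)%E.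
Proof.
move=> acc hX hP h0 s; rewrite /hit_time.
set s0 := (\sum_(0 <= t <oo) (hit_prob P X s t)%:E)%E.
set s1 := (\sum_(0 <= t <oo) (t%:R * hit_prob P X s t)%:E)%E.
have p0 t : (0 <= (hit_prob P X s t)%:E)%E by rewrite lee_fin hit_prob_ge0.
have tp0 t : (0 <= (t%:R * hit_prob P X s t)%:E)%E.
  by rewrite lee_fin mulr_ge0 ?hit_prob_ge0.
have s0_ge0 : (0 <= s0)%E by exact: nneseries_ge0.
have s1_ge0 : (0 <= s1)%E by exact: nneseries_ge0.
have partial n : (\sum_(0 <= t < n) (hit_prob P X s t)%:E = (1 - hit_after s n)%:E)%E.
  by rewrite sumEFin /hit_after big_mkord; congr EFin; ring.
have s0_le1 : (s0 <= 1)%E.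
  apply: lime_le; first by apply: is_cvg_nneseries => *.
  near=> n; rewrite partial lee_fin; have := hit_after_ge0 s n; lra.
(* If [X] is missed with positive probability, the second term of [hit_time] is already [+oo]. *)
have [s0E|] := eqVneq s0 1%E; last first.
  move=> s0N1; have s0lt : (s0 < 1)%E by rewrite lt_neqAle s0N1.
  have fs0 : s0 \is a fin_num by rewrite ge0_fin_numE// (le_lt_trans s0_le1)// ltry.
  rewrite -(fineK fs0) -EFinB gt0_mulye; last first.
    by rewrite lte_fin subr_gt0 -lte_fin fineK.
  by rewrite addey ?leey// gt_eqF// (lt_le_trans _ s1_ge0)// ltNyr.
rewrite s0E subee// mule0 adde0.
(* Once [T] is almost surely finite, [n P(T >= n)] is at most the tail of the series of [t P(T = t)]
   from [n] on. *)
have key n : ((hit_trunc s n)%:E <= s1)%E.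
  rewrite /s1 (@nneseries_split _ _ 0 n)// add0n hit_trunc_by_parts EFinD.
  apply: leeD; first by rewrite sumEFin big_mkord.
  have tail : ((hit_after s n)%:E = \sum_(n <= t <oo) (hit_prob P X s t)%:E)%E.
    have := s0E; rewrite /s0 (@nneseries_split _ _ 0 n)// add0n partial.
    case: (\sum_(n <= t <oo) _)%E => [x| |] //= [].
    by move=> h1; congr EFin; lra.
  rewrite EFinM tail -nneseriesZl// [leLHS]eseries_cond [leRHS]eseries_cond.
  apply: lee_nneseries => /= [i _ _|i ni].
  - by rewrite mule_ge0// lee_fin.
  - by rewrite -EFinM lee_fin ler_wpM2r ?hit_prob_ge0// ler_nat.
move: key s1_ge0; case: s1 => [x| |] //= key _; last by rewrite leey.
by rewrite lee_fin; apply: (hit_trunc_cvg acc).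
Unshelve. all: by end_near. Qed.

Lemma hit_time_in s : s \in X -> hit_time P X s = 0%E.
Proof.
move=> sX; have p t : hit_prob P X s t = (t == 0)%:R.
  by case: t => [|t]; rewrite ?hit_prob0 ?hit_probS sX// mul0r.
rewrite /hit_time.
have -> : (\sum_(0 <= t <oo) (t%:R * hit_prob P X s t)%:E = 0)%E.
  by rewrite eseries0// => -[|t] _ _; rewrite p ?mul0r ?mulr0.
have -> : (\sum_(0 <= t <oo) (hit_prob P X s t)%:E = 1)%E.
  rewrite (@nneseries_split _ _ 0 1)//; last by move=> *; rewrite lee_fin hit_prob_ge0.
  rewrite big_nat1 p eseries0 ?adde0// => -[|t]// _ _; by rewrite p.
by rewrite subee// mule0 adde0.
Qed.

End Hitting.

(** * The Poisson equation of a unichain *)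

Section Recurrence.
Variables (R : realType) (S : finType) (P : S -> S -> R).
Hypothesis Pdist : forall s, is_dist (P s).

Lemma recurrentP s : reflect (forall u, accessible P s u -> accessible P u s)
  (s \in recurrent_states P).
Proof.
rewrite inE; apply: (iffP forallP) => h u; first by move=> su; move: (h u); rewrite su.
by apply/implyP; exact: h.
Qed.

Lemma recurrent_closed s u : s \in recurrent_states P -> accessible P s u ->
  u \in recurrent_states P.
Proof.
move=> /recurrentP hs su; apply/recurrentP => w uw.
exact: (connect_trans (hs _ (connect_trans su uw)) su).
Qed.

Lemma recurrent_step s u : s \in recurrent_states P -> u \notin recurrent_states P ->
  P s u = 0.
Proof.
move=> sR uR; apply/eqP; rewrite eq_le kerP_ge0// andbT leNgt.
by apply: contra uR => Psu; apply: recurrent_closed sR _; exact: connect1.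
Qed.

(** Among the states accessible from [s], one with the fewest accessible states is recurrent. *)
Lemma reach_recurrent s : exists2 x, x \in recurrent_states P & accessible P s x.
Proof.
pose A x : {set S} := [set w | accessible P x w]%SET.
have sA : s \in A s by rewrite inE; exact: connect0.
have [y + ymin] := @arg_minnP _ s (mem (A s)) (fun x => #|A x|) sA.
rewrite /= inE => sy; exists y => //.
apply/recurrentP => u yu.
have sub : A u \subset A y.
  by apply/fintype.subsetP => w; rewrite !inE; exact: (connect_trans yu).
have /eqP eqA : A u == A y.
  rewrite eqEcard sub /=; apply: ymin; rewrite /= inE; exact: (connect_trans sy yu).
have : y \in A u by rewrite eqA inE; exact: connect0.
by rewrite inE.
Qed.

Hypothesis Puni : unichain P.

Lemma reach_recurrent_state x : x \in recurrent_states P ->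
  forall s, accessible P s x.
Proof.
move=> xR s; have [y yR sy] := reach_recurrent s.
by apply: (connect_trans sy); case: Puni => _; apply.
Qed.

Let d := stat_dist P.

Lemma stat_distP : is_stationary P d.
Proof.
have [[s _] _] := Puni.
by rewrite /d /stat_dist; apply: (@xgetPex _ _ _ (exists_stationary Pdist s)).
Qed.

Lemma stat_dist_ge0 s : 0 <= d s.
Proof. by case: stat_distP => -[]. Qed.

Lemma stat_dist_sum1 : \sum_s d s = 1.
Proof. by case: stat_distP => -[]. Qed.

Lemma stat_dist_inv (f : S -> R) : \sum_s d s * \sum_u P s u * f u = \sum_s d s * f s.
Proof.
transitivity (\sum_u (\sum_s d s * P s u) * f u).
  under eq_bigr do rewrite mulr_sumr.
  rewrite exchange_big/=; apply: eq_bigr => u _.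
  by rewrite mulr_suml; apply: eq_bigr => s _; rewrite mulrA.
by apply: eq_bigr => u _; case: stat_distP => _ ->.
Qed.

Variables (ct ch : R).
Hypothesis ctP : (ctar_chain P <= ct%:E)%E.
Hypothesis chP : (chit_chain P <= ch%:E)%E.

Let Rc := recurrent_states P.

Definition is_hit (X : {set S}) (h : S -> R) :=
  [/\ forall s, s \in X -> h s = 0,
    forall s, s \notin X -> h s = 1 + \sum_u P s u * h u & forall s, 0 <= h s].

Lemma exists_hit : exists (hR : S -> R) (h : S -> S -> R),
  is_hit Rc hR /\ forall x, x \in Rc -> is_hit [set x] (h x).
Proof.
have [hR hRP] := hit_fun Pdist reach_recurrent.
suff /boolp.choice[h hP] : forall x, exists h, x \in Rc -> is_hit [set x] h by exists hR, h.
move=> x; have [xR|_] := boolP (x \in Rc); last by exists (fun=> 0).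
have [|h hP] := @hit_fun _ _ _ Pdist [set x]; last by exists h.
by move=> s; exists x; rewrite ?inE//; exact: reach_recurrent_state.
Qed.

Variables (hR : S -> R) (h : S -> S -> R).
Hypothesis hRP : is_hit Rc hR.
Hypothesis hP : forall x, x \in Rc -> is_hit [set x] (h x).

(** The drift [hR - P hR] is 1 off the recurrent class and 0 on it, and its mean under the
    stationary law is zero. *)
Lemma stat_dist_transient s : s \notin Rc -> d s = 0.
Proof.
have [hR0 hR1 _] := hRP.
have : \sum_s d s * (hR s - \sum_u P s u * hR u) == 0.
  under eq_bigr do rewrite mulrBr.
  by rewrite sumrB stat_dist_inv subrr.
rewrite (eq_bigr (fun s => d s * (s \notin Rc)%:R)) => [|u _].
  rewrite psumr_eq0 => [/allP/(_ s (mem_index_enum _)) + sR|u _].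
    by rewrite sR mulr1 => /eqP.
  by rewrite mulr_ge0 ?stat_dist_ge0.
have [uR|uR] := boolP (u \in Rc); last by rewrite (hR1 u uR) addrK.
rewrite hR0// big1 ?subrr// => w _; have [wR|wR] := boolP (w \in Rc).
  by rewrite hR0// mulr0.
by rewrite (recurrent_step uR wR) mul0r.
Qed.

(* Kac's formula for the mean return time to x. *)
Lemma stat_dist_return x : x \in Rc -> d x * (1 + \sum_u P x u * h x u) = 1.
Proof.
move=> xR; have [h0 h1 _] := hP xR.
have : \sum_s d s * (h x s - \sum_u P s u * h x u) = 0.
  under eq_bigr do rewrite mulrBr.
  by rewrite sumrB stat_dist_inv subrr.
have dx : \sum_(s | s != x) d s = 1 - d x.
  by rewrite -stat_dist_sum1 [in RHS](bigD1 x)//= addrAC subrr add0r.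
have e : \sum_(s | s != x) d s * (h x s - \sum_u P s u * h x u) = \sum_(s | s != x) d s.
  by apply: eq_bigr => s sx; rewrite {1}h1 ?inE// addrK mulr1.
by rewrite (bigD1 x)//= h0 ?inE// e dx; lra.
Qed.

(** Only recurrent targets occur: a transient state is never reached from the recurrent class, so
    its hitting time is infinite there. *)
Definition poisson_base (f : S -> R) s : R := - \sum_(x in Rc) d x * f x * h x s.

Lemma sum_Rc (f : S -> R) : \sum_(x in Rc) d x * f x = \sum_x d x * f x.
Proof.
rewrite [RHS](bigID (mem Rc))/= [X in _ + X]big1 ?addr0// => x xR.
by rewrite stat_dist_transient// mul0r.
Qed.

(** A term with [x != s] contributes [- d x * f x], because [h x] decreases by 1 on average; for
    [x = s] Kac's formula supplies the additional [f s]. On a transient [s] this second case is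
    missing, whence the factor in front of [f s]. *)
Lemma poisson_baseP f s : poisson_base f s - \sum_u P s u * poisson_base f u =
  (s \in Rc)%:R * f s - \sum_x d x * f x.
Proof.
have -> : \sum_u P s u * poisson_base f u =
    - \sum_(x in Rc) d x * f x * \sum_u P s u * h x u.
  rewrite -sumrN; under eq_bigr do rewrite /poisson_base mulrN mulr_sumr -sumrN.
  rewrite exchange_big/=; apply: eq_bigr => x _.
  by rewrite mulr_sumr -sumrN; apply: eq_bigr => u _; ring.
rewrite opprK /poisson_base -sum_Rc addrC -sumrB.
have off x : x \in Rc -> x != s -> d x * f x * (\sum_u P s u * h x u) -
    d x * f x * h x s = - (d x * f x).
  move=> xR xs; have [h0 h1 _] := hP xR; rewrite (h1 s) ?inE 1?eq_sym//; ring.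
have [sR|sR] := boolP (s \in Rc); last first.
  rewrite mul0r sub0r -sumrN; apply: eq_bigr => x xR; apply: off => //.
  by apply: contraNneq sR => <-.
rewrite (bigD1 s)//= [in RHS](bigD1 s)//= mul1r.
have -> : \sum_(x in Rc | x != s) (d x * f x * (\sum_u P s u * h x u) - d x * f x * h x s)
    = - \sum_(x in Rc | x != s) d x * f x.
  by rewrite -sumrN; apply: eq_bigr => x /andP[xR xs]; exact: off.
have [h0 _ _] := hP sR; rewrite h0 ?inE//; have := stat_dist_return sR.
set a := \sum_u _; move=> k.
have -> : d s * f s * a = f s - d s * f s by rewrite -[X in X - _]mulr1 -k; ring.
ring.
Qed.

Lemma hR_le s : hR s <= ch.
Proof.
have [h0 h1 hge] := hRP.
rewrite -lee_fin; apply: le_trans chP.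
apply: (@le_trans _ _ (hit_time P Rc s)).
  by apply: le_hit_time => //; exact: reach_recurrent.
by rewrite /chit_chain (bigmaxD1 s)//= le_max lexx.
Qed.

Lemma target_pick : exists2 s0, s0 \in Rc & \sum_(x in Rc) d x * h x s0 <= ct.
Proof.
have := ctP; rewrite /ctar_chain; case: pickP => [s0 s0R|noR]; last first.
  by have [[s sR] _] := Puni; have := noR s; rewrite /= sR.
move=> le; exists s0 => //; rewrite -lee_fin; apply: le_trans le.
rewrite -sumEFin big_mkcond/=; apply: lee_sum => x _.
rewrite -/d; case: ifPn => xR; last by rewrite stat_dist_transient// mul0e.
have [h0 h1 hge] := hP xR.
rewrite EFinM lee_wpmul2l ?lee_fin ?stat_dist_ge0//.
apply: le_hit_time => // s; exists x; rewrite ?inE//.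
exact: reach_recurrent_state.
Qed.

(** The maximum principle applies to [v - v u], cut off to 0 outside the recurrent class, with
    boundary [u] and the transient states. *)
Lemma harmonic_recurrent v :
  (forall s, s \in Rc -> v s = \sum_u P s u * v u) ->
  {in Rc &, forall s u, v s = v u}.
Proof.
move=> vP s u sR uR.
pose w x := if x \in Rc then v x - v u else 0.
have /(_ s) : forall x, w x = 0; last by rewrite /w sR => /eqP; rewrite subr_eq0 => /eqP.
apply: (@max_principle_eq _ _ _ Pdist (u |: ~: Rc)%SET) => [x|x|x].
- by exists u; [by rewrite finset.in_setU finset.in_set1 eqxx|exact: (reach_recurrent_state uR)].
- by rewrite !(finset.in_setU, finset.in_set1, finset.in_setC) /w => /orP[/eqP ->|/negPf ->//]; rewrite subrr if_same.
- rewrite !(finset.in_setU, finset.in_set1, finset.in_setC) negb_or negbK => /andP[xu xR]; rewrite /w xR (vP x xR).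
  rewrite -[X in _ - X = _](kerP_cst Pdist x) -sumrB; apply: eq_bigr => y _.
  have [yR|yR] := boolP (y \in Rc); first by rewrite mulrBr.
  by rewrite (recurrent_step xR yR) !mul0r subr0.
Qed.

(** The random target lemma: by the Poisson equation for [f = 1], the mean time to a stationary
    target is harmonic on the recurrent class, hence equal to its value at the state picked by
    [ctar_chain]. *)
Lemma target_rec s : s \in Rc -> \sum_(x in Rc) d x * h x s <= ct.
Proof.
move=> sR; have [s0 s0R le] := target_pick.
have eq v : \sum_(x in Rc) d x * h x v = - poisson_base (fun=> 1) v.
  by rewrite /poisson_base opprK; apply: eq_bigr => x _; rewrite mulr1.
rewrite eq (@harmonic_recurrent (poisson_base (fun=> 1)) _ s s0)// -?eq// => u uR.
apply/eqP; rewrite -subr_eq0 poisson_baseP uR mul1r.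
by under eq_bigr do rewrite mulr1; rewrite stat_dist_sum1 subrr.
Qed.

(** Off the recurrent class, the mean target time and [hR] both decrease by 1 per step on average,
    so their difference is harmonic there and is bounded by its values on the class. *)
Lemma target_all s : \sum_(x in Rc) d x * h x s <= ct + hR s.
Proof.
have [h0 h1 hge] := hRP.
pose v s := \sum_(x in Rc) d x * h x s - hR s - ct.
suff : v s <= 0 by rewrite /v; lra.
have eq u : \sum_(x in Rc) d x * h x u = - poisson_base (fun=> 1) u.
  by rewrite /poisson_base opprK; apply: eq_bigr => x _; rewrite mulr1.
apply: (max_principle Pdist reach_recurrent) => u uR.
  by rewrite /v h0//; have := target_rec uR; lra.
have := poisson_baseP (fun=> 1) u; rewrite (negPf uR) mul0r.
under [\sum_(x : S) d x * 1]eq_bigr do rewrite mulr1.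
rewrite stat_dist_sum1 => k; rewrite /v eq h1//.
have -> : \sum_w P u w * (\sum_(x in Rc) d x * h x w - hR w - ct) =
   - (\sum_w P u w * poisson_base (fun=> 1) w) - (\sum_w P u w * hR w) - ct.
  rewrite -{2}(kerP_cst Pdist u ct) -sumrN -!sumrB; apply: eq_bigr => w _.
  by rewrite eq; ring.
lra.
Qed.

Lemma poisson_solution (f : S -> R) (b : R) : (forall s, `|f s| <= b) ->
  exists g, (forall s, g s - \sum_u P s u * g u = f s - \sum_u d u * f u) /\
    forall s, `|g s| <= 2 * (ct + ch) * b.
Proof.
move=> fb; have [h0 h1 hge] := hRP.
(* [u] collects the values of [f] before the recurrent class is entered; [poisson_base] provides the
   values on the class and the centering. *)
have [u [u0 u1]] := dirichlet_solve Pdist f reach_recurrent.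
have ub s : `|u s| <= b * hR s.
  rewrite ler_norml; apply/andP; split; last first.
    apply: (dirichlet_bound Pdist reach_recurrent h0 h1 u0 u1) => v.
    by have := fb v; rewrite ler_norml => /andP[].
  rewrite lerNl.
  apply: (@dirichlet_bound _ _ _ Pdist Rc (fun s => - f s) hR (fun s => - u s)) => //.
  - exact: reach_recurrent.
  - by move=> v vR; rewrite u0// oppr0.
  - move=> v vR; rewrite u1// opprD -sumrN; congr (_ + _).
    by apply: eq_bigr => w _; rewrite mulrN.
  - by move=> v; have := fb v; rewrite ler_norml lerNl => /andP[].
exists (fun s => u s + poisson_base f s); split=> s.
  have -> : \sum_w P s w * (u w + poisson_base f w) =
      \sum_w P s w * u w + \sum_w P s w * poisson_base f w.
    by rewrite -big_split/=; apply: eq_bigr => w _; rewrite mulrDr.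
  have pb := poisson_baseP f s; have [sR|sR] := boolP (s \in Rc); last first.
    by move: pb; rewrite (negPf sR) mul0r (u1 s sR); lra.
  move: pb; rewrite sR mul1r u0// [\sum_w P s w * u w]big1; first by lra.
  move=> w _; have [wR|wR] := boolP (w \in Rc); first by rewrite u0// mulr0.
  by rewrite (recurrent_step sR wR) mul0r.
have b0 : 0 <= b by exact: le_trans (fb s).
have pb : `|poisson_base f s| <= b * (ct + hR s).
  rewrite /poisson_base normrN; apply: le_trans (ler_norm_sum _ _ _) _.
  apply: (@le_trans _ _ (\sum_(x in Rc) b * (d x * h x s))).
    apply: ler_sum => x xR; have [_ _ hx] := hP xR.
    rewrite !normrM (ger0_norm (stat_dist_ge0 _)) (ger0_norm (hx s)).
    have := mulr_ge0 (stat_dist_ge0 x) (hx s).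
    by move=> /ler_wpM2l /(_ _ _ (fb x)); lra.
  by rewrite -mulr_sumr ler_wpM2l// target_all.
have := ler_normD (u s) (poisson_base f s); have := ub s; have := hR_le s.
move=> hs us; have : b * hR s <= b * ch by rewrite ler_wpM2l.
have : 0 <= b * ct.
  have [s0 s0R] := target_pick => /(le_trans _) ct0.
  rewrite mulr_ge0// ct0// sumr_ge0// => x xR; have [_ _ hx] := hP xR.
  by rewrite mulr_ge0 ?stat_dist_ge0.
by move: pb; lra.
Qed.

(** Reaching another recurrent state takes at least one step, so [1 - d s <= ct] for every recurrent
    [s]; two recurrent states cannot both have mass above 1/2. With a single recurrent state the
    target constant is 0. *)
Lemma target_ge_half : (0 < ctar_chain P)%E -> 2^-1 <= ct.
Proof.
move=> c0; have [s0 s0R _] := target_pick.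
have low s : s \in Rc -> 1 - d s <= ct.
  move=> sR; apply: le_trans (target_rec sR).
  rewrite -stat_dist_sum1 (bigD1 s)//= addrAC subrr add0r.
  rewrite [leLHS](bigID (mem Rc))/= [X in _ + X]big1 ?addr0 => [|x /andP[_ xR]]; last first.
    by rewrite stat_dist_transient.
  rewrite [leRHS](bigD1 s)//= -[leLHS]add0r lerD//.
    by have [_ _ hs] := hP sR; rewrite mulr_ge0 ?stat_dist_ge0.
  under eq_bigl do rewrite andbC.
  apply: ler_sum => x /andP[xR xs]; have [_ h1 hx] := hP xR.
  rewrite ler_peMr ?stat_dist_ge0// h1 ?inE 1?eq_sym//.
  by rewrite lerDl; apply: sumr_ge0 => w _; apply: mulr_ge0; [exact: kerP_ge0|exact: hx].
have [s1 /andP[s1R s10]|no] := pickP (fun s => (s \in Rc) && (s != s0)).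
  have := low _ s0R; have := low _ s1R.
  have : d s0 + d s1 <= 1.
    rewrite -stat_dist_sum1 (bigD1 s0)//= (bigD1 s1)//= addrA lerDl.
    by rewrite sumr_ge0// => w _; exact: stat_dist_ge0.
  lra.
move: c0; rewrite /ctar_chain; case: pickP => [s1 s1R|_]; last by rewrite ltxx.
have d0 x : x != s1 -> d x = 0.
  move=> xs; apply: stat_dist_transient; apply: contra_neqN xs => xR.
  have := no x; rewrite /= xR /= => /negbFE/eqP ->.
  by have := no s1; rewrite /= s1R /= => /negbFE/eqP ->.
rewrite big1 ?ltxx// => x _; have [->|xs] := eqVneq x s1.
  by rewrite hit_time_in ?inE// mule0.
by rewrite -/d d0// mul0e.
Qed.

End Recurrence.

(** * Trajectories under a fixed policy *)

Section Rollout.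
Variables (R : realType) (S A : finType) (M : mdp R S A).
Notation tr := (transition S A).

Definition step_mean (pi : S -> A -> R) (s : S) (f : tr -> R) : R :=
  \sum_a \sum_s' pi s a * kernel M s a s' * f (s, a, s').

(** An expectation over [n] transitions, defined by recursion rather than as a sum over paths, so
    that conditioning on the first steps is mere unfolding. *)
Fixpoint rollout (pi : S -> A -> R) (n : nat) (s : S) (F : seq tr -> R) : R :=
  if n is n'.+1 then
    step_mean pi s (fun z => rollout pi n' z.2 (fun l => F (z :: l)))
  else F [::].

Definition end_state (s : S) (l : seq tr) : S := last s [seq z.2 | z <- l].

(** The list counterpart of [feasible]. Estimates along a rollout need to hold on such lists only,
    which matters because the updates are known to stay in [Theta] only there. *)
Fixpoint feasible_from (s : S) (l : seq tr) : bool :=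
  if l is z :: l' then
    [&& z.1.1 == s, 0 < kernel M z.1.1 z.1.2 z.2 & feasible_from z.2 l']
  else true.

Lemma end_state_cat s l l' : end_state s (l ++ l') = end_state (end_state s l) l'.
Proof. by rewrite /end_state map_cat last_cat. Qed.

Lemma feasible_from_cat s l l' :
  feasible_from s (l ++ l') = feasible_from s l && feasible_from (end_state s l) l'.
Proof. by elim: l s => //= z l IH s; rewrite IH !andbA. Qed.

Variable pi : S -> A -> R.
Hypothesis piP : is_policy pi.

Lemma policy_ge0 s a : 0 <= pi s a. Proof. by case: (piP s). Qed.
Lemma policy_sum1 s : \sum_a pi s a = 1. Proof. by case: (piP s). Qed.
Lemma kernel_ge0 s a s' : 0 <= kernel M s a s'.
Proof. by case: (kernel_dist M s a). Qed.
Lemma kernel_sum1 s a : \sum_s' kernel M s a s' = 1.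
Proof. by case: (kernel_dist M s a). Qed.

Lemma step_mean_le s f g :
  (forall a s', 0 < kernel M s a s' -> f (s, a, s') <= g (s, a, s')) ->
  step_mean pi s f <= step_mean pi s g.
Proof.
move=> h; apply: ler_sum => a _; apply: ler_sum => s' _.
have [k0|k0] := eqVneq (kernel M s a s') 0; first by rewrite k0 mulr0 !mul0r.
rewrite ler_wpM2l ?mulr_ge0 ?policy_ge0 ?kernel_ge0// h//.
by rewrite lt_neqAle eq_sym k0 kernel_ge0.
Qed.

Lemma eq_step_mean s f g : (forall a s', f (s, a, s') = g (s, a, s')) ->
  step_mean pi s f = step_mean pi s g.
Proof. by move=> h; apply: eq_bigr => a _; apply: eq_bigr => s' _; rewrite h. Qed.

Lemma step_meanD s f g :
  step_mean pi s (fun z => f z + g z) = step_mean pi s f + step_mean pi s g.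
Proof.
rewrite /step_mean -big_split; apply: eq_bigr => a _ /=.
by rewrite -big_split; apply: eq_bigr => s' _ /=; rewrite mulrDr.
Qed.

Lemma step_meanZ s c f : step_mean pi s (fun z => c * f z) = c * step_mean pi s f.
Proof.
rewrite /step_mean mulr_sumr; apply: eq_bigr => a _ /=.
by rewrite mulr_sumr; apply: eq_bigr => s' _ /=; rewrite mulrCA.
Qed.

Lemma step_mean_cst s c : step_mean pi s (fun=> c) = c.
Proof.
rewrite /step_mean -[RHS]mul1r -(policy_sum1 s) mulr_suml; apply: eq_bigr => a _.
by rewrite -mulr_suml -mulr_sumr kernel_sum1 mulr1.
Qed.

Lemma step_mean_next s (g : S -> R) :
  step_mean pi s (fun z => g z.2) = \sum_u pol_chain M pi s u * g u.
Proof.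
rewrite /step_mean exchange_big/=; apply: eq_bigr => u _.
by rewrite mulr_suml; apply: eq_bigr => a _; rewrite (mulrC (pi _ _)).
Qed.

Lemma rollout_le n s F G :
  (forall l, size l = n -> feasible_from s l -> F l <= G l) ->
  rollout pi n s F <= rollout pi n s G.
Proof.
elim: n s F G => [|n IH] s F G h /=; first exact: h.
apply: step_mean_le => a s' k; apply: IH => l ln fl; apply: h => /=.
  by rewrite ln.
by rewrite eqxx k.
Qed.

Lemma eq_rollout n s F G :
  (forall l, size l = n -> feasible_from s l -> F l = G l) ->
  rollout pi n s F = rollout pi n s G.
Proof.
by move=> h; apply/eqP; rewrite eq_le !rollout_le// => l ln fl; rewrite h.
Qed.

Lemma rolloutD n s F G :
  rollout pi n s (fun l => F l + G l) = rollout pi n s F + rollout pi n s G.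
Proof.
elim: n s F G => [|n IH] s F G //=; rewrite -step_meanD.
by apply: eq_step_mean => a s'; rewrite IH.
Qed.

Lemma rolloutZ n s c F : rollout pi n s (fun l => c * F l) = c * rollout pi n s F.
Proof.
elim: n s F => [|n IH] s F //=; rewrite -step_meanZ.
by apply: eq_step_mean => a s'; rewrite IH.
Qed.

Lemma rolloutN n s F : rollout pi n s (fun l => - F l) = - rollout pi n s F.
Proof.
by rewrite -mulN1r -rolloutZ; congr rollout; apply: funext => l; rewrite mulN1r.
Qed.

Lemma rolloutB n s F G :
  rollout pi n s (fun l => F l - G l) = rollout pi n s F - rollout pi n s G.
Proof. by rewrite rolloutD rolloutN. Qed.

Lemma rollout_cst n s c : rollout pi n s (fun=> c) = c.
Proof.
elim: n s => [|n IH] s //=; rewrite -[RHS](step_mean_cst s).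
by apply: eq_step_mean => a s'; rewrite IH.
Qed.

Lemma rollout_sum (I : finType) n s (F : I -> seq tr -> R) :
  rollout pi n s (fun l => \sum_i F i l) = \sum_i rollout pi n s (F i).
Proof.
elim: (index_enum I) => [|i r IH].
  by rewrite big_nil -[RHS](rollout_cst n s); congr rollout; apply: funext => l; rewrite big_nil.
rewrite big_cons -IH -rolloutD; congr rollout; apply: funext => l.
by rewrite big_cons.
Qed.

Lemma rollout_cat n m s F :
  rollout pi (n + m) s F =
  rollout pi n s (fun l => rollout pi m (end_state s l) (fun l' => F (l ++ l'))).
Proof.
by elim: n s F => [|n IH] s F //=; apply: eq_step_mean => a s'; rewrite IH.
Qed.

Lemma rollout_ge0 n s F : (forall l, size l = n -> feasible_from s l -> 0 <= F l) ->
  0 <= rollout pi n s F.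
Proof. by move=> h; rewrite -{1}(rollout_cst n s 0); exact: rollout_le. Qed.

Lemma ler_norm_rollout n s F : `|rollout pi n s F| <= rollout pi n s (fun l => `|F l|).
Proof.
rewrite ler_norml -rolloutN; apply/andP; split; apply: rollout_le => l _ _.
  by rewrite lerNl -normrN ler_norm.
exact: ler_norm.
Qed.

Variables (d : S -> R) (Cb : R).
Hypothesis Cb0 : 0 <= Cb.
Hypothesis d_dist : is_dist d.
Hypothesis poisson : forall (f : S -> R) (b : R), (forall s, `|f s| <= b) ->
  exists g, (forall s, g s - \sum_u pol_chain M pi s u * g u = f s - \sum_u d u * f u) /\
    forall s, `|g s| <= Cb * b.

Definition stat_mean (f : tr -> R) : R := \sum_s d s * step_mean pi s f.

Lemma stat_meanD f g : stat_mean (fun z => f z + g z) = stat_mean f + stat_mean g.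
Proof.
by rewrite /stat_mean -big_split; apply: eq_bigr => s _; rewrite step_meanD mulrDr.
Qed.

Lemma stat_meanZ c f : stat_mean (fun z => c * f z) = c * stat_mean f.
Proof.
by rewrite /stat_mean mulr_sumr; apply: eq_bigr => s _; rewrite step_meanZ mulrCA.
Qed.

Lemma stat_mean_cst c : stat_mean (fun=> c) = c.
Proof.
rewrite /stat_mean; under eq_bigr do rewrite step_mean_cst.
by rewrite -mulr_suml; case: d_dist => _ ->; rewrite mul1r.
Qed.

Lemma stat_mean_le f g : (forall z, f z <= g z) -> stat_mean f <= stat_mean g.
Proof.
move=> h; apply: ler_sum => s _; rewrite ler_wpM2l//; first by case: d_dist.
by apply: step_mean_le => a s' _; exact: h.
Qed.

Lemma stat_mean_norm f b : (forall z, `|f z| <= b) -> `|stat_mean f| <= b.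
Proof.
move=> h; rewrite ler_norml -{1}(stat_mean_cst (- b)) -{2}(stat_mean_cst b).
by rewrite !stat_mean_le// => z; have := h z; rewrite ler_norml => /andP[].
Qed.

Lemma stat_mean_sqr_le f : stat_mean f ^+ 2 <= stat_mean (fun z => f z ^+ 2).
Proof.
set c := stat_mean f.
have : stat_mean (fun=> 0) <= stat_mean (fun z => (f z ^+ 2 + (- 2 * c) * f z) + c ^+ 2).
  by apply: stat_mean_le => z; have := sqr_ge0 (f z - c); rewrite sqrrB; nra.
rewrite !stat_meanD stat_meanZ !stat_mean_cst -/c; nra.
Qed.

Section Deviation.
Variables (f : tr -> R) (b : R).
Hypothesis b0 : 0 <= b.
Hypothesis fb : forall z, `|f z| <= b.

Let delta z := f z - stat_mean f.

(** The Poisson solution for the mean of [f] given the state makes [delta z + g z.2 - g s] centered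
    given [s]. *)
Lemma martingale_part : exists g : S -> R, (forall s, `|g s| <= Cb * b) /\
  forall s, step_mean pi s (fun z => delta z + g z.2) = g s.
Proof.
have [|g [g1 g2]] := poisson (f := fun s => step_mean pi s f) (b := b).
  move=> s; rewrite ler_norml -{1}(step_mean_cst s (- b)) -{2}(step_mean_cst s b).
  by rewrite !step_mean_le// => a s' _; have := fb (s, a, s'); rewrite ler_norml => /andP[].
exists g; split=> // s; rewrite step_meanD step_mean_next /delta step_meanD step_mean_cst.
have := g1 s; rewrite /stat_mean; lra.
Qed.

(** The bound does not depend on [n]: by the martingale property only [g] at the start and at the
    end of the path survives. *)
Lemma rollout_dev_mean n s :
  `|rollout pi n s (fun l => \sum_(z <- l) delta z)| <= 2 * Cb * b.
Proof.
have [g [gb gP]] := martingale_part.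
(* The induction needs the sum [c] accumulated so far: [c] plus [g] at the current state is the
   martingale. *)
have h c : rollout pi n s (fun l => c + \sum_(z <- l) delta z + g (end_state s l)) = c + g s.
  elim: n s c => [|n IH] s c /=; first by rewrite big_nil addr0.
  rewrite -(gP s) -{2}(step_mean_cst s c) -step_meanD; apply: eq_step_mean => a s'.
  rewrite addrA -(IH s' (c + delta (s, a, s'))); congr rollout; apply: funext => l.
  by rewrite big_cons -addrA -!addrA; congr (_ + _).
have := h 0; rewrite rolloutD.
have -> : rollout pi n s (fun l => 0 + \sum_(z <- l) delta z) =
  rollout pi n s (fun l => \sum_(z <- l) delta z).
  by congr rollout; apply: funext => l; rewrite add0r.
have : `|rollout pi n s (fun l => g (end_state s l))| <= Cb * b.
  apply: le_trans (ler_norm_rollout _ _ _) _.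
  by rewrite -(rollout_cst n s (Cb * b)); apply: rollout_le.
by have := gb s; rewrite !ler_norml => /andP[h1 h2] /andP[h3 h4] h5; apply/andP; lra.
Qed.

(** Martingale increments are orthogonal, so the second moment grows linearly in [n]. Each increment
    is at most [(2 + 2 * Cb) * b]: [2 * b] from [delta] and [2 * Cb * b] from [g]. *)
Lemma rollout_dev_sqr n s : (0 < n)%N ->
  rollout pi n s (fun l => (\sum_(z <- l) delta z) ^+ 2) <= 12 * (1 + Cb) ^+ 2 * b ^+ 2 * n%:R.
Proof.
move=> n0; have [g [gb gP]] := martingale_part.
set k := (2 + 2 * Cb) ^+ 2 * b ^+ 2.
have k0 : 0 <= k by rewrite mulr_ge0 ?sqr_ge0.
have h m u c : rollout pi m u (fun l => (c + \sum_(z <- l) delta z + g (end_state u l)) ^+ 2)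
    <= (c + g u) ^+ 2 + m%:R * k.
  elim: m u c => [|m IH] u c /=; first by rewrite big_nil addr0 mul0r addr0.
  have le1 : step_mean pi u (fun z => rollout pi m z.2 (fun l =>
      (c + \sum_(z <- z :: l) delta z + g (end_state u (z :: l))) ^+ 2)) <=
    step_mean pi u (fun z => (c + delta z + g z.2) ^+ 2 + m%:R * k).
    apply: step_mean_le => a s' _; apply: le_trans (IH s' (c + delta (u, a, s'))).
    by apply: rollout_le => l _ _; rewrite big_cons /end_state /= !addrA.
  apply: le_trans le1 _; rewrite step_meanD step_mean_cst -natr1 mulrDl mul1r [_ * k + k]addrC addrA lerD2r.
  have -> : step_mean pi u (fun z => (c + delta z + g z.2) ^+ 2) =
    (c + g u) ^+ 2 + step_mean pi u (fun z => (delta z + g z.2 - g u) ^+ 2).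
    rewrite (_ : (fun z => (c + delta z + g z.2) ^+ 2) = fun z =>
      (delta z + g z.2 - g u) ^+ 2 + (2 * (c + g u)) * (delta z + g z.2)
       + ((c + g u) ^+ 2 - 2 * (c + g u) * g u)).
      by rewrite step_meanD step_meanD step_meanZ step_mean_cst gP; ring.
    by apply: funext => z; ring.
  rewrite lerD2l -[leRHS](step_mean_cst u); apply: step_mean_le => a s' _.
  rewrite /k -exprMn -ler_sqrt ?sqr_ge0// !sqrtr_sqr [leRHS]ger0_norm ?mulr_ge0 ?addr_ge0//; last first.
    by rewrite mulr_ge0.
  have := stat_mean_norm fb; have := fb (u, a, s'); have := gb u; have := gb s'.
  rewrite /delta !ler_norml => /andP[? ?] /andP[? ?] /andP[? ?] /andP[? ?].
  by apply/andP; split => /=; lra.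
have le2 : rollout pi n s (fun l => (\sum_(z <- l) delta z) ^+ 2) <=
  rollout pi n s (fun l => 2 * ((0 + \sum_(z <- l) delta z + g (end_state s l)) ^+ 2) + 2 * (Cb * b) ^+ 2).
  apply: rollout_le => l _ _; rewrite add0r; set x := \sum_(z <- l) _; set y := g _.
  have : y ^+ 2 <= (Cb * b) ^+ 2.
    by rewrite -(real_normK (num_real y)) ler_pXn2r ?nnegrE ?mulr_ge0//; exact: gb.
  by have := sqr_ge0 (x + 2 * y); nra.
apply: le_trans le2 _; rewrite rolloutD rolloutZ rollout_cst.
have := h n s 0; rewrite add0r.
have : g s ^+ 2 <= (Cb * b) ^+ 2.
  by rewrite -(real_normK (num_real (g s))) ler_pXn2r ?nnegrE ?mulr_ge0//; exact: gb.
have n1 : 1 <= n%:R :> R by rewrite ler1n.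
set t := rollout _ _ _ _; set w := g s ^+ 2 => hw ht.
(* Of the factor 12, 8 comes from [2 * k] and 4 from the two boundary values of [g]. *)
have -> : 12 * (1 + Cb) ^+ 2 * b ^+ 2 * n%:R = 2 * (n%:R * k) + 4 * ((1 + Cb) ^+ 2 * b ^+ 2) * n%:R.
  by rewrite /k; ring.
have : (Cb * b) ^+ 2 <= ((1 + Cb) ^+ 2 * b ^+ 2) * n%:R.
  apply: (@le_trans _ _ ((1 + Cb) ^+ 2 * b ^+ 2)); last by rewrite ler_peMr// mulr_ge0 ?sqr_ge0//.
  by rewrite exprMn ler_wpM2r ?sqr_ge0// ler_pXn2r ?nnegrE ?addr_ge0//; lra.
lra.
Qed.
End Deviation.

(* Common bound for the bias and the variance of a batch mean. *)
Definition batch_err (B : nat) : R := 12 * (1 + Cb) ^+ 2 / B%:R.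

Section VectorDeviation.
Variables (n : nat) (e : tr -> 'cV[R]_n) (ebar : 'cV[R]_n) (b : R) (B : nat).
Hypothesis b0 : 0 <= b.
Hypothesis eb : forall z, enorm (e z) <= b.
Hypothesis ebarP : forall u, dotp u ebar = stat_mean (fun z => dotp u (e z)).
Hypothesis B0 : (0 < B)%N.

Definition batch_mean (l : seq tr) : 'cV[R]_n := B%:R^-1 *: \sum_(z <- l) e z.

Lemma batch_mean_dev u l : size l = B ->
  dotp u (batch_mean l - ebar) =
  B%:R^-1 * \sum_(z <- l) (dotp u (e z) - stat_mean (fun z => dotp u (e z))).
Proof.
move=> lB; rewrite dotpBr /batch_mean dotpZr dotp_sumr sumrB mulrBr ebarP.
rewrite big_const_seq count_predT lB iter_addr_0 -[X in _ - _ * X]mulr_natl mulrA mulVf ?mul1r//.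
by rewrite pnatr_eq0 -lt0n.
Qed.

Lemma batch_mean_bias s u :
  `|rollout pi B s (fun l => dotp u (batch_mean l - ebar))| <= batch_err B * (enorm u * b).
Proof.
rewrite (@eq_rollout B s _ (fun l => B%:R^-1 *
    \sum_(z <- l) (dotp u (e z) - stat_mean (fun z => dotp u (e z))))); last first.
  by move=> l lB _; exact: batch_mean_dev.
have Bp : 0 < B%:R^-1 :> R by rewrite invr_gt0 ltr0n.
rewrite rolloutZ normrM gtr0_norm//.
apply: (@le_trans _ _ (B%:R^-1 * (2 * Cb * (enorm u * b)))).
  rewrite ler_pM2l//; apply: rollout_dev_mean => z.
  by rewrite (le_trans (dotp_norm_le u (e z)))// ler_wpM2l ?enorm_ge0.
have -> : batch_err B * (enorm u * b) = B%:R^-1 * (12 * (1 + Cb) ^+ 2 * (enorm u * b)).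
  by rewrite /batch_err; ring.
rewrite ler_pM2l// ler_wpM2r ?mulr_ge0 ?enorm_ge0//.
by have := sqr_ge0 Cb; rewrite sqrrD expr1n mul1r; move: Cb0; lra.
Qed.

(** Coordinate by coordinate, which costs the dimension [n]. *)
Lemma batch_mean_var s :
  rollout pi B s (fun l => enorm (batch_mean l - ebar) ^+ 2) <= batch_err B * (n%:R * b ^+ 2).
Proof.
have Bp : 0 < B%:R :> R by rewrite ltr0n.
rewrite (@eq_rollout B s _ (fun l => \sum_(i < n) B%:R^-1 ^+ 2 *
    (\sum_(z <- l) (dotp (delta_mx i 0) (e z) - stat_mean (fun z => dotp (delta_mx i 0) (e z)))) ^+ 2)); last first.
  move=> l lB _; rewrite enorm_sqr dotpE; apply: eq_bigr => i _.
  by rewrite -expr2 -dotp_delta batch_mean_dev// exprMn.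
have -> : batch_err B * (n%:R * b ^+ 2) = \sum_(i < n) batch_err B * b ^+ 2.
  by rewrite sumr_const card_ord -mulr_natl; ring.
rewrite rollout_sum; apply: ler_sum => i _; rewrite rolloutZ.
apply: (@le_trans _ _ (B%:R^-1 ^+ 2 * (12 * (1 + Cb) ^+ 2 * b ^+ 2 * B%:R))).
  rewrite ler_wpM2l ?sqr_ge0//; apply: rollout_dev_sqr => // z.
  by rewrite dotp_delta (le_trans (enorm_coord (e z) i)).
rewrite /batch_err [leRHS](_ : _ = 12 * (1 + Cb) ^+ 2 * b ^+ 2 * B%:R^-1); last by ring.
by rewrite mulrC -[leLHS]mulrA expr2 [B%:R * _]mulrA divff ?mul1r// gt_eqF.
Qed.
End VectorDeviation.
End Rollout.

Lemma affine_rec (R : realType) (u : nat -> R) (q e : R) (H : nat) :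
  0 <= q -> q < 1 -> (forall h, (h < H)%N -> u h.+1 <= q * u h + e) ->
  forall h, (h <= H)%N -> u h <= q ^+ h * u 0 + e / (1 - q) * (1 - q ^+ h).
Proof.
move=> q0 q1 rec; elim=> [|h IH] hH; first by rewrite expr0 mul1r subrr mulr0 addr0.
apply: le_trans (rec h hH) _; have := ler_wpM2l q0 (IH (ltnW hH)).
rewrite exprS; set x := q ^+ h; move=> h1.
have -> : e / (1 - q) * (1 - q * x) = q * (e / (1 - q) * (1 - x)) + e.
  by field; rewrite subr_eq0 eq_sym lt_eqF.
nra.
Qed.

Lemma affine_rec_le (R : realType) (u : nat -> R) (q e : R) (H : nat) :
  0 <= q -> q < 1 -> 0 <= e -> (forall h, (h < H)%N -> u h.+1 <= q * u h + e) ->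
  forall h, (h <= H)%N -> u h <= q ^+ h * u 0 + e / (1 - q).
Proof.
move=> q0 q1 e0 rec h hH; apply: le_trans (affine_rec q0 q1 rec hH) _.
rewrite lerD2l -[leRHS]mulr1 ler_wpM2l// ?gerBl ?exprn_ge0//.
by rewrite divr_ge0// subr_ge0 ltW.
Qed.

Lemma growth_rec (R : realType) (u : nat -> R) (q e : R) (H : nat) :
  1 <= q -> (forall h, 0 <= u h) -> 0 <= e ->
  (forall h, (h < H)%N -> u h.+1 <= q * u h + e) ->
  forall h, (h <= H)%N -> u h <= q ^+ h * (u 0 + h%:R * e).
Proof.
move=> q1 u0 e0 rec; elim=> [|h IH] hH; first by rewrite expr0 mul1r mul0r addr0.
have q0 : 0 <= q by exact: le_trans q1.
apply: le_trans (rec h hH) _; have := ler_wpM2l q0 (IH (ltnW hH)).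
have : 1 <= q ^+ h.+1 by rewrite exprn_ege1.
rewrite exprS -natr1; set x := q ^+ h => h1 h2.
have : e <= q * x * e by rewrite -{1}(mul1r e) ler_wpM2r.
lra.
Qed.

Lemma sqr_sum3 (R : realType) (x y z : R) :
  (x + y + z) ^+ 2 <= 3 * (x ^+ 2 + y ^+ 2 + z ^+ 2).
Proof.
have := sqr_ge0 (x - y); have := sqr_ge0 (y - z); have := sqr_ge0 (x - z); nra.
Qed.

Lemma young_sqr (R : realType) (t x y : R) : 0 < t ->
  (x + y) ^+ 2 <= (1 + t) * x ^+ 2 + (1 + t^-1) * y ^+ 2.
Proof.
move=> t0; have -> : (1 + t) * x ^+ 2 + (1 + t^-1) * y ^+ 2 =
    (x + y) ^+ 2 + t^-1 * (t * x - y) ^+ 2 by field; rewrite gt_eqF.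
by rewrite lerDl mulr_ge0 ?sqr_ge0// invr_ge0 ltW.
Qed.

Section Projection.
Variables (R : realType) (n : nat) (Q : 'M[R]_n).
Hypotheses (QT : Q^T = Q) (QQ : Q *m Q = Q).

Lemma dotp_proj x y : dotp (Q *m x) (Q *m y) = dotp (Q *m x) y.
Proof. by rewrite dotp_mulmx QT mulmxA QQ. Qed.

Lemma enorm_proj x : enorm (Q *m x) <= enorm x.
Proof.
have [->|x0] := eqVneq (enorm (Q *m x)) 0; first exact: enorm_ge0.
rewrite -(ler_pM2l (x := enorm (Q *m x))) ?lt_neqAle 1?eq_sym ?x0 ?enorm_ge0//.
by rewrite -expr2 enorm_sqr dotp_proj dotp_le_enorm.
Qed.
End Projection.

(* The Poisson equation of the chain is solvable with operator norm at most Cb. *)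
Definition mixing (R : realType) (S A : finType) (M : mdp R S A)
    (pi : S -> A -> R) (d : S -> R) (Cb : R) : Prop :=
  [/\ is_policy pi, 0 <= Cb, is_stationary (pol_chain M pi) d &
    forall (f : S -> R) (b : R), (forall s, `|f s| <= b) ->
    exists g, (forall s, g s - \sum_u pol_chain M pi s u * g u = f s - \sum_u d u * f u) /\
      forall s, `|g s| <= Cb * b].

Section SaStep.
Variables (R : realType) (S A : finType) (M : mdp R S A).
Notation tr := (transition S A).
Variables (pi : S -> A -> R) (d : S -> R) (Cb : R).
Hypothesis mix : mixing M pi d Cb.
Variables (B : nat).
Hypothesis B0 : (0 < B)%N.
Let piP := let: And4 h _ _ _ := mix in h.
Let Cb0 := let: And4 _ h _ _ := mix in h.
Let d_dist := let: And4 _ _ h _ := mix in proj1 h.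
Let poisson := let: And4 _ _ _ h := mix in h.
Let kap := batch_err Cb B.

Lemma batch_err_ge0 : 0 <= kap.
Proof. by rewrite /kap /batch_err divr_ge0// mulr_ge0// sqr_ge0. Qed.

Section OneStep.
Variables (n : nat) (e : tr -> 'cV[R]_n) (ebar : 'cV[R]_n) (b eta : R) (x : 'cV[R]_n).
Hypothesis b0 : 0 <= b.
Hypothesis eta0 : 0 <= eta.
Hypothesis eb : forall z, enorm (e z) <= b.
Hypothesis ebarP : forall u, dotp u ebar = stat_mean M pi d (fun z => dotp u (e z)).

Lemma sa_step_mean s u :
  `|rollout M pi B s (fun l => dotp u (x - eta *: batch_mean e B l)) -
    dotp u (x - eta *: ebar)| <= kap * (eta * enorm u * b).
Proof.
have := batch_mean_bias piP Cb0 poisson b0 eb ebarP B0 s u.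
rewrite (_ : (fun l => dotp u (x - eta *: batch_mean e B l)) = fun l =>
  dotp u (x - eta *: ebar) + (- eta) * dotp u (batch_mean e B l - ebar)); last first.
  by apply: funext => l; rewrite !dotpBr !dotpZr; ring.
rewrite rolloutD// rolloutZ// rollout_cst// addrAC subrr add0r => h.
rewrite normrM normrN (ger0_norm eta0).
apply: le_trans (ler_wpM2l eta0 h) _; rewrite -/kap.
by rewrite [leLHS](_ : _ = kap * (eta * enorm u * b))//; ring.
Qed.

(** Expand the square around the mean step: the cross term is a batch bias and the quadratic term a
    batch variance. [Q] is either the identity or the projection on the directions that contract. *)
Lemma sa_step_sqr (Q : 'M[R]_n) s : Q^T = Q -> Q *m Q = Q ->
  rollout M pi B s (fun l => enorm (Q *m (x - eta *: batch_mean e B l)) ^+ 2) <=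
  enorm (Q *m (x - eta *: ebar)) ^+ 2 +
  kap * (2 * eta * enorm (x - eta *: ebar) * b + eta ^+ 2 * n%:R * b ^+ 2).
Proof.
move=> QT QQ; set v := x - eta *: ebar.
apply: (@le_trans _ _ (rollout M pi B s (fun l => enorm (Q *m v) ^+ 2 +
    ((- (2 * eta)) * dotp (Q *m v) (batch_mean e B l - ebar) +
     eta ^+ 2 * enorm (batch_mean e B l - ebar) ^+ 2)))).
  apply: rollout_le => // l _ _.
  have -> : x - eta *: batch_mean e B l = v - eta *: (batch_mean e B l - ebar).
    by rewrite /v scalerBr opprB addrA subrK.
  move: (batch_mean e B l - ebar) => w.
  rewrite mulmxBr -scalemxAr enorm_sqr !(dotpBl, dotpBr, dotpZl, dotpZr).
  rewrite (dotpC (Q *m w) (Q *m v)) (dotp_proj QT QQ v w) -!enorm_sqr.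
  have : eta ^+ 2 * enorm (Q *m w) ^+ 2 <= eta ^+ 2 * enorm w ^+ 2.
    by rewrite ler_wpM2l ?sqr_ge0// ler_pXn2r ?nnegrE ?enorm_ge0// enorm_proj.
  rewrite (expr2 eta); lra.
rewrite rolloutD// rollout_cst// lerD2l rolloutD// !rolloutZ// mulrDr lerD//.
  have := batch_mean_bias piP Cb0 poisson b0 eb ebarP B0 s (Q *m v).
  rewrite -/kap ler_norml => /andP[h _].
  have : kap * (enorm (Q *m v) * b) <= kap * (enorm v * b).
    by rewrite ler_wpM2l ?batch_err_ge0// ler_wpM2r// enorm_proj.
  move=> h2; have h3 : 0 <= 2 * eta by rewrite mulr_ge0.
  have := ler_wpM2l h3 (le_trans (_ : - rollout M pi B s (fun l => dotp (Q *m v) (batch_mean e B l - ebar)) <= _) h2).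
  rewrite lerNl => /(_ h); lra.
have := ler_wpM2l (sqr_ge0 eta) (batch_mean_var piP Cb0 d_dist poisson b0 eb ebarP B0 s).
by rewrite -/kap; lra.
Qed.

End OneStep.
End SaStep.

(** * The critic *)

Lemma unitmx_inj (R : realType) n (A : 'M[R]_n) :
  (forall x : 'cV[R]_n, A *m x = 0 -> x = 0) -> A \in unitmx.
Proof.
move=> h; rewrite unitmxE unitfE -det_tr; apply/det0P => -[v v0 hv].
case/eqP: v0; apply: trmx_inj; rewrite trmx0; apply: h.
by apply: trmx_inj; rewrite trmx_mul trmxK trmx0.
Qed.

Definition mean_reward (R : realType) (S A : finType) (M : mdp R S A) (pi : S -> A -> R)
    (d : S -> R) : R := stat_mean M pi d (fun z => reward M z.1.1 z.1.2).

Lemma mean_reward_ge0_le1 (R : realType) (S A : finType) (M : mdp R S A) (pi : S -> A -> R)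
    (d : S -> R) : is_policy pi -> is_dist d -> 0 <= mean_reward M pi d <= 1.
Proof.
move=> piP d_dist.
rewrite -{1}(stat_mean_cst M piP d_dist 0) -(stat_mean_cst M piP d_dist 1).
by rewrite !(stat_mean_le M piP d_dist)// => z; have /andP[] := reward_ge0_le1 M z.1.1 z.1.2.
Qed.

(** * Means under the stationary law of a transition *)

Section Stationary.
Variables (R : realType) (S A : finType) (M : mdp R S A).
Notation tr := (transition S A).
Variables (pi : S -> A -> R) (d : S -> R) (Cb : R).
Hypothesis mix : mixing M pi d Cb.
Let piP := let: And4 h _ _ _ := mix in h.
Let d_stat := let: And4 _ _ h _ := mix in h.
Let d_dist := proj1 d_stat.
Local Notation E := (stat_mean M pi d).

Lemma step_mean_pair s (h : S -> S -> R) :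
  step_mean M pi s (fun z => h z.1.1 z.2) = \sum_u pol_chain M pi s u * h s u.
Proof. by rewrite -(step_mean_next M pi s (h s)); apply: eq_step_mean. Qed.

Lemma stat_mean_pair (h : S -> S -> R) :
  E (fun z => h z.1.1 z.2) = \sum_s \sum_u d s * pol_chain M pi s u * h s u.
Proof.
apply: eq_bigr => s _; rewrite step_mean_pair mulr_sumr.
by apply: eq_bigr => u _; rewrite mulrA.
Qed.

Lemma stat_mean_first (g : S -> R) : E (fun z => g z.1.1) = \sum_s d s * g s.
Proof.
apply: eq_bigr => s _; congr (_ * _); rewrite -[RHS](step_mean_cst M piP s).
exact: eq_step_mean.
Qed.

Lemma stat_mean_next (g : S -> R) : E (fun z => g z.2) = E (fun z => g z.1.1).
Proof.
rewrite (stat_mean_pair (fun _ u => g u)) stat_mean_first exchange_big/=.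
by apply: eq_bigr => u _; rewrite -mulr_suml; case: d_stat => _ ->.
Qed.

Lemma stat_meanN f : E (fun z => - f z) = - E f.
Proof.
by rewrite -mulN1r -stat_meanZ; congr stat_mean; apply: funext => z; rewrite mulN1r.
Qed.

Lemma stat_meanB f g : E (fun z => f z - g z) = E f - E g.
Proof. by rewrite stat_meanD stat_meanN. Qed.

Lemma stat_mean_ge0 f : (forall z, 0 <= f z) -> 0 <= E f.
Proof. by move=> h; rewrite -(stat_mean_cst M piP d_dist 0) stat_mean_le. Qed.

Lemma stat_mean_CS f g : E (fun z => f z * g z) ^+ 2 <=
  E (fun z => f z ^+ 2) * E (fun z => g z ^+ 2).
Proof.
set c := E (fun z => f z * g z); set a := E _; set b := E _.
have quad t : 0 <= a - 2 * t * c + t ^+ 2 * b.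
  have -> : a - 2 * t * c + t ^+ 2 * b = E (fun z => (f z - t * g z) ^+ 2).
    rewrite /a /b /c -!stat_meanZ -stat_meanB -stat_meanD.
    by congr stat_mean; apply: funext => z; ring.
  by apply: stat_mean_ge0 => z; rewrite sqr_ge0.
have b0 : 0 <= b by apply: stat_mean_ge0 => z; rewrite sqr_ge0.
have [b00|bn0] := eqVneq b 0.
  have [->|c0] := eqVneq c 0; first by rewrite b00 expr0n mulr0.
  have := quad ((a + 1) / (2 * c)); rewrite b00 mulr0 addr0.
  by have -> : a - 2 * ((a + 1) / (2 * c)) * c = -1; [field|rewrite ler0N1].
have bp : 0 < b by rewrite lt_neqAle eq_sym bn0.
have := quad (c / b).
have -> : a - 2 * (c / b) * c + (c / b) ^+ 2 * b = (a * b - c ^+ 2) / b by field.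
by rewrite pmulr_lge0 ?invr_gt0// subr_ge0.
Qed.

Definition vmean n (e : tr -> 'cV[R]_n) : 'cV[R]_n := \col_i E (fun z => e z i 0).

Lemma stat_mean_sum (I : finType) (F : I -> tr -> R) :
  E (fun z => \sum_i F i z) = \sum_i E (F i).
Proof.
elim: (index_enum I) => [|i r IH].
  rewrite big_nil -[RHS](stat_mean_cst M piP d_dist 0); congr stat_mean.
  by apply: funext => z; rewrite big_nil.
rewrite big_cons -IH -stat_meanD; congr stat_mean; apply: funext => z.
by rewrite big_cons.
Qed.

Lemma dotp_vmean n (e : tr -> 'cV[R]_n) u : dotp u (vmean e) = E (fun z => dotp u (e z)).
Proof.
rewrite dotpE (_ : (fun z => dotp u (e z)) = fun z => \sum_i u i 0 * e z i 0).
  by rewrite stat_mean_sum; apply: eq_bigr => i _; rewrite stat_meanZ mxE.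
by apply: funext => z; rewrite dotpE.
Qed.

Lemma enorm_vmean n (e : tr -> 'cV[R]_n) (b : R) : 0 <= b -> (forall z, enorm (e z) <= b) ->
  enorm (vmean e) <= b.
Proof.
move=> b0 eb; apply: enorm_dual => // u; rewrite dotp_vmean.
apply: le_trans (ler_norm _) _; apply: (stat_mean_norm M piP d_dist) => z.
by rewrite (le_trans (dotp_norm_le _ _))// mulrC ler_wpM2r ?enorm_ge0.
Qed.

Lemma reward_dev (z : tr) : `|reward M z.1.1 z.1.2 - mean_reward M pi d| <= 1.
Proof.
have /andP[? ?] := reward_ge0_le1 M z.1.1 z.1.2; have /andP[? ?] := mean_reward_ge0_le1 M piP d_dist.
by rewrite ler_norml; apply/andP; split; lra.
Qed.

End Stationary.

(** * The mean critic matrix and its kernel *)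

Section CriticMx.
Variables (R : realType) (S A : finType) (M : mdp R S A).
Notation tr := (transition S A).
Variables (pi : S -> A -> R) (Cb : R).
Notation d := (pol_stat M pi).
Hypothesis mix : mixing M pi d Cb.
Let piP := let: And4 h _ _ _ := mix in h.
Let d_stat := let: And4 _ _ h _ := mix in h.
Let d_dist := proj1 d_stat.
Local Notation E := (stat_mean M pi d).
Variables (m : nat) (phi : S -> 'cV[R]_m) (lambda : R).
Hypothesis phi1 : forall s, enorm (phi s) <= 1.
Hypothesis lambda0 : 0 < lambda.
Let C := critic_mx M pi phi.
Hypothesis coercive : forall x, in_ker_orth C x -> lambda * enorm x ^+ 2 <= dotp x (C *m x).

Lemma critic_mxE u x : dotp u (C *m x) =
  E (fun z => dotp u (phi z.1.1) * dotp (phi z.1.1 - phi z.2) x).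
Proof.
rewrite (stat_mean_pair M pi d (fun s s' => dotp u (phi s) * dotp (phi s - phi s') x)).
rewrite /C /critic_mx mulmx_suml dotp_sumr; apply: eq_bigr => s _.
rewrite mulmx_suml dotp_sumr; apply: eq_bigr => s' _.
by rewrite -scalemxAl dotpZr mulmx_dotp dotpZr (mulrC (dotp _ x)).
Qed.

(** By stationarity [phi z.2] and [phi z.1.1] have the same second moments, so the symmetric part of
    [C] is a Dirichlet form, hence nonnegative. *)
Lemma dirichlet_form x :
  2 * dotp x (C *m x) = E (fun z => dotp (phi z.2 - phi z.1.1) x ^+ 2).
Proof.
have h := stat_mean_next mix (fun s => dotp x (phi s) ^+ 2).
rewrite critic_mxE -stat_meanZ -[LHS]addr0 -[X in _ + X](subrr (E (fun z => dotp x (phi z.1.1) ^+ 2))).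
rewrite -{1}h -stat_meanB -stat_meanD; congr stat_mean; apply: funext => z.
by rewrite !dotpBl !(dotpC (phi _) x); ring.
Qed.

(** If [C v = 0], the Dirichlet form of [v] vanishes, so [dotp (phi s) v] is almost surely unchanged
    by a transition; Cauchy-Schwarz gives this in integrated form. *)
Lemma critic_ker_flat (v : 'cV[R]_m) (k : tr -> R) : C *m v = 0 ->
  E (fun z => k z * dotp (phi z.2 - phi z.1.1) v) = 0.
Proof.
move=> Cv; apply/eqP; rewrite -sqrf_eq0 eq_le sqr_ge0 andbT.
apply: le_trans (stat_mean_CS mix _ _) _.
by rewrite -dirichlet_form Cv dotp0r !mulr0.
Qed.

(** Makes the range of [C] orthogonal to its kernel, so that one orthogonal projection commutes with
    [C]. *)
Lemma critic_ker_tr (v : 'cV[R]_m) : C *m v = 0 -> C^T *m v = 0.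
Proof.
move=> Cv; apply: dotp_inj => u; rewrite dotp0r dotp_mulmx trmxK dotpC critic_mxE.
have h1 := stat_mean_next mix (fun s => dotp v (phi s) * dotp u (phi s)).
have h2 := critic_ker_flat (fun z => dotp u (phi z.2)) Cv.
rewrite -[RHS](_ : E (fun z => dotp v (phi z.1.1) * dotp u (phi z.1.1)) -
  E (fun z => dotp v (phi z.2) * dotp u (phi z.2)) +
  E (fun z => dotp u (phi z.2) * dotp (phi z.2 - phi z.1.1) v) = 0); last first.
  by rewrite h1 h2 subrr addr0.
rewrite -stat_meanB -stat_meanD; congr stat_mean; apply: funext => z.
by rewrite !dotpBl !(dotpC (phi _) u) !(dotpC (phi _) v); ring.
Qed.

Definition critic_rhs : 'cV[R]_m :=
  vmean M pi d (fun z => (reward M z.1.1 z.1.2 - mean_reward M pi d) *: phi z.1.1).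

(** The solvability condition for the critic equation. The Poisson equation writes the centered
    reward as [g s - g s'] in mean, and the weight [dotp v (phi s)] is constant along transitions,
    so the mean telescopes to 0. *)
Lemma critic_rhs_ker (v : 'cV[R]_m) : C *m v = 0 -> dotp v critic_rhs = 0.
Proof.
move=> Cv; rewrite (dotp_vmean mix); have [_ _ _ poisson] := mix.
pose r s := step_mean M pi s (fun z => reward M z.1.1 z.1.2).
have [|g [g1 _]] := poisson r 1.
  move=> s; rewrite ler_norml; apply/andP; split.
    rewrite -(step_mean_cst M piP s (-1)); apply: (step_mean_le piP) => a s' _ /=.
    by have /andP[? ?] := reward_ge0_le1 M s a; lra.
  rewrite -(step_mean_cst M piP s 1); apply: (step_mean_le piP) => a s' _ /=.
  by have /andP[] := reward_ge0_le1 M s a.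
pose f s := dotp v (phi s).
transitivity (\sum_s d s * ((r s - mean_reward M pi d) * f s)).
  apply: eq_bigr => s _; congr (_ * _).
  have -> : (r s - mean_reward M pi d) * f s = f s * r s + - (mean_reward M pi d * f s) by ring.
  rewrite /r -step_meanZ -[X in _ + X](step_mean_cst M piP s) -step_meanD.
  by apply: eq_step_mean => a s'; rewrite dotpZr /= /f; ring.
transitivity (E (fun z => (g z.1.1 - g z.2) * f z.1.1)).
  rewrite (stat_mean_pair M pi d (fun s u => (g s - g u) * f s)).
  apply: eq_bigr => s _.
  rewrite (_ : r s - _ = g s - \sum_u pol_chain M pi s u * g u); last first.
    by rewrite g1 /mean_reward /stat_mean.
  under [in RHS]eq_bigr do rewrite -mulrA; rewrite -mulr_sumr; congr (_ * _).
  rewrite -(step_mean_pair M pi s (fun s u => (g s - g u) * f s)).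
  have -> : (g s - \sum_u pol_chain M pi s u * g u) * f s =
     g s * f s + - f s * \sum_u pol_chain M pi s u * g u by ring.
  rewrite -(step_mean_next M pi s g) -(step_mean_cst M piP s (g s * f s)).
  by rewrite -step_meanZ -step_meanD; apply: eq_step_mean => a s' /=; ring.
have h1 := stat_mean_next mix (fun s => g s * f s).
have h2 := critic_ker_flat (fun z => g z.2) Cv.
rewrite -[RHS](_ : E (fun z => g z.1.1 * f z.1.1) - E (fun z => g z.2 * f z.2) +
  E (fun z => g z.2 * dotp (phi z.2 - phi z.1.1) v) = 0); last first.
  by rewrite h1 h2 subrr addr0.
rewrite -stat_meanB -stat_meanD; congr stat_mean; apply: funext => z.
by rewrite /f !dotpBl !(dotpC (phi _) v); ring.
Qed.

Lemma enorm_critic_mx x : enorm (C *m x) <= 2 * enorm x.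
Proof.
apply: enorm_dual => [|u]; first by rewrite mulr_ge0 ?enorm_ge0.
rewrite critic_mxE; apply: le_trans (ler_norm _) _.
apply: (stat_mean_norm M piP d_dist) => z; rewrite normrM [leRHS]mulrC.
apply: ler_pM => //.
  by apply: le_trans (dotp_norm_le _ _) _; rewrite ler_piMr ?enorm_ge0.
apply: le_trans (dotp_norm_le _ _) _; rewrite ler_wpM2r ?enorm_ge0//.
by rewrite (le_trans (enormB _ _))// (_ : 2 = 1 + 1)// lerD.
Qed.

(* The critic target, and the orthogonal projection Q onto (ker C)^perp = range C. *)
Lemma critic_target : exists (Q : 'M[R]_m) (zs : 'cV[R]_m),
  [/\ Q^T = Q, Q *m Q = Q, C *m Q = C & Q *m C = C] /\
  [/\ forall x : 'cV[R]_m, lambda * enorm (Q *m x) ^+ 2 <= dotp (Q *m x) (C *m x),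
      forall v : 'cV[R]_m, C *m (v - Q *m v) = 0, C *m zs = critic_rhs, Q *m zs = zs &
      enorm zs <= lambda^-1].
Proof.
have [N [NT NN CN Nfix]] := orth_proj_kernel C.
have CtN : C^T *m N = 0.
  apply/matrixP => i j.
  have := critic_ker_tr (v := N *m delta_mx j 0); rewrite mulmxA CN mul0mx => /(_ erefl).
  by rewrite mulmxA -colE => /colP /(_ i); rewrite [LHS]mxE => ->; rewrite !mxE.
have NC : N *m C = 0 by apply: trmx_inj; rewrite trmx_mul NT CtN trmx0.
pose Q := 1%:M - N.
have QT : Q^T = Q by rewrite /Q linearB/= trmx1 NT.
have QQ : Q *m Q = Q by rewrite /Q mulmxBr mulmx1 mulmxBl mul1mx NN subrr subr0.
have CQ : C *m Q = C by rewrite /Q mulmxBr mulmx1 CN subr0.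
have QC : Q *m C = C by rewrite /Q mulmxBl mul1mx NC subr0.
have coer (x : 'cV[R]_m) : lambda * enorm (Q *m x) ^+ 2 <= dotp (Q *m x) (C *m x).
  rewrite -{1}CQ -mulmxA; apply: coercive => y Cy.
  by rewrite dotp_mulmx QT /Q mulmxBl mul1mx Nfix// subrr dotp0l.
(* [Q] fixes [C] and annihilates [N], so a null vector of the sum is killed by both. Solving with
   [C + N] gives the target, whose kernel part is 0 by [critic_rhs_ker]. *)
have U : C + N \in unitmx.
  apply: unitmx_inj => x; rewrite mulmxDl => h.
  have Cx : C *m x = 0.
    have := congr1 (mulmx Q) h; rewrite mulmxDr mulmx0 !mulmxA QC.
    by rewrite {1}/Q mulmxBl mul1mx NN subrr mul0mx addr0.
  by have := Nfix x Cx; move: h; rewrite Cx add0r => -> <-.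
have [zs eqz] : exists zs, C *m zs + N *m zs = critic_rhs.
  by exists (invmx (C + N) *m critic_rhs); rewrite -mulmxDl mulmxA mulmxV// mul1mx.
have Nz : N *m zs = 0.
  have -> : N *m zs = N *m critic_rhs.
    by rewrite -eqz mulmxDr !mulmxA NC NN mul0mx add0r.
  apply: dotp_inj => u; rewrite dotp0r dotp_mulmx NT; apply: critic_rhs_ker.
  by rewrite mulmxA CN mul0mx.
have Cz : C *m zs = critic_rhs by rewrite -eqz Nz addr0.
have Qz : Q *m zs = zs by rewrite /Q mulmxBl mul1mx Nz subr0.
exists Q, zs; split=> //; split=> // [v|].
  by rewrite mulmxBr mulmxA CQ subrr.
have rhs1 : enorm critic_rhs <= 1.
  apply: (enorm_vmean mix) => // z; rewrite enormZ -[leRHS]mulr1.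
  by rewrite ler_pM ?enorm_ge0// (reward_dev mix).
have := coer zs; rewrite Qz Cz => h.
have [->|z0] := eqVneq (enorm zs) 0; first by rewrite invr_ge0 ltW.
have zp : 0 < enorm zs by rewrite lt_neqAle eq_sym z0 enorm_ge0.
rewrite -div1r ler_pdivlMr// -(ler_pM2r zp).
apply: le_trans (_ : lambda * enorm zs ^+ 2 <= _); first by rewrite expr2; lra.
apply: le_trans h _; apply: le_trans (dotp_le_enorm _ _) _.
by rewrite mulrC ler_pM2r.
Qed.

End CriticMx.

(** * The critic iteration read batch by batch *)

Section Batches.
Variables (R : realType) (S A : finType) (M : mdp R S A) (m : nat).
Notation tr := (transition S A).
Variables (phi : S -> 'cV[R]_m) (p : nac_steps R) (B : nat).
Implicit Types (l : seq tr).

Lemma batch_catl l1 l2 j : (j.+1 * B <= size l1)%N -> batch B (l1 ++ l2) j = batch B l1 j.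
Proof.
by rewrite mulSn => h; rewrite /batch !take_drop takel_cat.
Qed.

Lemma batch_catr l1 l2 i j : size l1 = (i * B)%N -> batch B (l1 ++ l2) (i + j) = batch B l2 j.
Proof.
move=> h; rewrite /batch drop_cat h mulnDl; case: ltnP => [|_].
  by rewrite ltnNge leq_addr.
by rewrite addKn.
Qed.

Lemma batch_full l : size l = B -> batch B l 0 = l.
Proof. by move=> h; rewrite /batch mul0n drop0 take_oversize ?h. Qed.

Lemma critic_iter_prefix H l1 l2 k x0 h : ((2 * H * k + h) * B <= size l1)%N ->
  critic_iter M phi p H B (l1 ++ l2) k x0 h = critic_iter M phi p H B l1 k x0 h.
Proof.
elim: h => //= h IH hs; rewrite batch_catl -?addnS// IH//.
by apply: leq_trans hs; rewrite leq_mul2r addnS leqnSn orbT.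
Qed.

Lemma critic_iter_shift H l1 l2 k x0 h : size l1 = (2 * H * k * B)%N ->
  critic_iter M phi p H B (l1 ++ l2) k x0 h = critic_iter M phi p H B l2 0 x0 h.
Proof. by move=> hs; elim: h => //= h IH; rewrite batch_catr// IH muln0 add0n. Qed.

Lemma critic_iter_last H l1 l2 x0 h : size l1 = (h * B)%N -> size l2 = B ->
  critic_iter M phi p H B (l1 ++ l2) 0 x0 h.+1 =
  batch_step B (beta p) (Av phi (cbeta p)) (bv M phi (cbeta p)) l2
    (critic_iter M phi p H B l1 0 x0 h).
Proof.
move=> h1 h2 /=; rewrite muln0 add0n -[X in batch _ _ X]addn0 (batch_catr _ _ h1) batch_full//.
by rewrite critic_iter_prefix// muln0 h1.
Qed.

Definition critic_dir (eta : R) (zeta : 'cV[R]_m) (z : tr) : 'cV[R]_m :=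
  (dotp (phi z.1.1 - phi z.2) zeta + eta - reward M z.1.1 z.1.2) *: phi z.1.1.

Lemma critic_increment (x : 'cV[R]_(1 + m)) z :
  Av phi (cbeta p) z *m x - bv M phi (cbeta p) z =
  col_mx (cbeta p * (usubmx x 0 0 - reward M z.1.1 z.1.2))%:M
    (critic_dir (usubmx x 0 0) (dsubmx x) z).
Proof.
case: z => [[s a] s'] /=; rewrite -{1}(vsubmxK x) mul_block_col mul0mx addr0.
rewrite {1 2}[usubmx x]mx11_scalar opp_col_mx add_col_mx; congr col_mx.
  by rewrite mul_scalar_mx -raddfN/= mulrBr raddfB/= scale_scalar_mx raddfN.
rewrite mul_mx_scalar mulmx_dotp -scalerDl -scalerBl /critic_dir; congr (_ *: _) => /=.
by rewrite (addrC (usubmx x 0 0)).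
Qed.

Lemma critic_step_col (x : 'cV[R]_(1 + m)) l :
  batch_step B (beta p) (Av phi (cbeta p)) (bv M phi (cbeta p)) l x =
  x - beta p *: (B%:R^-1 *: col_mx
    (\sum_(z <- l) cbeta p * (usubmx x 0 0 - reward M z.1.1 z.1.2))%:M
    (\sum_(z <- l) critic_dir (usubmx x 0 0) (dsubmx x) z)).
Proof.
rewrite /batch_step; congr (_ - _ *: (_ *: _)).
rewrite (eq_bigr _ (fun z _ => critic_increment x z)).
elim/big_rec3: _ => [|z u v w _ ->]; first by rewrite raddf0 col_mx0.
by rewrite add_col_mx raddfD.
Qed.

Lemma critic_step_eta (x : 'cV[R]_(1 + m)) l : beta p * cbeta p = 1 -> (0 < B)%N ->
  size l = B ->
  usubmx (batch_step B (beta p) (Av phi (cbeta p)) (bv M phi (cbeta p)) l x) 0 0 =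
  B%:R^-1 * \sum_(z <- l) reward M z.1.1 z.1.2.
Proof.
move=> bc B0 lB; rewrite critic_step_col linearB/= !linearZ/= col_mxKu -mulr_sumr !mxE /= mulr1n sumrB.
rewrite big_const_seq count_predT lB iter_addr_0 -[x (lshift m 0) 0 *+ B]mulr_natl.
move: (x _ 0) (\sum_(z <- l) _) => e r.
have -> : e + beta p * (B%:R^-1 * - (cbeta p * (B%:R * e - r))) =
  e - (beta p * cbeta p) * (B%:R^-1 * (B%:R * e) - B%:R^-1 * r) by ring.
by rewrite bc mul1r mulKf; [ring|rewrite pnatr_eq0 -lt0n].
Qed.

Lemma critic_step_zeta (x : 'cV[R]_(1 + m)) l :
  dsubmx (batch_step B (beta p) (Av phi (cbeta p)) (bv M phi (cbeta p)) l x) =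
  dsubmx x - beta p *: batch_mean (critic_dir (usubmx x 0 0) (dsubmx x)) B l.
Proof.
by rewrite critic_step_col linearB/= !linearZ/= col_mxKd.
Qed.

End Batches.

(** * One batch of the critic *)

Section CriticStep.
Variables (R : realType) (S A : finType) (M : mdp R S A).
Notation tr := (transition S A).
Variables (pi : S -> A -> R) (Cb : R).
Notation d := (pol_stat M pi).
Hypothesis mix : mixing M pi d Cb.
Let piP := let: And4 h _ _ _ := mix in h.
Let d_stat := let: And4 _ _ h _ := mix in h.
Let d_dist := proj1 d_stat.
Local Notation E := (stat_mean M pi d).
Local Notation J := (mean_reward M pi d).
Variables (m : nat) (phi : S -> 'cV[R]_m) (lambda : R).
Hypothesis phi1 : forall s, enorm (phi s) <= 1.
Hypotheses (lambda0 : 0 < lambda) (lambda1 : lambda <= 1).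
Let C := critic_mx M pi phi.
Variables (Q : 'M[R]_m) (zs : 'cV[R]_m).
Hypotheses (QT : Q^T = Q) (QQ : Q *m Q = Q) (CQ : C *m Q = C) (QC : Q *m C = C).
Hypothesis coer : forall x : 'cV[R]_m, lambda * enorm (Q *m x) ^+ 2 <= dotp (Q *m x) (C *m x).
Hypothesis Czs : C *m zs = critic_rhs M pi phi.
Hypothesis zs_le : enorm zs <= lambda^-1.
Variables (bt : R) (B : nat).
Hypotheses (bt0 : 0 < bt) (bt1 : 4 * bt <= lambda) (B0 : (0 < B)%N).
Let kap := batch_err Cb B.
Let a := bt * lambda.
(** [b1] bounds the critic direction at [zeta = zs], [eta = J]. In [ce], [m + 2] adds the variance
    and bias parts of the noise, and 3 comes from [sqr_sum3]. *)
Let b1 := 2 / lambda + 1.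
Let ce : R := 3 * (m%:R + 2).

(** Since [4 * bt <= lambda], the quadratic term [4 * bt ^ 2] uses up at most half of the gain
    [2 * bt * lambda]. *)
Lemma contract_C x : enorm (Q *m x - bt *: (C *m x)) ^+ 2 <= (1 - a) * enorm (Q *m x) ^+ 2.
Proof.
have h1 : enorm (C *m x) <= 2 * enorm (Q *m x).
  by rewrite -{1}CQ -mulmxA; exact: (enorm_critic_mx mix phi1).
have h2 : enorm (C *m x) ^+ 2 <= (2 * enorm (Q *m x)) ^+ 2.
  by rewrite ler_pXn2r ?nnegrE ?mulr_ge0 ?enorm_ge0.
rewrite enorm_sqr !(dotpBl, dotpBr, dotpZl, dotpZr) (dotpC (C *m x)) -!enorm_sqr.
have h3 := coer x; move: h2 h3; rewrite exprMn.
move: (enorm (C *m x) ^+ 2) (enorm_ge0 (Q *m x)) => c.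
move: (enorm (Q *m x)) (dotp _ _) => y w y0 h2 h3; rewrite /a.
have k1 : bt * (lambda * y ^+ 2) <= bt * w by rewrite ler_wpM2l// ltW.
have k2 : bt * (bt * c) <= bt * (bt * (2 ^+ 2 * y ^+ 2)) by rewrite !ler_wpM2l// ltW.
have k3 : bt * (4 * bt) * y ^+ 2 <= bt * lambda * y ^+ 2.
  by rewrite ler_wpM2r ?sqr_ge0// ler_wpM2l// ltW.
lra.
Qed.

(** The adjoint step on test vectors. The rate is halved in passing from the squared norm to the
    norm, as [1 - a <= (1 - a / 2) ^ 2]. *)
Lemma contract_Ct u : Q *m u = u -> enorm (u - bt *: (C^T *m u)) <= (1 - a / 2) * enorm u.
Proof.
move=> Qu; have a0 : 0 < a by rewrite mulr_gt0.
have a1 : a <= 1 by apply: mulr_ile1; [exact: ltW|exact: ltW|move: bt1 lambda1; lra|].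
apply: enorm_le; first by rewrite mulr_ge0 ?enorm_ge0//; lra.
rewrite !(dotpBl, dotpBr, dotpZl, dotpZr) (dotpC (C^T *m u)).
have -> : dotp u (C^T *m u) = dotp u (C *m u) by rewrite dotp_mulmx trmxK dotpC.
have h3 := coer u; rewrite Qu in h3.
have h1 : enorm (C^T *m u) <= 2 * enorm u.
  apply: enorm_dual => [|v]; first by rewrite mulr_ge0 ?enorm_ge0.
  rewrite dotp_mulmx trmxK; apply: le_trans (dotp_le_enorm _ _) _.
  have := enorm_critic_mx mix phi1 v => h; have := ler_wpM2r (enorm_ge0 u) h; rewrite -/C; lra.
have h2 : enorm (C^T *m u) ^+ 2 <= (2 * enorm u) ^+ 2.
  by rewrite ler_pXn2r ?nnegrE ?mulr_ge0 ?enorm_ge0.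
rewrite -!enorm_sqr; move: h2 h3; rewrite exprMn.
move: (enorm (C^T *m u) ^+ 2) (dotp _ _) (enorm u) => c w y h2 h3.
have k1 : bt * (lambda * y ^+ 2) <= bt * w by rewrite ler_wpM2l// ltW.
have k2 : bt * (bt * c) <= bt * (bt * (2 ^+ 2 * y ^+ 2)) by rewrite !ler_wpM2l// ltW.
have k3 : bt * (4 * bt) * y ^+ 2 <= bt * lambda * y ^+ 2.
  by rewrite ler_wpM2r ?sqr_ge0// ler_wpM2l// ltW.
have k4 : 0 <= (a / 2) ^+ 2 * y ^+ 2 by rewrite mulr_ge0 ?sqr_ge0.
by rewrite exprMn sqrrB expr1n; move: k4; rewrite /a; lra.
Qed.

(** On the whole space the step is merely nonexpansive: [dotp x (C x)] sees only [Q x]. *)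
Lemma contract_C_full x : enorm (x - bt *: (C *m x)) <= enorm x.
Proof.
apply: enorm_le; first exact: enorm_ge0.
have := contract_C x; rewrite enorm_sqr !(dotpBl, dotpBr, dotpZl, dotpZr).
rewrite (dotpC (C *m x)) -!enorm_sqr (dotpC (C *m x) x).
have -> : dotp x (C *m x) = dotp (Q *m x) (C *m x) by rewrite -{1}QC -mulmxA dotp_mulmx QT.
have a0 : 0 <= a by rewrite mulr_ge0// ltW.
have : 0 <= a * enorm (Q *m x) ^+ 2 by rewrite mulr_ge0 ?sqr_ge0.
lra.
Qed.

Variables (zeta : 'cV[R]_m) (eta : R) (s : S).
Let x := zeta - zs.
Let k := eta - J.
Let phibar := vmean M pi d (fun z => phi z.1.1).
Let ebar := C *m x + k *: phibar.
Let e := critic_dir M phi eta zeta.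
Let b := 2 * enorm x + `|k| + b1.

Lemma critic_dir_mean u : dotp u ebar = E (fun z => dotp u (e z)).
Proof.
rewrite /ebar /x mulmxBr Czs dotpDr dotpZr dotpBr critic_mxE /critic_rhs !(dotp_vmean mix).
rewrite -stat_meanB -stat_meanZ -stat_meanD; congr stat_mean; apply: funext => z.
by rewrite /e /critic_dir !dotpZr /k; ring.
Qed.

Lemma enorm_phibar : enorm phibar <= 1.
Proof. by apply: (enorm_vmean mix). Qed.

Lemma critic_b_ge0 : 0 <= b.
Proof.
rewrite /b /b1 !addr_ge0 ?mulr_ge0 ?enorm_ge0//.
by rewrite invr_ge0 ltW.
Qed.

Lemma critic_dir_le z : enorm (e z) <= b.
Proof.
rewrite /e /critic_dir enormZ; apply: le_trans (ler_piMr _ (phi1 _)) _ => //.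
rewrite -addrA; apply: le_trans (ler_normD _ _) _.
have h1 : `|dotp (phi z.1.1 - phi z.2) zeta| <= 2 * enorm zeta.
  apply: le_trans (dotp_norm_le _ _) _; rewrite ler_wpM2r ?enorm_ge0//.
  by apply: le_trans (enormB _ _) _; rewrite -[2]/(1 + 1) lerD.
have h2 : enorm zeta <= enorm x + lambda^-1.
  rewrite (_ : zeta = x + zs); last by rewrite /x subrK.
  by apply: le_trans (enormD _ _) _; rewrite lerD2l.
have h3 : `|eta - reward M z.1.1 z.1.2| <= `|k| + 1.
  have := reward_dev mix z; rewrite distrC => h3.
  rewrite (_ : eta - _ = k + (J - reward M z.1.1 z.1.2)); last by rewrite /k; ring.
  by apply: le_trans (ler_normD _ _) _; rewrite lerD2l.
rewrite /b /b1; lra.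
Qed.

Lemma critic_drift_le : enorm (x - bt *: ebar) <= enorm x + `|k|.
Proof.
rewrite /ebar scalerDr opprD addrA; apply: le_trans (enormB _ _) _.
apply: lerD; first exact: contract_C_full.
rewrite scalerA enormZ; apply: le_trans (ler_piMr _ enorm_phibar) _ => //.
by rewrite normrM gtr0_norm// ler_piMl//; move: bt1 lambda1; lra.
Qed.

Let err := kap * (ce * (4 * enorm x ^+ 2 + k ^+ 2 + b1 ^+ 2)).

Lemma critic_noise_le :
  kap * (2 * bt * enorm (x - bt *: ebar) * b + bt ^+ 2 * m%:R * b ^+ 2) <= err.
Proof.
have kap0 : 0 <= kap by exact: batch_err_ge0.
have b0 := critic_b_ge0; have bt_1 : bt <= 1 by move: bt1 lambda1; lra.
rewrite ler_wpM2l//.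
have h1 : enorm (x - bt *: ebar) <= b.
  apply: le_trans critic_drift_le _; rewrite /b.
  have : 0 <= b1 by rewrite /b1 addr_ge0// mulr_ge0// invr_ge0 ltW.
  by have := enorm_ge0 x; lra.
have h2 : b ^+ 2 <= 3 * (4 * enorm x ^+ 2 + k ^+ 2 + b1 ^+ 2).
  by apply: le_trans (sqr_sum3 _ _ _) _; rewrite exprMn real_normK ?num_real//; lra.
have h3 : bt ^+ 2 <= 1 by rewrite expr_le1// ltW.
have h4 : enorm (x - bt *: ebar) * b <= b ^+ 2 by rewrite expr2 ler_wpM2r.
have h5 : bt * (enorm (x - bt *: ebar) * b) <= b ^+ 2.
  by rewrite -[leRHS]mul1r ler_pM ?mulr_ge0 ?enorm_ge0// ltW.
have h6 : bt ^+ 2 * (m%:R * b ^+ 2) <= m%:R * b ^+ 2.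
  by rewrite ler_piMl// mulr_ge0 ?sqr_ge0.
have h7 : (m%:R + 2) * b ^+ 2 <= (m%:R + 2) * (3 * (4 * enorm x ^+ 2 + k ^+ 2 + b1 ^+ 2)).
  by rewrite ler_wpM2l ?addr_ge0.
rewrite /ce; lra.
Qed.

Let x' (l : seq tr) := zeta - bt *: batch_mean e B l - zs.

Lemma critic_next_eq l : x' l = x - bt *: batch_mean e B l.
Proof. by rewrite /x' /x addrAC. Qed.

(** The Young parameter [t] stays free: with [t = H], the unprojected error grows by a factor
    [1 + 1 / H] per batch only. *)
Lemma critic_full_sqr (t : R) : 0 < t ->
  rollout M pi B s (fun l => enorm (x' l) ^+ 2) <=
  (1 + t^-1) * enorm x ^+ 2 + (1 + t) * k ^+ 2 + err.
Proof.
move=> t0; have := @sa_step_sqr _ _ _ _ _ _ _ mix B B0 m e ebar b bt x critic_b_ge0 (ltW bt0)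
  critic_dir_le critic_dir_mean 1%:M s (trmx1 _ _) (mulmx1 _).
rewrite mul1mx => h; apply: le_trans (le_trans h (lerD _ critic_noise_le)); last first.
  apply: (@le_trans _ _ ((enorm x + `|k|) ^+ 2)).
    by rewrite ler_pXn2r ?nnegrE ?addr_ge0 ?enorm_ge0// critic_drift_le.
  have ti : 0 < t^-1 by rewrite invr_gt0.
  by apply: le_trans (young_sqr _ _ ti) _; rewrite invrK real_normK ?num_real.
by apply: (rollout_le piP) => l _ _; rewrite critic_next_eq mul1mx.
Qed.

Lemma critic_proj_sqr :
  rollout M pi B s (fun l => enorm (Q *m x' l) ^+ 2) <=
  (1 - a / 2) * enorm (Q *m x) ^+ 2 + (1 + 2 / a) * k ^+ 2 + err.
Proof.
have a0 : 0 < a by rewrite mulr_gt0.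
have := @sa_step_sqr _ _ _ _ _ _ _ mix B B0 m e ebar b bt x critic_b_ge0 (ltW bt0)
  critic_dir_le critic_dir_mean Q s QT QQ.
move=> h; apply: le_trans (le_trans h (lerD _ critic_noise_le)); last first.
  have -> : Q *m (x - bt *: ebar) = (Q *m x - bt *: (C *m x)) - (bt * k) *: (Q *m phibar).
    by rewrite (mulmxBr Q x) -scalemxAr (mulmxDr Q (C *m x)) (mulmxA Q C x) QC
      -(scalemxAr k) scalerDr scalerA opprD addrA.
  apply: (@le_trans _ _ ((enorm (Q *m x - bt *: (C *m x)) + `|k|) ^+ 2)).
    rewrite ler_pXn2r ?nnegrE ?addr_ge0 ?enorm_ge0//.
    apply: le_trans (enormB _ _) _; rewrite lerD2l enormZ.
    apply: le_trans (ler_piMr _ (le_trans (enorm_proj QT QQ _) enorm_phibar)) _ => //.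
    by rewrite normrM gtr0_norm// ler_piMl//; move: bt1 lambda1; lra.
  (* Young with parameter [a / 2] gives up half of the contraction:
     [(1 + a / 2) * (1 - a) <= 1 - a / 2]. *)
  have a2 : 0 < a / 2 by rewrite divr_gt0.
  apply: le_trans (young_sqr _ _ a2) _; rewrite invf_div real_normK ?num_real//.
  rewrite lerD2r; have := contract_C x; set w := enorm (_ - _) ^+ 2; set y := enorm (Q *m x) ^+ 2.
  move=> hw; have y0 : 0 <= y by rewrite sqr_ge0.
  have : (1 + a / 2) * w <= (1 + a / 2) * ((1 - a) * y) by rewrite ler_wpM2l//; lra.
  have : 0 <= a ^+ 2 * y by rewrite mulr_ge0 ?sqr_ge0.
  by rewrite expr2; lra.
by apply: (rollout_le piP) => l _ _; rewrite critic_next_eq.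
Qed.

(** The mean step is moved onto the test vector, so that later steps act on [u] deterministically
    while [x] stays untouched. *)
Lemma critic_bias u :
  `|rollout M pi B s (fun l => dotp u (x' l)) -
    (dotp (u - bt *: (C^T *m u)) x - k * (bt * dotp u phibar))| <= kap * (enorm u * b).
Proof.
have := @sa_step_mean _ _ _ _ _ _ _ mix B B0 m e ebar b bt x critic_b_ge0 (ltW bt0)
  critic_dir_le critic_dir_mean s u.
rewrite (_ : (fun l => dotp u (x - _)) = (fun l => dotp u (x' l))); last first.
  by apply: funext => l; rewrite critic_next_eq.
have -> : dotp u (x - bt *: ebar) = dotp (u - bt *: (C^T *m u)) x - k * (bt * dotp u phibar).
  rewrite /ebar (dotpBr x) dotpZr (dotpDr (C *m x)) (dotpZr k) (dotp_mulmx u C x).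
  by rewrite (dotpBl u) dotpZl; ring.
move=> h; apply: le_trans h _.
have kap0 : 0 <= kap by exact: batch_err_ge0.
rewrite ler_wpM2l// ler_wpM2r ?critic_b_ge0// ler_piMl ?enorm_ge0//.
by move: bt1 lambda1; lra.
Qed.

End CriticStep.

Lemma twice_le_sqr (R : realType) (t : R) : 2 * t <= 1 + t ^+ 2.
Proof. by have := sqr_ge0 (t - 1); rewrite sqrrB; lra. Qed.

Section ScalarVec.
Variables (R : realType).
Lemma dotp_scalar (u : 'cV[R]_1) (c : R) : dotp u c%:M = u 0 0 * c.
Proof. by rewrite dotpE big_ord_recl big_ord0 addr0 !mxE eqxx mulr1n. Qed.

Lemma enorm_scalar (c : R) : enorm (c%:M : 'cV[R]_1) = `|c|.
Proof. by rewrite /enorm big_ord_recl big_ord0 addr0 mxE eqxx mulr1n sqrtr_sqr. Qed.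

Lemma enorm_dsubmx n (x : 'cV[R]_(1 + n)) : enorm (dsubmx x) <= enorm x.
Proof.
apply: enorm_le; first exact: enorm_ge0.
rewrite enorm_sqr !dotpE big_split_ord/= big_ord_recl big_ord0 addr0.
rewrite ler_wpDl//; first by rewrite -expr2 sqr_ge0.
by apply: ler_sum => i _; rewrite !mxE.
Qed.

Lemma usubmx_le n (x : 'cV[R]_(1 + n)) : `|usubmx x 0 0| <= enorm x.
Proof. by rewrite mxE; exact: enorm_coord. Qed.
End ScalarVec.

Section RewardDev.
Variables (R : realType) (S A : finType) (M : mdp R S A).
Notation tr := (transition S A).
Variables (pi : S -> A -> R) (Cb : R) (B : nat).
Notation d := (pol_stat M pi).
Hypothesis mix : mixing M pi d Cb.
Hypothesis B0 : (0 < B)%N.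
Let piP := let: And4 h _ _ _ := mix in h.
Let Cb0 := let: And4 _ h _ _ := mix in h.
Let d_dist := let: And4 _ _ h _ := mix in proj1 h.
Let poisson := let: And4 _ _ _ h := mix in h.
Local Notation J := (mean_reward M pi d).
Let kap := batch_err Cb B.
(** Rewards are viewed as vectors of length 1, so the batch estimates for vectors apply. *)
Let e (z : tr) : 'cV[R]_1 := (reward M z.1.1 z.1.2)%:M.
Let rhat (l : seq tr) := B%:R^-1 * \sum_(z <- l) reward M z.1.1 z.1.2.

Lemma reward_batch_mean l : batch_mean e B l = (rhat l)%:M.
Proof.
rewrite /batch_mean /rhat -scale_scalar_mx; congr (_ *: _).
by rewrite raddf_sum.
Qed.

Lemma reward_dev_le z : enorm (e z) <= 1.
Proof.
rewrite /e enorm_scalar; have /andP[? ?] := reward_ge0_le1 M z.1.1 z.1.2.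
by rewrite ger0_norm.
Qed.

Lemma reward_ebar u : dotp u J%:M = stat_mean M pi d (fun z => dotp u (e z)).
Proof.
rewrite dotp_scalar -stat_meanZ; congr stat_mean; apply: funext => z.
by rewrite dotp_scalar.
Qed.

Lemma reward_batch_sqr s : rollout M pi B s (fun l => (rhat l - J) ^+ 2) <= kap.
Proof.
have := batch_mean_var piP Cb0 d_dist poisson ler01 reward_dev_le reward_ebar B0 s.
rewrite expr1n !mulr1; congr (_ <= _); congr rollout; apply: funext => l.
by rewrite reward_batch_mean -raddfB/= enorm_scalar real_normK ?num_real.
Qed.

Lemma reward_batch_bias s (u : R) : `|rollout M pi B s (fun l => (rhat l - J) * u)| <= kap * `|u|.
Proof.
have := batch_mean_bias piP Cb0 poisson ler01 reward_dev_le reward_ebar B0 s (u%:M).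
rewrite enorm_scalar mulr1; congr (`|_| <= _); congr rollout; apply: funext => l.
by rewrite reward_batch_mean -raddfB/= dotpC dotp_scalar !mxE eqxx mulr1n.
Qed.
End RewardDev.

(** * The whole critic phase *)

Section CriticPhase.
Variables (R : realType) (S A : finType) (M : mdp R S A).
Notation tr := (transition S A).
Variables (pi : S -> A -> R) (Cb : R).
Notation d := (pol_stat M pi).
Hypothesis mix : mixing M pi d Cb.
Let piP := let: And4 h _ _ _ := mix in h.
Local Notation J := (mean_reward M pi d).
Variables (m : nat) (phi : S -> 'cV[R]_m) (lambda : R).
Hypothesis phi1 : forall s, enorm (phi s) <= 1.
Hypotheses (lambda0 : 0 < lambda) (lambda1 : lambda <= 1).
Let C := critic_mx M pi phi.
Variables (Q : 'M[R]_m) (zs : 'cV[R]_m).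
Hypotheses (QT : Q^T = Q) (QQ : Q *m Q = Q) (CQ : C *m Q = C) (QC : Q *m C = C).
Hypothesis coer : forall x : 'cV[R]_m, lambda * enorm (Q *m x) ^+ 2 <= dotp (Q *m x) (C *m x).
Hypothesis Czs : C *m zs = critic_rhs M pi phi.
Hypothesis zs_le : enorm zs <= lambda^-1.
Variables (p : nac_steps R) (B H : nat) (R0 : R) (x0 : 'cV[R]_(1 + m)).
Hypotheses (bt0 : 0 < beta p) (bt1 : 4 * beta p <= lambda) (B0 : (0 < B)%N).
Hypotheses (bc : beta p * cbeta p = 1) (H0 : (0 < H)%N) (x0_le : enorm x0 <= R0).
Let kap := batch_err Cb B.
Let a := beta p * lambda.
Let b1 := 2 / lambda + 1.
Let ce : R := 3 * (m%:R + 2).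
Hypothesis kap_small : 4 * ce * kap * H%:R <= 1.

Let X h l := critic_iter M phi p H B l 0 x0 h.
Let eta h l := usubmx (X h l) 0 0.
Let zeta h l := dsubmx (X h l).
Let x h l := zeta h l - zs.
Let k h l := eta h l - J.
Let Ro s h F := rollout M pi (h * B) s F.

Lemma critic_rollout_step s h (G : R -> 'cV[R]_m -> R) :
  Ro s h.+1 (fun l => G (k h.+1 l) (x h.+1 l)) =
  Ro s h (fun l => rollout M pi B (end_state s l) (fun l' =>
    G (B%:R^-1 * \sum_(z <- l') reward M z.1.1 z.1.2 - J)
      (zeta h l - beta p *: batch_mean (critic_dir M phi (eta h l) (zeta h l)) B l' - zs))).
Proof.
rewrite /Ro mulSnr rollout_cat; apply: (eq_rollout piP) => l hl _.
apply: (eq_rollout piP) => l' hl' _.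
by rewrite /k /eta /x /zeta /X critic_iter_last// critic_step_eta// critic_step_zeta.
Qed.

Let n0 := (R0 + 1) ^+ 2.
Let w0 := (R0 + lambda^-1) ^+ 2.

Lemma R0_ge0 : 0 <= R0. Proof. exact: le_trans (enorm_ge0 _) x0_le. Qed.

Lemma critic_k0 : `|k 0 [::]| <= R0 + 1.
Proof.
have [_ _ [dP _] _] := mix; have /andP[j0 j1] := mean_reward_ge0_le1 M piP dP; have := usubmx_le x0.
rewrite /k /eta /X /= => h; apply: le_trans (ler_normB _ _) _.
by apply: lerD; [exact: le_trans h x0_le|rewrite ger0_norm].
Qed.

Lemma critic_x0 : enorm (x 0 [::]) <= R0 + lambda^-1.
Proof.
rewrite /x /zeta /X /=; apply: le_trans (enormB _ _) (lerD _ zs_le).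
by rewrite (le_trans (enorm_dsubmx _)).
Qed.

Lemma kap_ge0 : 0 <= kap. Proof. exact: batch_err_ge0. Qed.

Lemma ce_kap_le : 4 * ce * kap <= H%:R^-1.
Proof. by rewrite -div1r ler_pdivlMr ?ltr0n. Qed.

Lemma H_inv_le1 : H%:R^-1 <= 1 :> R.
Proof. by rewrite invf_le1 ?ltr0n// ler1n. Qed.

Lemma ce_ge6 : 6 <= ce. Proof. by rewrite /ce; have : 0 <= m%:R :> R by []; lra. Qed.

Lemma kap_le1 : kap <= 1.
Proof.
have := ce_kap_le; have := H_inv_le1; have := ce_ge6; have := kap_ge0; nra.
Qed.

Lemma critic_k_sqr s h : Ro s h (fun l => k h l ^+ 2) <= n0 + 1.
Proof.
case: h => [|h].
  rewrite /Ro mul0n /=; have := critic_k0; have := R0_ge0 => r0 h.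
  apply: (@le_trans _ _ n0); last by rewrite lerDl.
  rewrite -(real_normK (num_real (k 0 [::]))) /n0 ler_pXn2r ?nnegrE ?addr_ge0//.
rewrite (critic_rollout_step s h (fun k _ => k ^+ 2)).
apply: (@le_trans _ _ 1); last by rewrite lerDr /n0 sqr_ge0.
rewrite -[leRHS](rollout_cst M piP (h * B) s); apply: (rollout_le piP) => l _ _.
exact: le_trans (reward_batch_sqr mix B0 _) kap_le1.
Qed.

Lemma critic_k_sqrS s h : Ro s h.+1 (fun l => k h.+1 l ^+ 2) <= kap.
Proof.
rewrite (critic_rollout_step s h (fun k _ => k ^+ 2)).
rewrite -[leRHS](rollout_cst M piP (h * B) s); apply: (rollout_le piP) => l _ _.
exact: (reward_batch_sqr mix B0 _).
Qed.

Lemma critic_k_biasS s h u : `|Ro s h.+1 (fun l => k h.+1 l * u)| <= kap * `|u|.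
Proof.
rewrite (critic_rollout_step s h (fun k _ => k * u)).
apply: le_trans (ler_norm_rollout M piP _ _ _) _.
rewrite -[leRHS](rollout_cst M piP (h * B) s); apply: (rollout_le piP) => l _ _.
exact: (reward_batch_bias mix B0).
Qed.

Let W s h := Ro s h (fun l => enorm (x h l) ^+ 2).
Let N s h := Ro s h (fun l => k h l ^+ 2).
Let Y s h := Ro s h (fun l => enorm (Q *m x h l) ^+ 2).

(** Young's inequality with [t = H] and the noise bounded by [kap_small] each cost a factor
    increment [1 / H]. *)
Lemma critic_W_step s h : W s h.+1 <= (1 + 2 / H%:R) * W s h +
  ((2 + H%:R) * (n0 + 1) + b1 ^+ 2).
Proof.
have Hp : 0 < H%:R :> R by rewrite ltr0n.
rewrite /W (critic_rollout_step s h (fun _ x => enorm x ^+ 2)).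
apply: (@le_trans _ _ (Ro s h (fun l => ((1 + H%:R^-1) * enorm (x h l) ^+ 2 +
  (1 + H%:R) * k h l ^+ 2) + (kap * ce) * (4 * enorm (x h l) ^+ 2 + (k h l ^+ 2 + b1 ^+ 2))))).
  apply: (rollout_le piP) => l _ _.
  have := critic_full_sqr mix phi1 lambda0 lambda1 QT CQ QC coer
    Czs zs_le bt0 bt1 B0 (zeta h l) (eta h l) (end_state s l) Hp.
  move=> h1; apply: le_trans h1 _; rewrite -/(x h l) -/(k h l) -/kap -/ce -/b1; lra.
rewrite /Ro !(rolloutD, rolloutZ, rollout_cst)// -/(Ro s h _) -/(Ro s h _) -/(W s h) -/(N s h).
have k1 := ce_kap_le; have k2 := H_inv_le1.
have W0 : 0 <= W s h by apply: (rollout_ge0 piP) => l _ _; rewrite sqr_ge0.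
have N1 : N s h <= n0 + 1 by exact: critic_k_sqr.
have N0 : 0 <= N s h by apply: (rollout_ge0 piP) => l _ _; rewrite sqr_ge0.
have k3 : kap * ce * 4 * W s h <= H%:R^-1 * W s h by rewrite ler_wpM2r//; lra.
have k4 : kap * ce * (N s h + b1 ^+ 2) <= 1 * (N s h + b1 ^+ 2).
  rewrite ler_wpM2r ?addr_ge0 ?sqr_ge0//.
  have : 0 <= kap * ce by rewrite mulr_ge0 ?kap_ge0//; have := ce_ge6; lra.
  lra.
have k5 : (2 + H%:R) * N s h <= (2 + H%:R) * (n0 + 1) by rewrite ler_wpM2l//; lra.
lra.
Qed.

Let kW := expR 2 * (w0 + 3 * (n0 + 1) + b1 ^+ 2).

Lemma H_ge1 : 1 <= H%:R :> R. Proof. by rewrite ler1n. Qed.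

(** Over the phase the growth factor is at most [(1 + 2 / H) ^ H <= expR 2], and the forcing adds
    [O(H)] at each of [H] steps. *)
Lemma critic_W_le s h : (h <= H)%N -> W s h <= kW * H%:R ^+ 2.
Proof.
move=> hH; have H1 := H_ge1.
have Hp : 0 < H%:R :> R by rewrite ltr0n.
set e := ((2 + H%:R) * (n0 + 1) + b1 ^+ 2) : R.
have n00 : 0 <= n0 by rewrite /n0 sqr_ge0.
have w00 : 0 <= w0 by rewrite /w0 sqr_ge0.
have e0 : 0 <= e by rewrite /e addr_ge0 ?sqr_ge0// mulr_ge0 ?addr_ge0//.
have q1 : 1 <= 1 + 2 / H%:R :> R by rewrite lerDl divr_ge0.
have Wge0 j : 0 <= W s j by apply: (rollout_ge0 piP) => l _ _; rewrite sqr_ge0.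
apply: le_trans (growth_rec q1 Wge0 e0 (fun j _ => critic_W_step s j) hH) _.
have W0 : W s 0 <= w0.
  have li : 0 <= lambda^-1 by rewrite invr_ge0 ltW.
  rewrite /W /Ro mul0n /= /w0 ler_pXn2r ?nnegrE ?enorm_ge0 ?addr_ge0 ?R0_ge0//.
  exact: critic_x0.
have pw : (1 + 2 / H%:R) ^+ h <= expR 2 :> R.
  apply: (@le_trans _ _ ((expR (2 / H%:R)) ^+ h)).
    by apply: lerXn2r; rewrite ?nnegrE ?expR_ge0 ?(le_trans _ q1)// expR_ge1Dx.
  rewrite -expRM_natl ler_expR mulrA ler_pdivrMr// mulrC ler_pM2l// ler_nat//.
rewrite /kW -mulrA; apply: ler_pM => //.
  by rewrite addr_ge0// mulr_ge0.
have hh : h%:R * e <= H%:R * e by rewrite ler_wpM2r// ler_nat.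
have HH : H%:R <= H%:R ^+ 2 :> R by rewrite expr2 ler_peMr.
have c1 : w0 <= w0 * H%:R ^+ 2 by rewrite ler_peMr//; lra.
have c2 : H%:R * b1 ^+ 2 <= H%:R ^+ 2 * b1 ^+ 2 by rewrite ler_wpM2r ?sqr_ge0.
have c3 : H%:R * (n0 + 1) <= H%:R ^+ 2 * (n0 + 1) by rewrite ler_wpM2r//; lra.
have eE : e = (2 + H%:R) * (n0 + 1) + b1 ^+ 2 by [].
apply: le_trans (lerD W0 hh) _; clearbody e; rewrite eE; lra.
Qed.

Let q := 1 - a / 2.

Lemma critic_a_gt0 : 0 < a. Proof. by rewrite mulr_gt0. Qed.
Lemma critic_a_le1 : a <= 1.
Proof. by apply: mulr_ile1; [exact: ltW|exact: ltW|move: bt1 lambda1; lra|]. Qed.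

Lemma critic_Y_step s h : Y s h.+1 <= q * Y s h + (1 + 2 / a) * N s h +
  kap * ce * (4 * W s h + (N s h + b1 ^+ 2)).
Proof.
rewrite /Y (critic_rollout_step s h (fun _ x => enorm (Q *m x) ^+ 2)).
apply: (@le_trans _ _ (Ro s h (fun l => (q * enorm (Q *m x h l) ^+ 2 +
  (1 + 2 / a) * k h l ^+ 2) + (kap * ce) * (4 * enorm (x h l) ^+ 2 + (k h l ^+ 2 + b1 ^+ 2))))).
  apply: (rollout_le piP) => l _ _.
  have := critic_proj_sqr mix phi1 lambda0 lambda1 QT QQ CQ QC coer
    Czs zs_le bt0 bt1 B0 (zeta h l) (eta h l) (end_state s l).
  move=> h1; apply: le_trans h1 _; rewrite -/(x h l) -/(k h l) -/a -/q -/kap -/ce -/b1; lra.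
by rewrite /Ro !(rolloutD, rolloutZ, rollout_cst).
Qed.

Let y1 := 5 * w0 + (2 + 2 / a) * n0 + b1 ^+ 2.
Let kY := (1 + 2 / a) + ce * (4 * kW + 1 + b1 ^+ 2).

Lemma critic_W_ge0 s h : 0 <= W s h.
Proof. by apply: (rollout_ge0 piP) => l _ _; rewrite sqr_ge0. Qed.
Lemma critic_N_ge0 s h : 0 <= N s h.
Proof. by apply: (rollout_ge0 piP) => l _ _; rewrite sqr_ge0. Qed.

Lemma critic_N0 s : N s 0 <= n0.
Proof.
rewrite /N /Ro mul0n /= -(real_normK (num_real (k 0 [::]))) /n0.
by rewrite ler_pXn2r ?nnegrE ?addr_ge0 ?R0_ge0//; exact: critic_k0.
Qed.

Lemma critic_W0 s : W s 0 <= w0.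
Proof.
have li : 0 <= lambda^-1 by rewrite invr_ge0 ltW.
rewrite /W /Ro mul0n /= /w0 ler_pXn2r ?nnegrE ?enorm_ge0 ?addr_ge0 ?R0_ge0//.
exact: critic_x0.
Qed.

Lemma kW_ge0 : 0 <= kW.
Proof.
have n00 : 0 <= n0 by rewrite /n0 sqr_ge0.
have w00 : 0 <= w0 by rewrite /w0 sqr_ge0.
apply: mulr_ge0; first exact: expR_ge0.
by have := sqr_ge0 b1; lra.
Qed.

Lemma ce_kap1 : 0 <= kap * ce <= 1.
Proof.
have := ce_kap_le; have := H_inv_le1; have := ce_ge6; have := kap_ge0.
by move=> h1 h2 h3 h4; rewrite mulr_ge0//=; [nra|lra].
Qed.

Lemma critic_q : 0 <= q < 1.
Proof. by have := critic_a_gt0; have := critic_a_le1; rewrite /q => ? ?; apply/andP; split; lra. Qed.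

(** The first batch still uses the initial reward estimate, whose error is of order 1 and not [kap].
    The contraction is therefore counted from the second batch on, whence the exponent [H.-1]. *)
Lemma critic_Y1 s : Y s 1 <= y1.
Proof.
apply: le_trans (critic_Y_step s 0) _.
have /andP[q0 q1] := critic_q; have /andP[c0 c1] := ce_kap1.
have a0 := critic_a_gt0; have ai : 0 <= a^-1 by rewrite invr_ge0 ltW.
have Y0 : Y s 0 <= W s 0.
  apply: (rollout_le piP) => l _ _.
  by rewrite ler_pXn2r ?nnegrE ?enorm_ge0// enorm_proj.
have Yp : 0 <= Y s 0 by apply: (rollout_ge0 piP) => l _ _; rewrite sqr_ge0.
have k1 : q * Y s 0 <= 1 * Y s 0 by rewrite ler_wpM2r// ltW.
have W0 := critic_W0 s; have N0 := critic_N0 s.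
have Wp := critic_W_ge0 s 0; have Np := critic_N_ge0 s 0.
have k2 : (1 + 2 / a) * N s 0 <= (1 + 2 / a) * n0 by rewrite ler_wpM2l// addr_ge0// mulr_ge0.
have k3 : kap * ce * (4 * W s 0 + (N s 0 + b1 ^+ 2)) <= 1 * (4 * W s 0 + (N s 0 + b1 ^+ 2)).
  by rewrite ler_wpM2r//; have := sqr_ge0 b1; lra.
rewrite /y1; lra.
Qed.

Lemma HH_ge1 : 1 <= H%:R ^+ 2 :> R. Proof. by rewrite exprn_ege1// H_ge1. Qed.

Lemma critic_Y_le s : Y s H <= y1 * q ^+ H.-1 + 2 / a * kY * kap * H%:R ^+ 2.
Proof.
have /andP[q0 q1] := critic_q; have a0 := critic_a_gt0.
have H1 := HH_ge1; have kp := kap_ge0; have kp1 := kap_le1.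
have ai : 0 <= 2 / a by rewrite divr_ge0// ltW.
have kW0 := kW_ge0; have ce6 := ce_ge6; have /andP[c0 c1] := ce_kap1.
pose e := kY * kap * H%:R ^+ 2.
have kY0 : 0 <= kY.
  by rewrite /kY addr_ge0 ?addr_ge0// mulr_ge0//; have := sqr_ge0 b1; lra.
have e0 : 0 <= e by apply: mulr_ge0; [exact: mulr_ge0|exact: exprn_ge0].
(* From here on the reward error is at most [kap], and the [H ^ 2] bound on [W] enters with the
   factor [kap * ce]. *)
have rec h : (h < H.-1)%N -> Y s h.+2 <= q * Y s h.+1 + e.
  move=> hH; have hH' : (h.+1 <= H)%N by exact: leq_trans hH (leq_pred H).
  apply: le_trans (critic_Y_step s h.+1) _; rewrite -addrA lerD2l.
  have k1 := critic_k_sqrS s h; rewrite -/(N s h.+1) in k1.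
  have k2 := critic_W_le s hH'; have k3 := critic_N_ge0 s h.+1.
  have k4 : (1 + 2 / a) * N s h.+1 <= (1 + 2 / a) * (kap * H%:R ^+ 2).
    rewrite ler_wpM2l ?addr_ge0//; apply: le_trans k1 _; rewrite ler_peMr//.
  have k5 : kap * ce * (4 * W s h.+1 + (N s h.+1 + b1 ^+ 2)) <=
      kap * ce * ((4 * kW + 1 + b1 ^+ 2) * H%:R ^+ 2).
    rewrite ler_wpM2l//.
    have : b1 ^+ 2 <= b1 ^+ 2 * H%:R ^+ 2 by rewrite ler_peMr ?sqr_ge0.
    lra.
  rewrite /e /kY; lra.
have := affine_rec_le (u := fun h => Y s h.+1) q0 q1 e0 rec (leqnn _).
rewrite prednK// => h; apply: le_trans h _; apply: lerD.
  by rewrite mulrC ler_wpM2r ?exprn_ge0// critic_Y1.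
have -> : 1 - q = a / 2 by rewrite /q; ring.
by rewrite /e invf_div; lra.
Qed.

Let y2 := 3 * (1 + w0) + 2 * (1 + n0) + b1.
Let kb := 4 + kW + n0 + b1.

Lemma b1_ge0 : 0 <= b1. Proof. by rewrite /b1 addr_ge0// divr_ge0// ltW. Qed.

Lemma critic_bias_step s h u : Q *m u = u ->
  `|Ro s h.+1 (fun l => dotp u (x h.+1 l))| <=
  `|Ro s h (fun l => dotp (u - beta p *: (C^T *m u)) (x h l))| +
  `|Ro s h (fun l => k h l * (beta p * dotp u (vmean M pi d (fun z => phi z.1.1))))| +
  kap * (enorm u * (2 + W s h + N s h + b1)).
Proof.
move=> Qu; rewrite (critic_rollout_step s h (fun _ x => dotp u x)).
set F := (X in `|Ro s h X| <= _).
set G1 := (X in _ <= `|Ro s h X| + _ + _); set G2 := (X in _ <= _ + `|Ro s h X| + _).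
have b0 := b1_ge0.
have dev : `|Ro s h (fun l => F l - (G1 l - G2 l))| <=
    kap * (enorm u * (2 + W s h + N s h + b1)).
  apply: le_trans (ler_norm_rollout M piP _ _ _) _.
  apply: (@le_trans _ _ (Ro s h (fun l => kap * enorm u *
      ((2 + b1) + (enorm (x h l) ^+ 2 + k h l ^+ 2))))).
    apply: (rollout_le piP) => l _ _.
    have := critic_bias mix phi1 lambda0 lambda1 Czs zs_le bt0 bt1 B0
      (zeta h l) (eta h l) (end_state s l) u.
    have ku : 0 <= kap * enorm u by apply: mulr_ge0; [exact: kap_ge0|exact: enorm_ge0].
    move=> h1; apply: le_trans h1 _; rewrite mulrA ler_wpM2l//.
    rewrite -/(x h l) -/(k h l) -/b1.
    have := twice_le_sqr (enorm (x h l)); have := twice_le_sqr `|k h l|.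
    rewrite real_normK ?num_real//; have := normr_ge0 (k h l); lra.
  rewrite /Ro !(rolloutD, rolloutZ, rollout_cst)// -/(Ro s h _) -/(Ro s h _) -/(W s h) -/(N s h); lra.
have -> : Ro s h F = Ro s h G1 - Ro s h G2 + Ro s h (fun l => F l - (G1 l - G2 l)).
  by rewrite /Ro !rolloutB; ring.
apply: le_trans (ler_normD _ _) _; rewrite lerD//; exact: ler_normB.
Qed.

Lemma critic_bias1 s u : Q *m u = u ->
  `|Ro s 1 (fun l => dotp u (x 1 l))| <= enorm u * y2.
Proof.
move=> Qu; have h0 := critic_bias_step s 0 Qu; apply: le_trans h0 _.
have kp := kap_ge0; have kp1 := kap_le1; have b0 := b1_ge0.
have W0 := critic_W0 s; have N0 := critic_N0 s; have u0 := enorm_ge0 u.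
rewrite {1 2}/Ro mul0n /=.
have xs : enorm (x 0 [::]) <= 1 + w0.
  have : enorm (x 0 [::]) ^+ 2 <= w0 by have := critic_W0 s; rewrite /W /Ro mul0n.
  by have := twice_le_sqr (enorm (x 0 [::])); have := enorm_ge0 (x 0 [::]); lra.
have ks : `|k 0 [::]| <= 1 + n0.
  have := critic_k0; have := R0_ge0 => r0 h; apply: le_trans h _; rewrite /n0.
  by have := twice_le_sqr (R0 + 1); lra.
have t1 : `|dotp (u - beta p *: (C^T *m u)) (x 0 [::])| <= enorm u * (1 + w0).
  apply: le_trans (dotp_norm_le _ _) _; apply: ler_pM; rewrite ?enorm_ge0//.
  have := contract_Ct mix phi1 lambda0 lambda1 coer bt0 bt1 Qu.
  by have /andP[? ?] := critic_q; rewrite -/a -/q => h; apply: le_trans h _; rewrite ler_piMl// ltW.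
have phb : `|beta p * dotp u (vmean M pi d (fun z => phi z.1.1))| <= enorm u.
  rewrite normrM gtr0_norm//; apply: (@le_trans _ _ (1 * (enorm u * 1))); last by rewrite mul1r mulr1.
  apply: ler_pM => //; [exact: ltW|move: bt1 lambda1; lra|].
  by apply: le_trans (dotp_norm_le _ _) _; rewrite ler_wpM2l//; exact: (enorm_phibar mix).
have t2 : `|k 0 [::] * (beta p * dotp u (vmean M pi d (fun z => phi z.1.1)))| <= (1 + n0) * enorm u.
  by rewrite normrM ler_pM.
have t3 : kap * (enorm u * (2 + W s 0 + N s 0 + b1)) <= 1 * (enorm u * (2 + w0 + n0 + b1)).
  apply: ler_pM => //.
    have := critic_W_ge0 s 0; have := critic_N_ge0 s 0 => N00 W00.
    by apply: mulr_ge0 => //; lra.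
  by rewrite ler_wpM2l//; lra.
have n00 : 0 <= n0 by rewrite /n0 sqr_ge0.
have w00 : 0 <= w0 by rewrite /w0 sqr_ge0.
have : 0 <= enorm u * (w0 + 1) by rewrite mulr_ge0 ?addr_ge0.
rewrite /y2; lra.
Qed.

(** Induction on [h] for all [u] in the range of [Q]: one step replaces [u] by
    [u - beta p *: (C^T *m u)], which stays in that range and is shorter by the factor [q]. The
    geometric sum of the batch biases gives [2 / a]. *)
Lemma critic_bias_le s h u : (h < H)%N -> Q *m u = u ->
  `|Ro s h.+1 (fun l => dotp u (x h.+1 l))| <=
  enorm u * (q ^+ h * y2 + 2 / a * (kb * kap * H%:R ^+ 2)).
Proof.
have /andP[q0 q1] := critic_q; have a0 := critic_a_gt0.
have H1 := HH_ge1; have kp := kap_ge0; have kp1 := kap_le1; have b0 := b1_ge0.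
have kW0 := kW_ge0; have n00 : 0 <= n0 by rewrite /n0 sqr_ge0.
have kb0 : 0 <= kb by rewrite /kb; lra.
have ai : 0 <= 2 / a by rewrite divr_ge0// ltW.
set e := kb * kap * H%:R ^+ 2.
have e0 : 0 <= e by apply: mulr_ge0; [exact: mulr_ge0|exact: exprn_ge0].
elim: h u => [|h IH] u hH Qu.
  apply: le_trans (critic_bias1 s Qu) _; rewrite ler_wpM2l ?enorm_ge0//.
  by rewrite expr0 mul1r lerDl mulr_ge0.
apply: le_trans (critic_bias_step s h.+1 Qu) _.
pose u' := u - beta p *: (C^T *m u).
have Qu' : Q *m u' = u'.
  rewrite /u' mulmxBr Qu -scalemxAr mulmxA.
  by have -> : Q *m C^T = C^T by apply: trmx_inj; rewrite trmx_mul trmxK QT CQ.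
have nu' : enorm u' <= q * enorm u.
  exact: (contract_Ct mix phi1 lambda0 lambda1 coer bt0 bt1 Qu).
have u0 := enorm_ge0 u.
have y20 : 0 <= y2 by have := sqr_ge0 (R0 + lambda^-1); rewrite -/w0 /y2; lra.
have t1 : `|Ro s h.+1 (fun l => dotp u' (x h.+1 l))| <=
    q * enorm u * (q ^+ h * y2 + 2 / a * e).
  apply: le_trans (IH u' (ltnW hH) Qu') _; rewrite ler_wpM2r//.
  by apply: addr_ge0; apply: mulr_ge0 => //; exact: exprn_ge0.
have phb : `|beta p * dotp u (vmean M pi d (fun z => phi z.1.1))| <= enorm u.
  rewrite normrM gtr0_norm//; apply: (@le_trans _ _ (1 * (enorm u * 1))); last by rewrite mul1r mulr1.
  apply: ler_pM => //; [exact: ltW|move: bt1 lambda1; lra|].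
  by apply: le_trans (dotp_norm_le _ _) _; rewrite ler_wpM2l//; exact: (enorm_phibar mix).
have t2 := critic_k_biasS s h (beta p * dotp u (vmean M pi d (fun z => phi z.1.1))).
have t2' : kap * `|beta p * dotp u (vmean M pi d (fun z => phi z.1.1))| <= kap * enorm u * H%:R ^+ 2.
  by apply: (@le_trans _ _ (kap * enorm u)); rewrite ?ler_wpM2l// ler_peMr// mulr_ge0.
have t3 : kap * (enorm u * (2 + W s h.+1 + N s h.+1 + b1)) <=
    kap * (enorm u * ((kb - 1) * H%:R ^+ 2)).
  rewrite !ler_wpM2l//.
  have k1 := critic_W_le s (ltnW hH); have k2 := critic_k_sqr s h.+1; rewrite -/(N s h.+1) in k2.
  have k3 : (3 + n0 + b1) * 1 <= (3 + n0 + b1) * H%:R ^+ 2.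
    by rewrite ler_wpM2l//; lra.
  rewrite /kb; lra.
have -> : enorm u * (q ^+ h.+1 * y2 + 2 / a * e) =
   q * enorm u * (q ^+ h * y2 + 2 / a * e) + enorm u * e.
  by rewrite exprS /q; field; rewrite gt_eqF.
have : enorm u * e = kap * enorm u * H%:R ^+ 2 + kap * (enorm u * ((kb - 1) * H%:R ^+ 2)).
  by rewrite /e; ring.
move: t1; rewrite /u'; lra.
Qed.

End CriticPhase.

(** * The NPG iteration *)

Section NpgBatches.
Variables (R : realType) (S A : finType) (M : mdp R S A) (m d : nat).
Notation tr := (transition S A).
Variables (piF : 'cV[R]_d -> S -> A -> R) (theta : 'cV[R]_d).
Variables (phi : S -> 'cV[R]_m) (p : nac_steps R) (B : nat) (xi : 'cV[R]_(1 + m)).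
Implicit Types (l : seq tr).
Let sc := score piF theta.

Definition td_error (eta : R) (zeta : 'cV[R]_m) (z : tr) : R :=
  reward M z.1.1 z.1.2 - eta + dotp zeta (phi z.2 - phi z.1.1).

Definition npg_dir (eta : R) (zeta : 'cV[R]_m) (w : 'cV[R]_d) (z : tr) : 'cV[R]_d :=
  (dotp (sc z.1.1 z.1.2) w - td_error eta zeta z) *: sc z.1.1 z.1.2.

(** The NPG iteration on the transitions of its own phase, with the preceding critic batches
    removed. *)
Fixpoint npg_run l (w : 'cV[R]_d) h : 'cV[R]_d :=
  if h is h'.+1 then
    batch_step B (gamma p) (Au piF theta) (bu M piF phi theta xi) (batch B l h')
      (npg_run l w h')
  else w.

Lemma npg_iter_run H l1 l2 w h : size l1 = (H * B)%N ->
  npg_iter M piF phi p H B (l1 ++ l2) 0 theta xi w h = npg_run l2 w h.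
Proof. by move=> h1; elim: h => //= h ->; rewrite muln0 add0n (batch_catr _ _ h1). Qed.

Lemma npg_iter_shift H l1 l2 k w h : size l1 = (2 * H * k * B)%N ->
  npg_iter M piF phi p H B (l1 ++ l2) k theta xi w h =
  npg_iter M piF phi p H B l2 0 theta xi w h.
Proof.
by move=> hs; elim: h => //= h IH; rewrite -addnA batch_catr// IH muln0 add0n.
Qed.

Lemma npg_iter_prefix H l1 l2 k w h : ((2 * H * k + H + h) * B <= size l1)%N ->
  npg_iter M piF phi p H B (l1 ++ l2) k theta xi w h =
  npg_iter M piF phi p H B l1 k theta xi w h.
Proof.
elim: h => //= h IH hs; rewrite batch_catl -?addnS// IH//.
by apply: leq_trans hs; rewrite leq_mul2r addnS leqnSn orbT.
Qed.

Lemma npg_run_prefix l1 l2 w h : (h * B <= size l1)%N ->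
  npg_run (l1 ++ l2) w h = npg_run l1 w h.
Proof.
elim: h => //= h IH hs; rewrite batch_catl// IH//.
by apply: leq_trans hs; rewrite leq_mul2r leqnSn orbT.
Qed.

Lemma npg_step l w :
  batch_step B (gamma p) (Au piF theta) (bu M piF phi theta xi) l w =
  w - gamma p *: batch_mean (npg_dir (usubmx xi 0 0) (dsubmx xi) w) B l.
Proof.
rewrite /batch_step; congr (_ - _ *: (_ *: _)); apply: eq_bigr => -[[s a] s'] _ /=.
by rewrite mulmx_dotp -scalerBl.
Qed.

Lemma npg_run_last l1 l2 w h : size l1 = (h * B)%N -> size l2 = B ->
  npg_run (l1 ++ l2) w h.+1 =
  npg_run l1 w h - gamma p *:
    batch_mean (npg_dir (usubmx xi 0 0) (dsubmx xi) (npg_run l1 w h)) B l2.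
Proof.
move=> h1 h2; rewrite -npg_step /= -[X in batch _ _ X]addn0 (batch_catr _ _ h1) batch_full//.
by rewrite npg_run_prefix// h1.
Qed.

End NpgBatches.

(** * The NPG phase for a fixed critic outcome *)

Section NpgPhase.
Variables (R : realType) (S A : finType) (M : mdp R S A) (m d : nat).
Notation tr := (transition S A).
Variables (piF : 'cV[R]_d -> S -> A -> R) (theta : 'cV[R]_d) (Cb : R).
Let pi := piF theta.
Local Notation dd := (pol_stat M pi).
Hypothesis mix : mixing M pi dd Cb.
Let piP := let: And4 h _ _ _ := mix in h.
Let d_dist := let: And4 _ _ h _ := mix in proj1 h.
Local Notation E := (stat_mean M pi dd).
Variables (phi : S -> 'cV[R]_m) (p : nac_steps R) (B : nat) (xi : 'cV[R]_(1 + m)).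
Let sc := score piF theta.
Variables (g mu : R).
Hypotheses (phi1 : forall s, enorm (phi s) <= 1) (g1 : 1 <= g) (mu0 : 0 < mu).
Hypothesis sc_le : forall s a, enorm (sc s a) <= g.
Let F := fisher M piF theta.
Hypothesis coerF : forall v : 'cV[R]_d, mu * enorm v ^+ 2 <= dotp v (F *m v).
Hypothesis B0 : (0 < B)%N.

Lemma fisherE u v : dotp u (F *m v) =
  E (fun z => dotp u (sc z.1.1 z.1.2) * dotp (sc z.1.1 z.1.2) v).
Proof.
rewrite /F /fisher /esa mulmx_suml dotp_sumr; apply: eq_bigr => s _.
rewrite mulmx_suml dotp_sumr /step_mean mulr_sumr; apply: eq_bigr => a _.
rewrite -scalemxAl dotpZr mulmx_dotp dotpZr (mulrC (dotp _ v)) /occ -mulrA; congr (_ * _).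
rewrite /= -mulr_suml -mulr_sumr kernel_sum1 mulr1//.
Qed.

Lemma fisher_sym u v : dotp u (F *m v) = dotp (F *m u) v.
Proof.
rewrite (dotpC (F *m u)) !fisherE; congr stat_mean; apply: funext => z.
by rewrite mulrC (dotpC v) (dotpC u).
Qed.

Lemma fisher_unit : F \in unitmx.
Proof.
apply: unitmx_inj => v Fv; apply: dotp_eq0; rewrite -enorm_sqr.
have := coerF v; rewrite Fv dotp0r => h.
apply/eqP; rewrite eq_le sqr_ge0 andbT -(ler_pM2l mu0) mulr0//.
Qed.

Lemma enorm_fisher v : enorm (F *m v) <= g ^+ 2 * enorm v.
Proof.
have g0 : 0 <= g by exact: le_trans g1.
apply: enorm_dual => [|u]; first by rewrite mulr_ge0 ?sqr_ge0 ?enorm_ge0.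
rewrite fisherE; apply: le_trans (ler_norm _) _.
apply: (stat_mean_norm M piP d_dist) => z; rewrite normrM.
have -> : g ^+ 2 * enorm v * enorm u = (g * enorm u) * (g * enorm v) by ring.
apply: ler_pM => //; apply: le_trans (dotp_norm_le _ _) _.
  by rewrite mulrC ler_wpM2r ?enorm_ge0.
by rewrite ler_wpM2r ?enorm_ge0.
Qed.

Lemma enorm_fisher_inv v : enorm (invmx F *m v) <= enorm v / mu.
Proof.
set w := invmx F *m v.
have Fw : F *m w = v by rewrite /w mulmxA mulmxV ?fisher_unit// mul1mx.
have := coerF w; rewrite Fw => h.
have [->|w0] := eqVneq (enorm w) 0; first by rewrite divr_ge0 ?enorm_ge0// ltW.
have wp : 0 < enorm w by rewrite lt_neqAle eq_sym w0 enorm_ge0.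
rewrite ler_pdivlMr// -(ler_pM2r wp); have := dotp_le_enorm w v; move: h; rewrite expr2; lra.
Qed.

Definition td_mean (eta : R) (zeta : 'cV[R]_m) : 'cV[R]_d :=
  vmean M pi dd (fun z => td_error M phi eta zeta z *: sc z.1.1 z.1.2).

(** The fixed point of the mean NPG iteration for the given critic output. *)
Definition npg_target (eta : R) (zeta : 'cV[R]_m) : 'cV[R]_d :=
  invmx F *m td_mean eta zeta.

Let eta := usubmx xi 0 0.
Let zeta := dsubmx xi.
(** Bounds the TD error for the given critic output. It is random from the viewpoint of the epoch,
    so every estimate keeps its dependence on [n] explicit. *)
Let n := 1 + `|eta| + 2 * enorm zeta.

Lemma npg_n_ge1 : 1 <= n.
Proof. by rewrite /n -addrA lerDl addr_ge0 ?mulr_ge0 ?enorm_ge0. Qed.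

Lemma td_error_le z : `|td_error M phi eta zeta z| <= n.
Proof.
have /andP[r0 r1] := reward_ge0_le1 M z.1.1 z.1.2.
apply: le_trans (ler_normD _ _) _; rewrite /n lerD//.
  by apply: le_trans (ler_normB _ _) _; rewrite lerD// ger0_norm.
apply: le_trans (dotp_norm_le _ _) _; rewrite mulrC ler_wpM2r ?enorm_ge0//.
by apply: le_trans (enormB _ _) _; rewrite -[2]/(1 + 1) lerD.
Qed.

Lemma td_term_le z : enorm (td_error M phi eta zeta z *: sc z.1.1 z.1.2) <= g * n.
Proof. by rewrite enormZ mulrC ler_pM ?enorm_ge0// td_error_le. Qed.

Lemma enorm_td_mean : enorm (td_mean eta zeta) <= g * n.
Proof.
apply: (enorm_vmean mix) => [|z]; last exact: td_term_le.
by rewrite mulr_ge0// (le_trans _ g1, le_trans _ npg_n_ge1).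
Qed.

Lemma enorm_npg_target : enorm (npg_target eta zeta) <= g * n / mu.
Proof.
apply: le_trans (enorm_fisher_inv _) _; rewrite ler_wpM2r ?invr_ge0 ?(ltW mu0)//.
exact: enorm_td_mean.
Qed.

Hypotheses (gm0 : 0 < gamma p) (gm1 : gamma p <= 1) (gm2 : gamma p * g ^+ 4 <= mu).
Hypothesis gm3 : gamma p * mu <= 1.
Let a := gamma p * mu.
Let kap := batch_err Cb B.
(** The direction at the target has size at most [gg * n]: [g * n] from the TD term and [g ^ 2]
    times the bound [g * n / mu] on the target. *)
Let gg := g + g ^+ 3 / mu.
Let cn : R := 2 * (d%:R + 2) * gg ^+ 2.
Hypothesis kap_small : kap * (2 * (d%:R + 2) * (1 + g ^+ 2) ^+ 2) <= a / 2.
Hypothesis kap1 : kap <= 1.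

(** [gamma p * g ^ 4 <= mu] makes the quadratic term at most half of the gain [2 * gamma p * mu]. *)
Lemma contract_F v : enorm (v - gamma p *: (F *m v)) ^+ 2 <= (1 - a) * enorm v ^+ 2.
Proof.
have h2 : enorm (F *m v) ^+ 2 <= (g ^+ 2 * enorm v) ^+ 2.
  have p0 : 0 <= g ^+ 2 * enorm v by apply: mulr_ge0; [exact: sqr_ge0|exact: enorm_ge0].
  by rewrite ler_pXn2r ?nnegrE ?enorm_ge0// enorm_fisher.
rewrite enorm_sqr !(dotpBl, dotpBr, dotpZl, dotpZr) -(fisher_sym v v) -!enorm_sqr.
have := coerF v; move: h2.
rewrite exprMn -exprM; move: (enorm (F *m v) ^+ 2) (dotp _ _) => c w h2 h3.
have k1 : gamma p * (mu * enorm v ^+ 2) <= gamma p * w by rewrite ler_wpM2l// ltW.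
have k2 : gamma p * (gamma p * c) <= gamma p * (gamma p * (g ^+ (2 * 2) * enorm v ^+ 2)).
  by rewrite !ler_wpM2l// ltW.
have k3 : gamma p * (gamma p * g ^+ 4) * enorm v ^+ 2 <= gamma p * mu * enorm v ^+ 2.
  by rewrite ler_wpM2r ?sqr_ge0// ler_wpM2l// ltW.
rewrite /a; lra.
Qed.

Lemma npg_a_gt0 : 0 < a. Proof. by rewrite mulr_gt0. Qed.

Lemma contract_F_norm u : enorm (u - gamma p *: (F *m u)) <= (1 - a / 2) * enorm u.
Proof.
have a0 := npg_a_gt0.
apply: enorm_le; first by rewrite mulr_ge0 ?enorm_ge0//; move: gm3; rewrite -/a; lra.
rewrite -enorm_sqr; apply: le_trans (contract_F u) _.
rewrite exprMn ler_wpM2r ?sqr_ge0// sqrrB expr1n.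
by have := sqr_ge0 (a / 2); lra.
Qed.

Section Step.
Variables (w : 'cV[R]_d) (s : S).
Let x := w - npg_target eta zeta.
Let b := g ^+ 2 * enorm x + gg * n.
Let e := npg_dir M piF theta phi eta zeta w.

Lemma npg_b_ge0 : 0 <= b.
Proof.
have g0 : 0 <= g by exact: le_trans g1.
have n0 : 0 <= n by exact: le_trans npg_n_ge1.
rewrite /b addr_ge0 ?mulr_ge0 ?sqr_ge0 ?enorm_ge0// /gg addr_ge0 ?divr_ge0 ?exprn_ge0//.
exact: ltW.
Qed.

Lemma npg_dir_le z : enorm (e z) <= b.
Proof.
have g0 : 0 <= g by exact: le_trans g1.
rewrite /e /npg_dir -/sc scalerBl; apply: le_trans (enormB _ _) _.
have h1 : enorm (dotp (sc z.1.1 z.1.2) w *: sc z.1.1 z.1.2) <= g ^+ 2 * enorm w.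
  rewrite enormZ expr2 -mulrA [g * enorm w]mulrC mulrA.
  apply: ler_pM => //; first exact: enorm_ge0.
  by apply: le_trans (dotp_norm_le _ _) _; rewrite ler_wpM2r ?enorm_ge0.
have h2 : enorm w <= enorm x + g * n / mu.
  rewrite (_ : w = x + npg_target eta zeta); last by rewrite /x subrK.
  by apply: le_trans (enormD _ _) _; rewrite lerD2l enorm_npg_target.
have h3 : g ^+ 2 * enorm w <= g ^+ 2 * (enorm x + g * n / mu) by rewrite ler_wpM2l ?sqr_ge0.
have h4 := td_term_le z.
have -> : b = g ^+ 2 * (enorm x + g * n / mu) + g * n by rewrite /b /gg; field; rewrite gt_eqF.
lra.
Qed.

Lemma npg_dir_mean u : dotp u (F *m x) = E (fun z => dotp u (e z)).
Proof.
have -> : F *m x = F *m w - td_mean eta zeta.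
  by rewrite /x mulmxBr /npg_target mulmxA mulmxV ?fisher_unit// mul1mx.
rewrite dotpBr fisherE /td_mean (dotp_vmean mix) -stat_meanB; congr stat_mean.
by apply: funext => z; rewrite /e /npg_dir !dotpZr -/sc; ring.
Qed.

Lemma npg_step_sqr :
  rollout M pi B s (fun l => enorm (w - gamma p *: batch_mean e B l - npg_target eta zeta) ^+ 2)
  <= (1 - a / 2) * enorm x ^+ 2 + kap * (cn * n ^+ 2).
Proof.
have g0 : 0 <= g by exact: le_trans g1.
have n1 := npg_n_ge1; have a0 := npg_a_gt0; have b0 := npg_b_ge0.
have kp : 0 <= kap by exact: batch_err_ge0.
have := @sa_step_sqr _ _ _ _ _ _ _ mix B B0 d e (F *m x) b (gamma p) x b0 (ltW gm0)
  npg_dir_le npg_dir_mean 1%:M s (trmx1 _ _) (mulmx1 _).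
rewrite mul1mx => h.
apply: (@le_trans _ _ ((1 - a) * enorm x ^+ 2 + (a / 2 * enorm x ^+ 2 + kap * (cn * n ^+ 2)))); last by lra.
(* The part of the noise proportional to [enorm x ^ 2] is absorbed by half of the contraction,
   thanks to [kap_small]; only the part with [n ^ 2] remains. *)
have noise : kap * (2 * gamma p * enorm (x - gamma p *: (F *m x)) * b +
    gamma p ^+ 2 * d%:R * b ^+ 2) <= a / 2 * enorm x ^+ 2 + kap * (cn * n ^+ 2).
  have x0 := enorm_ge0 x.
  have v0 : enorm (x - gamma p *: (F *m x)) <= enorm x + b.
    apply: le_trans (contract_F_norm x) _.
    have : 0 <= a / 2 * enorm x by apply: mulr_ge0 => //; lra.
    lra.
  have c0 : 0 <= enorm x + b by lra.
  have p1 : enorm (x - gamma p *: (F *m x)) * b <= (enorm x + b) ^+ 2.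
    by rewrite expr2; apply: ler_pM => //; [exact: enorm_ge0|lra].
  have p2 : gamma p * (enorm (x - gamma p *: (F *m x)) * b) <= (enorm x + b) ^+ 2.
    by rewrite -[leRHS]mul1r; apply: ler_pM => //; [exact: ltW|rewrite mulr_ge0 ?enorm_ge0].
  have p3 : b ^+ 2 <= (enorm x + b) ^+ 2 by rewrite ler_pXn2r ?nnegrE//; lra.
  have p4 : gamma p ^+ 2 * (d%:R * b ^+ 2) <= d%:R * (enorm x + b) ^+ 2.
    rewrite -[leRHS]mul1r; apply: ler_pM.
    - exact: sqr_ge0.
    - by apply: mulr_ge0 => //; exact: sqr_ge0.
    - by rewrite expr_le1// ltW.
    - by rewrite ler_wpM2l.
  have p5 : (enorm x + b) ^+ 2 <= 2 * ((1 + g ^+ 2) ^+ 2 * enorm x ^+ 2 + gg ^+ 2 * n ^+ 2).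
    have -> : enorm x + b = (1 + g ^+ 2) * enorm x + gg * n by rewrite /b; ring.
    have := sqr_ge0 ((1 + g ^+ 2) * enorm x - gg * n).
    by rewrite -!exprMn sqrrB sqrrD; lra.
  have p6 : (d%:R + 2) * (enorm x + b) ^+ 2 <=
      (d%:R + 2) * (2 * ((1 + g ^+ 2) ^+ 2 * enorm x ^+ 2 + gg ^+ 2 * n ^+ 2)).
    by rewrite ler_wpM2l ?addr_ge0.
  have p7 := ler_wpM2r (sqr_ge0 (enorm x)) kap_small.
  apply: (@le_trans _ _ (kap * ((d%:R + 2) * (2 * ((1 + g ^+ 2) ^+ 2 * enorm x ^+ 2 + gg ^+ 2 * n ^+ 2))))).
    by rewrite ler_wpM2l//; lra.
  by rewrite /cn; lra.
apply: le_trans (le_trans h (lerD (contract_F x) noise)).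
apply: (rollout_le piP) => l _ _; rewrite mul1mx.
by rewrite addrAC.
Qed.

Lemma npg_step_bias u :
  `|rollout M pi B s (fun l => dotp u (w - gamma p *: batch_mean e B l - npg_target eta zeta)) -
    dotp (u - gamma p *: (F *m u)) x| <= kap * (enorm u * b).
Proof.
have b0 := npg_b_ge0; have kp : 0 <= kap by exact: batch_err_ge0.
have := @sa_step_mean _ _ _ _ _ _ _ mix B B0 d e (F *m x) b (gamma p) x b0 (ltW gm0)
  npg_dir_le npg_dir_mean s u.
rewrite (_ : (fun l => dotp u (x - gamma p *: batch_mean e B l)) = (fun l => dotp u (w - gamma p *: batch_mean e B l - npg_target eta zeta))); last first.
  by apply: funext => l; rewrite addrAC.
have -> : dotp u (x - gamma p *: (F *m x)) = dotp (u - gamma p *: (F *m u)) x.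
  by rewrite (dotpBr x) dotpZr (dotpBl u) dotpZl fisher_sym.
move=> h; apply: le_trans h _.
by rewrite ler_wpM2l// ler_wpM2r// ler_piMl ?enorm_ge0.
Qed.
End Step.

Variables (R0 : R) (w0 : 'cV[R]_d) (H : nat).
Hypotheses (R00 : 0 <= R0) (w0_le : enorm w0 <= R0).
Let q := 1 - a / 2.
Let z0 := 2 * R0 ^+ 2 + 2 * (g / mu) ^+ 2.
Let kZ := z0 + 2 / a * cn.
Let eb := g ^+ 2 * (1 + kZ) + gg.
Let w_ h l := npg_run M piF theta phi p B xi l w0 h.
Let x_ h l := w_ h l - npg_target eta zeta.
Let Ro s h Fn := rollout M pi (h * B) s Fn.

Lemma npg_rollout_step s h (G : 'cV[R]_d -> R) :
  Ro s h.+1 (fun l => G (x_ h.+1 l)) =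
  Ro s h (fun l => rollout M pi B (end_state s l) (fun l' =>
    G (w_ h l - gamma p *: batch_mean (npg_dir M piF theta phi eta zeta (w_ h l)) B l' - npg_target eta zeta))).
Proof.
rewrite /Ro mulSnr rollout_cat; apply: (eq_rollout piP) => l hl _.
apply: (eq_rollout piP) => l' hl' _.
by rewrite /x_ /w_ npg_run_last.
Qed.

Lemma npg_q : 0 <= q < 1.
Proof. by have := npg_a_gt0; move: gm3; rewrite -/a /q => ? ?; apply/andP; split; lra. Qed.

Lemma npg_x0 : enorm (x_ 0 [::]) ^+ 2 <= z0 * n ^+ 2.
Proof.
have g0 : 0 <= g by exact: le_trans g1.
have n1 := npg_n_ge1; have n2 : 1 <= n ^+ 2 by rewrite exprn_ege1.
rewrite /x_ /w_ /=; apply: le_trans (sqr_enormD _ _) _; rewrite enormN.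
have -> : z0 * n ^+ 2 = 2 * R0 ^+ 2 * n ^+ 2 + 2 * ((g / mu) ^+ 2 * n ^+ 2) by rewrite /z0; ring.
apply: lerD.
  apply: (@le_trans _ _ (2 * R0 ^+ 2 * 1)); last by rewrite ler_wpM2l// mulr_ge0 ?sqr_ge0.
  by rewrite mulr1 ler_wpM2l// ler_pXn2r ?nnegrE ?enorm_ge0.
have pn : 0 <= g / mu * n.
  by apply: mulr_ge0; [apply: divr_ge0 => //; exact: ltW|exact: le_trans n1].
rewrite -exprMn ler_wpM2l// ler_pXn2r ?nnegrE ?enorm_ge0//.
by apply: le_trans enorm_npg_target _; rewrite mulrAC.
Qed.

Lemma npg_cn_ge0 : 0 <= cn.
Proof. by rewrite /cn mulr_ge0 ?sqr_ge0// mulr_ge0// addr_ge0. Qed.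

Lemma npg_Z_le s h : Ro s h (fun l => enorm (x_ h l) ^+ 2) <=
  n ^+ 2 * (z0 * q ^+ h + 2 / a * cn * kap).
Proof.
have /andP[q0 q1] := npg_q; have a0 := npg_a_gt0; have kp : 0 <= kap by exact: batch_err_ge0.
have c0 := npg_cn_ge0.
have e0 : 0 <= kap * (cn * n ^+ 2) by apply: mulr_ge0 => //; apply: mulr_ge0 => //; exact: sqr_ge0.
have rec j : (j < h)%N -> Ro s j.+1 (fun l => enorm (x_ j.+1 l) ^+ 2) <=
    q * Ro s j (fun l => enorm (x_ j l) ^+ 2) + kap * (cn * n ^+ 2).
  move=> _; rewrite (npg_rollout_step s j (fun x => enorm x ^+ 2)).
  apply: (@le_trans _ _ (Ro s j (fun l => q * enorm (x_ j l) ^+ 2 + kap * (cn * n ^+ 2)))).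
    by apply: (rollout_le piP) => l _ _; exact: npg_step_sqr.
  by rewrite /Ro rolloutD rollout_cst// rolloutZ//.
have := affine_rec_le (u := fun h => Ro s h (fun l => enorm (x_ h l) ^+ 2)) q0 q1 e0 rec (leqnn _).
move=> h1; apply: le_trans h1 _; rewrite {1}/Ro mul0n /=.
have -> : 1 - q = a / 2 by rewrite /q; ring.
rewrite invf_div; have := ler_wpM2l (exprn_ge0 h q0) npg_x0; lra.
Qed.

Lemma npg_Z_bound s h : Ro s h (fun l => enorm (x_ h l) ^+ 2) <= kZ * n ^+ 2.
Proof.
have /andP[q0 q1] := npg_q; have a0 := npg_a_gt0.
apply: le_trans (npg_Z_le s h) _; rewrite mulrC; apply: ler_wpM2r; first exact: sqr_ge0.
have z00 : 0 <= z0 by have := sqr_ge0 R0; have := sqr_ge0 (g / mu); rewrite /z0; lra.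
have ia : 0 <= 2 / a by rewrite divr_ge0// ltW.
have c0 := npg_cn_ge0; rewrite /kZ; apply: lerD.
  by apply: ler_piMr => //; apply: exprn_ile1 => //; exact: ltW.
by apply: ler_piMr => //; exact: mulr_ge0.
Qed.

(** Again by induction for all test vectors, with the step moved onto [u] by the symmetry of [F].
    The batch bias is linear in [enorm x] and is paid by the second moment through
    [2 t <= 1 + t ^ 2]. *)
Lemma npg_bias_le s h u : `|Ro s h (fun l => dotp u (x_ h l))| <=
  enorm u * (n ^+ 2 * ((1 + z0) * q ^+ h + 2 / a * eb * kap)).
Proof.
have /andP[q0 q1] := npg_q; have a0 := npg_a_gt0; have kp : 0 <= kap by exact: batch_err_ge0.
have g0 : 0 <= g by exact: le_trans g1.
have n1 := npg_n_ge1; have n2 : 1 <= n ^+ 2 by rewrite exprn_ege1.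
have nn : n <= n ^+ 2 by rewrite expr2 ler_peMr//; lra.
have gg0 : 0 <= gg by rewrite /gg addr_ge0 ?divr_ge0 ?exprn_ge0// ltW.
have z00 : 0 <= z0 by have := sqr_ge0 R0; have := sqr_ge0 (g / mu); rewrite /z0; lra.
have ia : 0 <= 2 / a by rewrite divr_ge0// ltW.
have kZ0 : 0 <= kZ by rewrite /kZ; apply: addr_ge0 => //; apply: mulr_ge0 => //; exact: npg_cn_ge0.
have eb0 : 0 <= eb by rewrite /eb; apply: addr_ge0 => //; apply: mulr_ge0; [exact: sqr_ge0|lra].
elim: h u => [|h IH] u.
  rewrite /Ro mul0n /= expr0 mulr1; apply: le_trans (dotp_norm_le _ _) _.
  rewrite ler_wpM2l ?enorm_ge0//.
  have := npg_x0; have := twice_le_sqr (enorm (x_ 0 [::])); have := enorm_ge0 (x_ 0 [::]).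
  have : 0 <= n ^+ 2 * (2 / a * eb * kap).
    by apply: mulr_ge0; [exact: sqr_ge0|apply: mulr_ge0 => //; exact: mulr_ge0].
  lra.
rewrite (npg_rollout_step s h (fun x => dotp u x)).
set F1 := (X in `|Ro s h X| <= _).
pose u' := u - gamma p *: (F *m u).
have nu' : enorm u' <= q * enorm u by exact: contract_F_norm.
pose G1 l := dotp u' (x_ h l).
have dev : `|Ro s h (fun l => F1 l - G1 l)| <= kap * (enorm u * (eb * n ^+ 2)).
  apply: le_trans (ler_norm_rollout M piP _ _ _) _.
  apply: (@le_trans _ _ (Ro s h (fun l => kap * enorm u *
      ((g ^+ 2 + gg * n) + g ^+ 2 * enorm (x_ h l) ^+ 2)))).
    apply: (rollout_le piP) => l _ _.
    have h1 := npg_step_bias (w_ h l) (end_state s l) u; apply: le_trans h1 _.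
    have ku : 0 <= kap * enorm u by apply: mulr_ge0 => //; exact: enorm_ge0.
    rewrite mulrA ler_wpM2l// -/(x_ h l).
    have := twice_le_sqr (enorm (x_ h l)); have := enorm_ge0 (x_ h l) => e1 e2.
    have : g ^+ 2 * enorm (x_ h l) <= g ^+ 2 * (1 + enorm (x_ h l) ^+ 2).
      by rewrite ler_wpM2l ?sqr_ge0//; lra.
    lra.
  rewrite /Ro !(rolloutD, rolloutZ, rollout_cst)// -/(Ro s h _) -mulrA ler_wpM2l//.
  rewrite ler_wpM2l ?enorm_ge0//.
  have := ler_wpM2l (sqr_ge0 g) (npg_Z_bound s h).
  have := ler_wpM2l gg0 nn; have := ler_wpM2l (sqr_ge0 g) n2; rewrite /eb; lra.
have -> : Ro s h F1 = Ro s h G1 + Ro s h (fun l => F1 l - G1 l) by rewrite /Ro rolloutB; ring.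
apply: le_trans (ler_normD _ _) _.
have t1 : `|Ro s h G1| <= q * enorm u * (n ^+ 2 * ((1 + z0) * q ^+ h + 2 / a * eb * kap)).
  apply: le_trans (IH u') _; rewrite ler_wpM2r//.
  apply: mulr_ge0; first exact: sqr_ge0.
  apply: addr_ge0; apply: mulr_ge0 => //; [lra|exact: exprn_ge0|exact: mulr_ge0].
have -> : enorm u * (n ^+ 2 * ((1 + z0) * q ^+ h.+1 + 2 / a * eb * kap)) =
  q * enorm u * (n ^+ 2 * ((1 + z0) * q ^+ h + 2 / a * eb * kap)) + kap * (enorm u * (eb * n ^+ 2)).
  have ea : 2 / a * (1 - q) = 1 by rewrite /q; field; rewrite gt_eqF.
  rewrite (exprS q h); move: ea; move: (q ^+ h) (2 / a) q eb kap (enorm u) n z0 => qh ia' q' eb' kap' u1 n' z' ea.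
  have -> : kap' * (u1 * (eb' * n' ^+ 2)) = kap' * (u1 * (eb' * n' ^+ 2)) * (ia' * (1 - q')) by rewrite ea mulr1.
  by ring.
by rewrite lerD.
Qed.

End NpgPhase.

(** * From critic and approximation errors to the NPG target *)

Section Bias.
Variables (R : realType) (S A : finType) (M : mdp R S A) (m d : nat).
Notation tr := (transition S A).
Variables (piF : 'cV[R]_d -> S -> A -> R) (theta : 'cV[R]_d) (Cb : R).
Let pi := piF theta.
Local Notation dd := (pol_stat M pi).
Hypothesis mix : mixing M pi dd Cb.
Let piP := let: And4 h _ _ _ := mix in h.
Let d_dist := let: And4 _ _ h _ := mix in proj1 h.
Local Notation E := (stat_mean M pi dd).
Local Notation J := (mean_reward M pi dd).
Variables (phi : S -> 'cV[R]_m).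
Let sc := score piF theta.
Variables (g mu lambda : R).
Hypotheses (phi1 : forall s, enorm (phi s) <= 1) (g1 : 1 <= g) (mu0 : 0 < mu).
Hypotheses (lambda0 : 0 < lambda).
Hypothesis sc_le : forall s a, enorm (sc s a) <= g.
Let F := fisher M piF theta.
Let C := critic_mx M pi phi.
Hypothesis coerF : forall v : 'cV[R]_d, mu * enorm v ^+ 2 <= dotp v (F *m v).
Variables (Q : 'M[R]_m) (zs : 'cV[R]_m).
Hypotheses (QT : Q^T = Q) (QQ : Q *m Q = Q).
Hypothesis coer : forall x : 'cV[R]_m, lambda * enorm (Q *m x) ^+ 2 <= dotp (Q *m x) (C *m x).
Hypothesis kerQ : forall v : 'cV[R]_m, C *m (v - Q *m v) = 0.
Hypothesis Czs : C *m zs = critic_rhs M pi phi.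
Hypothesis sc0 : forall u, E (fun z => dotp u (sc z.1.1 z.1.2)) = 0.

(* Adjoint of zeta |-> E[zeta . (phi(s') - phi(s)) score(s, a)].  It lies in the range
   of Q, so only the projected critic error enters the NPG target. *)
Definition td_dual (u : 'cV[R]_d) : 'cV[R]_m :=
  vmean M pi dd (fun z => dotp u (sc z.1.1 z.1.2) *: (phi z.2 - phi z.1.1)).

Lemma td_dualE u x : dotp (td_dual u) x =
  E (fun z => dotp x (phi z.2 - phi z.1.1) * dotp u (sc z.1.1 z.1.2)).
Proof.
rewrite dotpC (dotp_vmean mix); congr stat_mean; apply: funext => z.
by rewrite dotpZr mulrC.
Qed.

(** A kernel vector of [C] gives features that do not change along transitions, so it is orthogonal
    to [td_dual u]. *)
Lemma td_dual_proj u : Q *m td_dual u = td_dual u.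
Proof.
apply: dotp_inj => y; rewrite dotp_mulmx QT; apply/eqP; rewrite -subr_eq0 -dotpBl.
have -> : Q *m y - y = - (y - Q *m y) by rewrite opprB.
rewrite dotpNl oppr_eq0 dotpC td_dualE.
rewrite (_ : (fun z => _) = fun z => dotp u (sc z.1.1 z.1.2) *
  dotp (phi z.2 - phi z.1.1) (y - Q *m y)); last first.
  by apply: funext => z; rewrite mulrC (dotpC (y - _)).
by apply/eqP; apply: (critic_ker_flat mix).
Qed.

Lemma enorm_td_dual u : enorm (td_dual u) <= 2 * g * enorm u.
Proof.
have g0 : 0 <= g by exact: le_trans g1.
apply: (enorm_vmean mix) => [|z]; first by rewrite !mulr_ge0 ?enorm_ge0.
rewrite enormZ (_ : 2 * g * enorm u = enorm u * g * 2); last by ring.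
apply: ler_pM => //; first exact: enorm_ge0.
  by apply: le_trans (dotp_norm_le _ _) _; rewrite ler_wpM2l ?enorm_ge0.
by apply: le_trans (enormB _ _) _; rewrite -[2]/(1 + 1) lerD.
Qed.

(** [eta] drops out since the score has mean zero. The dependence on [zeta] is linear, so a bias of
    the critic passes to a bias of the target. *)
Lemma npg_target_dev u eta zeta :
  dotp u (npg_target M piF theta phi eta zeta - npg_target M piF theta phi J zs) =
  dotp (td_dual (invmx F *m u)) (zeta - zs).
Proof.
have FT : F^T = F.
  apply/matrixP => i j; rewrite mxE.
  have := fisher_sym M piF theta (delta_mx j 0) (delta_mx i 0).
  rewrite -/F (dotpC (F *m _)) !dotp_delta -!colE !mxE => ->//.
rewrite /npg_target -mulmxBr dotp_mulmx trmx_inv FT [LHS]dotpBr /td_mean !(dotp_vmean mix).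
rewrite -stat_meanB td_dualE.
set w := invmx F *m u.
rewrite -[RHS]addr0 -(mulr0 (J - eta)) -(sc0 w) -stat_meanZ -stat_meanD.
congr stat_mean; apply: funext => z.
by rewrite !dotpZr /td_error !dotpBl; ring.
Qed.

Lemma npg_target_dev_le eta zeta :
  enorm (npg_target M piF theta phi eta zeta - npg_target M piF theta phi J zs) <=
  2 * g / mu * enorm (Q *m (zeta - zs)).
Proof.
have g0 : 0 <= g by exact: le_trans g1.
have c0 : 0 <= 2 * g / mu by rewrite !mulr_ge0// invr_ge0 ltW.
apply: enorm_dual => [|u]; first by rewrite mulr_ge0 ?enorm_ge0.
rewrite npg_target_dev -td_dual_proj -{1}QT -dotp_mulmx.
apply: le_trans (dotp_le_enorm _ _) _.
rewrite mulrAC; apply: ler_wpM2r; first exact: enorm_ge0.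
apply: le_trans (enorm_td_dual _) _.
have := enorm_fisher_inv mu0 coerF u; rewrite -/F => h.
have g20 : 0 <= 2 * g by rewrite mulr_ge0.
have := ler_wpM2l g20 h; lra.
Qed.

Variables (V : S -> R).
Hypothesis bellman : forall s,
  V s = step_mean M pi s (fun z => reward M z.1.1 z.1.2 - J + V z.2).
Variable (gJ : 'cV[R]_d).
Hypothesis gJE : forall u, dotp u gJ =
  E (fun z => (reward M z.1.1 z.1.2 - J + (V z.2 - V z.1.1)) * dotp u (sc z.1.1 z.1.2)).

Definition value_loss (zeta : 'cV[R]_m) : R :=
  2^-1 * \sum_s dd s * (V s - dotp zeta (phi s)) ^+ 2.

Lemma bellman_test (h : S -> R) :
  E (fun z => (reward M z.1.1 z.1.2 - J) * h z.1.1) = E (fun z => (V z.1.1 - V z.2) * h z.1.1).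
Proof.
apply: eq_bigr => s _; congr (_ * _); apply/eqP; rewrite -subr_eq0.
rewrite -[X in _ + X == _]mulN1r -step_meanZ -step_meanD.
have -> : step_mean M pi s (fun z => (reward M z.1.1 z.1.2 - J) * h z.1.1 +
    -1 * ((V z.1.1 - V z.2) * h z.1.1)) =
    h s * step_mean M pi s (fun z => reward M z.1.1 z.1.2 - J + V z.2) + - (h s * V s).
  rewrite -step_meanZ -[X in _ + X](step_mean_cst M piP s) -step_meanD.
  by apply: eq_step_mean => a s' /=; ring.
by rewrite -bellman subrr.
Qed.

Lemma value_loss_ge0 zeta : 0 <= value_loss zeta.
Proof.
rewrite mulr_ge0 ?invr_ge0// sumr_ge0// => s _; rewrite mulr_ge0 ?sqr_ge0//.
by case: d_dist.
Qed.

(** Cauchy-Schwarz; by stationarity both residuals have second moment [2 * value_loss zeta], and the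
    square of their difference costs a further factor 4. *)
Lemma residual_diff zeta (h : S -> R) (k : tr -> R) (b : R) : 0 <= b ->
  (forall z, `|k z| <= b) ->
  (forall s, h s = dotp zeta (phi s) - V s) ->
  E (fun z => k z * (h z.2 - h z.1.1)) <= b * Num.sqrt (8 * value_loss zeta).
Proof.
move=> b0 kb hE.
have vl := value_loss_ge0 zeta.
apply: le_trans (ler_norm _) _.
rewrite -(ler_pXn2r (n:=2))// ?nnegrE ?mulr_ge0 ?sqrtr_ge0// real_normK ?num_real//.
have vl8 : 0 <= 8 * value_loss zeta by rewrite mulr_ge0.
apply: le_trans (stat_mean_CS mix _ _) _; rewrite exprMn sqr_sqrtr//.
have h2 : E (fun z => h z.1.1 ^+ 2) = 2 * value_loss zeta.
  rewrite (stat_mean_first mix (fun s => h s ^+ 2)) /value_loss mulrA divff ?mul1r//.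
  by apply: eq_bigr => s _; rewrite hE -sqrrN opprB.
have h3 : E (fun z => h z.2 ^+ 2) = 2 * value_loss zeta.
  by rewrite (stat_mean_next mix (fun s => h s ^+ 2)).
apply: ler_pM.
- by apply: (stat_mean_ge0 mix) => z; exact: sqr_ge0.
- by apply: (stat_mean_ge0 mix) => z; exact: sqr_ge0.
- rewrite -(stat_mean_cst M piP d_dist (b ^+ 2)); apply: (stat_mean_le M piP d_dist) => z.
  by rewrite -real_normK ?num_real// ler_pXn2r ?nnegrE.
- have -> : 8 * value_loss zeta = 2 * (2 * value_loss zeta) + 2 * (2 * value_loss zeta) by ring.
  rewrite -{1}h3 -h2 -!stat_meanZ -stat_meanD; apply: (stat_mean_le M piP d_dist) => z.
  by have := sqr_ge0 (h z.2 + h z.1.1); rewrite sqrrB sqrrD; lra.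
Qed.

(** By the Bellman equation, [C (zs - zeta)] tests the one-step increments of the residual
    [dotp zeta (phi s) - V s], so its norm is controlled by the loss; coercivity inverts [C] on the
    range of [Q]. *)
Lemma critic_target_bias zeta :
  enorm (Q *m (zs - zeta)) <= lambda^-1 * Num.sqrt (8 * value_loss zeta).
Proof.
set w := Num.sqrt _; have w0 : 0 <= w by exact: sqrtr_ge0.
have Cx : enorm (C *m (zs - zeta)) <= w.
  apply: enorm_dual => // u; rewrite mulmxBr Czs dotpBr (critic_mxE M pi) /critic_rhs (dotp_vmean mix).
  rewrite (_ : (fun z => dotp u (_ *: phi z.1.1)) =
     fun z => (reward M z.1.1 z.1.2 - J) * dotp u (phi z.1.1)); last first.
    by apply: funext => z; rewrite dotpZr.
  rewrite (bellman_test (fun s => dotp u (phi s))) -stat_meanB mulrC.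
  pose h s := dotp zeta (phi s) - V s.
  rewrite (_ : (fun z => _) = fun z => dotp u (phi z.1.1) * (h z.2 - h z.1.1)); last first.
    by apply: funext => z; rewrite /h dotpBl !(dotpC zeta); ring.
  apply: residual_diff => //; first exact: enorm_ge0.
  by move=> z; apply: le_trans (dotp_norm_le _ _) _; rewrite ler_piMr ?enorm_ge0.
have := coer (zs - zeta) => h.
have [->|q0] := eqVneq (enorm (Q *m (zs - zeta))) 0; first by rewrite mulr_ge0// invr_ge0 ltW.
have qp : 0 < enorm (Q *m (zs - zeta)) by rewrite lt_neqAle eq_sym q0 enorm_ge0.
rewrite mulrC ler_pdivlMr// -(ler_pM2r qp).
have := dotp_le_enorm (Q *m (zs - zeta)) (C *m (zs - zeta)).
have := ler_wpM2l (ltW qp) Cx; move: h; rewrite expr2; lra.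
Qed.

(** In [1 + 2 / lambda], 1 is the residual of [zeta] inside the TD error and [2 / lambda] the
    distance from [zs] to [zeta], seen through [td_dual]. *)
Lemma npg_target_bias zeta :
  enorm (npg_target M piF theta phi J zs - invmx F *m gJ) ^+ 2 <=
  8 * (g * (1 + 2 / lambda) / mu) ^+ 2 * value_loss zeta.
Proof.
have g0 : 0 <= g by exact: le_trans g1.
set w := Num.sqrt (8 * value_loss zeta); have w0 : 0 <= w by exact: sqrtr_ge0.
have vl := value_loss_ge0 zeta.
have step : enorm (td_mean M piF theta phi J zs - gJ) <= g * (1 + 2 / lambda) * w.
  have il : 0 <= lambda^-1 by rewrite invr_ge0 ltW.
  apply: enorm_dual => [|u]; first by rewrite !mulr_ge0// addr_ge0// mulr_ge0.
  rewrite dotpBr /td_mean (dotp_vmean mix) gJE -stat_meanB.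
  pose h s := dotp zeta (phi s) - V s.
  have -> : E (fun z => dotp u (td_error M phi J zs z *: score piF theta z.1.1 z.1.2) -
      (reward M z.1.1 z.1.2 - J + (V z.2 - V z.1.1)) * dotp u (sc z.1.1 z.1.2)) =
      E (fun z => dotp u (sc z.1.1 z.1.2) * (h z.2 - h z.1.1)) + dotp (td_dual u) (zs - zeta).
    rewrite td_dualE -stat_meanD; congr stat_mean; apply: funext => z.
    by rewrite dotpZr /td_error /h -/sc !(dotpBl, dotpBr); ring.
  have t1 : E (fun z => dotp u (sc z.1.1 z.1.2) * (h z.2 - h z.1.1)) <= g * enorm u * w.
    apply: residual_diff => //; first by rewrite mulr_ge0 ?enorm_ge0.
    by move=> z; apply: le_trans (dotp_norm_le _ _) _; rewrite mulrC ler_wpM2r ?enorm_ge0.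
  have t2 : dotp (td_dual u) (zs - zeta) <= 2 * g * enorm u * (lambda^-1 * w).
    rewrite -td_dual_proj -{1}QT -dotp_mulmx.
    apply: le_trans (dotp_le_enorm _ _) _; apply: ler_pM; rewrite ?enorm_ge0//.
      exact: enorm_td_dual.
    exact: critic_target_bias.
  lra.
have := enorm_fisher_inv mu0 coerF (td_mean M piF theta phi J zs - gJ).
rewrite -/F mulmxBr -/(npg_target M piF theta phi J zs) => h1.
have h2 : enorm (npg_target M piF theta phi J zs - invmx F *m gJ) <= g * (1 + 2 / lambda) / mu * w.
  apply: le_trans h1 _; rewrite ler_pdivrMr//; apply: le_trans step _.
  by rewrite [leRHS]mulrAC divfK ?gt_eqF.
apply: (@le_trans _ _ ((g * (1 + 2 / lambda) / mu * w) ^+ 2)).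
  by rewrite ler_pXn2r ?nnegrE ?enorm_ge0// (le_trans (enorm_ge0 _) h2).
have vl8 : 0 <= 8 * value_loss zeta by rewrite mulr_ge0.
by rewrite exprMn sqr_sqrtr//; lra.
Qed.

End Bias.

(** * Both phases of an epoch combined *)

Ltac nonneg := repeat first [assumption | exact: sqr_ge0 | exact: ler01 | exact: ler0n |
  exact: expR_ge0 | apply: addr_ge0 | apply: mulr_ge0].

(** The direction [nac_dir] as a function of the transitions of its own epoch only. *)
Definition epoch_dir (R : realType) (S A : finType) (M : mdp R S A) (m d : nat)
    (piF : 'cV[R]_d -> S -> A -> R) (phi : S -> 'cV[R]_m) (p : nac_steps R)
    (H B : nat) (theta : 'cV[R]_d) (x0 : 'cV[R]_(1 + m)) (w0 : 'cV[R]_d)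
    (l : seq (transition S A)) : 'cV[R]_d :=
  npg_iter M piF phi p H B l 0 theta (critic_iter M phi p H B l 0 x0 H) w0 H.

Definition epoch_err (R : realType) (lambda mu Cb : R) (p : nac_steps R) (H B : nat) : R :=
  (1 - beta p * lambda / 2) ^+ H.-1 + (1 - gamma p * mu / 2) ^+ H + batch_err Cb B.

(** A predicate on [K1], so that the constant can be chosen before the MDP, the policy class and the
    batch parameters, as uniformity in the theorem requires. *)
Definition epoch_dir_spec (R : realType) (m d : nat) (lambda mu g R0 : R) (p : nac_steps R)
    (K1 : R) : Prop :=
  forall (S A : finType) (M : mdp R S A) (piF : 'cV[R]_d -> S -> A -> R) (theta : 'cV[R]_d)
    (Cb : R) (phi : S -> 'cV[R]_m) (x0 : 'cV[R]_(1 + m)) (w0 : 'cV[R]_d) (B H : nat)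
    (V : S -> R) (gJ : 'cV[R]_d),
  let pi := piF theta in
  let dd := pol_stat M pi in
  let sc := score piF theta in
  mixing M pi dd Cb -> (forall s, enorm (phi s) <= 1) -> (forall s a, enorm (sc s a) <= g) ->
  (forall v : 'cV[R]_d, mu * enorm v ^+ 2 <= dotp v (fisher M piF theta *m v)) ->
  (forall u, stat_mean M pi dd (fun z => dotp u (sc z.1.1 z.1.2)) = 0) ->
  (forall x, in_ker_orth (critic_mx M pi phi) x ->
    lambda * enorm x ^+ 2 <= dotp x (critic_mx M pi phi *m x)) ->
  (forall s, V s = step_mean M pi s
    (fun z => reward M z.1.1 z.1.2 - mean_reward M pi dd + V z.2)) ->
  (forall u, dotp u gJ = stat_mean M pi dd (fun z =>
    (reward M z.1.1 z.1.2 - mean_reward M pi dd + (V z.2 - V z.1.1)) *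
      dotp u (sc z.1.1 z.1.2))) ->
  (0 < B)%N -> (0 < H)%N -> enorm x0 <= R0 -> enorm w0 <= R0 ->
  4 * (3 * (m%:R + 2)) * batch_err Cb B * H%:R <= 1 ->
  batch_err Cb B * (2 * (d%:R + 2) * (1 + g ^+ 2) ^+ 2) <= gamma p * mu / 2 ->
  forall s zeta,
  let dev l := epoch_dir M piF phi p H B theta x0 w0 l - invmx (fisher M piF theta) *m gJ in
  let err := H%:R ^+ 2 * epoch_err lambda mu Cb p H B in
  let loss := value_loss M piF theta phi V zeta in
  rollout M pi (H * B + H * B) s (fun l => enorm (dev l) ^+ 2) <= K1 * (err + loss) /\
  forall u, `|rollout M pi (H * B + H * B) s (fun l => dotp u (dev l))| <=
    enorm u * (K1 * (err + Num.sqrt loss)).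

Lemma epoch_dir_bounds (R : realType) (m d : nat) (lambda mu g R0 : R) (p : nac_steps R) :
  0 < lambda -> lambda <= 1 -> 0 < mu -> 1 <= g -> 0 <= R0 ->
  0 < beta p -> 4 * beta p <= lambda -> beta p * cbeta p = 1 ->
  0 < gamma p -> gamma p <= 1 -> gamma p * g ^+ 4 <= mu -> gamma p * mu <= 1 ->
  exists K1 : R, 0 <= K1 /\ epoch_dir_spec m d lambda mu g R0 p K1.
Proof.
move=> la0 la1 mu0 g1 R00 bt0 bt1 bc gm0 gm1 gm2 gm3.
have g0 : 0 <= g by exact: le_trans g1.
pose ac := beta p * lambda; pose an := gamma p * mu.
pose b1 := 2 / lambda + 1; pose ce : R := 3 * (m%:R + 2).
pose n0 := (R0 + 1) ^+ 2; pose wc0 := (R0 + lambda^-1) ^+ 2.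
pose kW := expR 2 * (wc0 + 3 * (n0 + 1) + b1 ^+ 2).
pose y1 := 5 * wc0 + (2 + 2 / ac) * n0 + b1 ^+ 2.
pose kY := (1 + 2 / ac) + ce * (4 * kW + 1 + b1 ^+ 2).
pose y2 := 3 * (1 + wc0) + 2 * (1 + n0) + b1.
pose kb := 4 + kW + n0 + b1.
pose gg := g + g ^+ 3 / mu.
pose cn : R := 2 * (d%:R + 2) * gg ^+ 2.
pose z0 := 2 * R0 ^+ 2 + 2 * (g / mu) ^+ 2.
pose kZ := z0 + 2 / an * cn.
pose eb := g ^+ 2 * (1 + kZ) + gg.
(* For [E[n ^ 2] <= kn * H ^ 2], from [n <= (2 + 2 / lambda) + |eta - J| + 2 |x|] and [sqr_sum3]. *)
pose kn := 3 * ((2 + 2 / lambda) ^+ 2 + (n0 + 1) + 4 * kW).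
pose gm := 2 * g / mu.
pose K2 := g * (1 + 2 / lambda) / mu.
(* The outer 2 splits the deviation at [wc], the NPG target of the exact critic; [16 = 2 * 8], with
   the 8 of [npg_target_bias]. *)
pose Ka := 2 * (2 * kn * (z0 + 2 / an * cn) + 2 * gm ^+ 2 * (y1 + 2 / ac * kY)) + 16 * K2 ^+ 2.
pose Kb := kn * (1 + z0 + 2 / an * eb) + gm * (y2 + 2 / ac * kb) + 3 * K2.
have il : 0 <= 2 / lambda by rewrite divr_ge0// ltW.
have il1 : 0 <= lambda^-1 by rewrite invr_ge0 ltW.
have ac0 : 0 < ac by exact: mulr_gt0.
have an0 : 0 < an by exact: mulr_gt0.
have iac : 0 <= 2 / ac by rewrite divr_ge0// ltW.
have ian : 0 <= 2 / an by rewrite divr_ge0// ltW.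
have b10 : 0 <= b1 by rewrite /b1 addr_ge0.
have n00 : 0 <= n0 by rewrite /n0 sqr_ge0.
have wc00 : 0 <= wc0 by rewrite /wc0 sqr_ge0.
have b1s := sqr_ge0 b1.
have gsq := sqr_ge0 g; have gmu := sqr_ge0 (g / mu).
have kW0 : 0 <= kW by rewrite /kW; nonneg.
have ce0 : 0 <= ce by rewrite /ce; nonneg.
have y10 : 0 <= y1 by rewrite /y1; nonneg.
have kY0 : 0 <= kY by rewrite /kY; nonneg.
have y20 : 0 <= y2 by rewrite /y2; nonneg.
have kb0 : 0 <= kb by rewrite /kb; nonneg.
have gg0 : 0 <= gg by rewrite /gg addr_ge0// divr_ge0 ?exprn_ge0// ltW.
have cn0 : 0 <= cn by rewrite /cn; nonneg.
have z00 : 0 <= z0 by rewrite /z0; nonneg.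
have icn : 0 <= 2 / an * cn by exact: mulr_ge0.
have kZ0 : 0 <= kZ by exact: addr_ge0.
have eb0 : 0 <= eb by rewrite /eb; nonneg.
have kn0 : 0 <= kn by rewrite /kn; nonneg.
have gm00 : 0 <= gm by rewrite /gm divr_ge0 ?mulr_ge0// ltW.
have imu : 0 <= mu^-1 by rewrite invr_ge0 ltW.
have K20 : 0 <= K2 by rewrite /K2; nonneg.
have ieb : 0 <= 2 / an * eb by exact: mulr_ge0.
have ikY : 0 <= 2 / ac * kY by exact: mulr_ge0.
have ikb : 0 <= 2 / ac * kb by exact: mulr_ge0.
have Ka1 : 0 <= 2 * kn * (z0 + 2 / an * cn) by nonneg.
have Ka2 : 0 <= 2 * gm ^+ 2 * (y1 + 2 / ac * kY) by nonneg.
have Kb1 : 0 <= kn * (1 + z0 + 2 / an * eb) by nonneg.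
have Kb2 : 0 <= gm * (y2 + 2 / ac * kb) by nonneg.
have Ka0 : 0 <= Ka by rewrite /Ka; nonneg.
have Kb0 : 0 <= Kb by rewrite /Kb; nonneg.
exists (Ka + Kb); split; first exact: addr_ge0.
move=> S A M piF theta Cb phi x0 w0 B H V gJ pi dd sc mix phi1 sc_le coerF sc0 coerC bell gJE
  B0 H0 x0R w0R kap1 kap2 s zeta dev err loss.
have piP : is_policy pi by case: mix.
have [Q [zs [[QT QQ CQ QC] [coer kerQ Czs Qzs zs_le]]]] := critic_target mix phi1 la0 coerC.
set kap := batch_err Cb B in kap1 kap2 *.
have kp : 0 <= kap by exact: batch_err_ge0.
have HH : 1 <= H%:R ^+ 2 :> R by rewrite exprn_ege1// ler1n.
have H1 : 1 <= H%:R :> R by rewrite ler1n.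
have kapl : kap <= 1.
  have : kap * 1 <= kap * H%:R by rewrite ler_wpM2l.
  have : 0 <= m%:R * (kap * H%:R) by apply: mulr_ge0 => //; exact: mulr_ge0.
  by move: kap1; clear; lra.
pose qc := 1 - ac / 2; pose qn := 1 - an / 2.
have qc0 : 0 <= qc.
  have : ac <= 1 by apply: mulr_ile1; [exact: ltW|exact: ltW|by move: bt1 la1; clear; lra|].
  by rewrite /qc; clear; lra.
have qn0 : 0 <= qn by move: gm3; rewrite /qn -/an; clear; lra.
set ep := epoch_err lambda mu Cb p H B in err *.
have epE : ep = qc ^+ H.-1 + qn ^+ H + kap by [].
have qcH := exprn_ge0 H.-1 qc0; have qnH := exprn_ge0 H qn0.
pose J := mean_reward M pi dd.
pose wc := npg_target M piF theta phi J zs.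
pose X l := critic_iter M phi p H B l 0 x0 H.
pose eta l := usubmx (X l) 0 0; pose ze l := dsubmx (X l).
pose x l := ze l - zs.
pose n l := 1 + `|eta l| + 2 * enorm (ze l).
pose wt l := npg_target M piF theta phi (eta l) (ze l).
pose Rc F := rollout M pi (H * B) s F.
(* the NPG phase, conditionally on the outcome l of the critic phase *)
pose wl l l' := npg_run M piF theta phi p B (X l) l' w0 H.
have split (G : 'cV[R]_d -> R) :
    rollout M pi (H * B + H * B) s (fun l => G (epoch_dir M piF phi p H B theta x0 w0 l)) =
    Rc (fun l => rollout M pi (H * B) (end_state s l) (fun l' => G (wl l l'))).
  rewrite rollout_cat; apply: (eq_rollout piP) => l hl _.
  apply: (eq_rollout piP) => l' hl' _; rewrite /epoch_dir critic_iter_prefix ?muln0 ?add0n ?hl//.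
  by rewrite npg_iter_run.
have Wle : Rc (fun l => enorm (x l) ^+ 2) <= kW * H%:R ^+ 2.
  exact: (critic_W_le mix phi1 la0 la1 QT CQ QC coer Czs zs_le bt0 bt1 B0 bc H0 x0R kap1 s (leqnn H)).
have Nle : Rc (fun l => (eta l - J) ^+ 2) <= n0 + 1.
  exact: (critic_k_sqr mix phi zs B0 bc H0 x0R kap1 s H).
have Yle : Rc (fun l => enorm (Q *m x l) ^+ 2) <= y1 * qc ^+ H.-1 + 2 / ac * kY * kap * H%:R ^+ 2.
  exact: (critic_Y_le mix phi1 la0 la1 QT QQ CQ QC coer Czs zs_le bt0 bt1 B0 bc H0 x0R kap1 s).
have Ble v : Q *m v = v -> `|Rc (fun l => dotp v (x l))| <=
    enorm v * (qc ^+ H.-1 * y2 + 2 / ac * (kb * kap * H%:R ^+ 2)).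
  move=> Qv; have HP : (H.-1 < H)%N by rewrite prednK.
  have := critic_bias_le mix phi1 la0 la1 QT CQ QC coer Czs zs_le bt0 bt1 B0 bc H0 x0R kap1 s HP Qv.
  by rewrite prednK.
have nle : Rc (fun l => n l ^+ 2) <= kn * H%:R ^+ 2.
  apply: (@le_trans _ _ (Rc (fun l => 3 * (2 + 2 / lambda) ^+ 2 + 3 * (eta l - J) ^+ 2 +
      12 * enorm (x l) ^+ 2))).
    apply: (rollout_le piP) => l _ _.
    have [_ _ [dP _] _] := mix; have /andP[j0 j1] := mean_reward_ge0_le1 M piP dP.
    have e1 : `|eta l| <= `|eta l - J| + 1.
      rewrite -{1}(subrK J (eta l)); apply: le_trans (ler_normD _ _) _.
      by rewrite lerD2l ger0_norm.
    have e2 : enorm (ze l) <= enorm (x l) + lambda^-1.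
      by rewrite -{1}(subrK zs (ze l)); apply: le_trans (enormD _ _) _; rewrite lerD2l.
    have nn : 0 <= n l by rewrite /n addr_ge0 ?addr_ge0// mulr_ge0// enorm_ge0.
    have le1 : n l <= (2 + 2 / lambda) + `|eta l - J| + 2 * enorm (x l) by rewrite /n; move: e1 e2; clear; lra.
    apply: (@le_trans _ _ (((2 + 2 / lambda) + `|eta l - J| + 2 * enorm (x l)) ^+ 2)).
      by rewrite ler_pXn2r ?nnegrE// (le_trans nn).
    apply: le_trans (sqr_sum3 _ _ _) _; rewrite real_normK ?num_real// exprMn; clear; lra.
  rewrite /Rc !rolloutD !rolloutZ rollout_cst// -/(Rc _) -/(Rc _).
  have t1 : (2 + 2 / lambda) ^+ 2 <= (2 + 2 / lambda) ^+ 2 * H%:R ^+ 2 by rewrite ler_peMr ?sqr_ge0.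
  have t2 : n0 + 1 <= (n0 + 1) * H%:R ^+ 2 by rewrite ler_peMr//; move: n00; clear; lra.
  by rewrite /kn; move: Wle Nle t1 t2; clear; lra.
have Zle l : rollout M pi (H * B) (end_state s l) (fun l' => enorm (wl l l' - wt l) ^+ 2) <=
    n l ^+ 2 * (z0 * qn ^+ H + 2 / an * cn * kap).
  exact: (npg_Z_le mix (X l) phi1 g1 mu0 sc_le coerF B0 gm0 gm1 gm2 gm3 kap2 R00 w0R _ H).
have Cle l u : `|rollout M pi (H * B) (end_state s l) (fun l' => dotp u (wl l l' - wt l))| <=
    enorm u * (n l ^+ 2 * ((1 + z0) * qn ^+ H + 2 / an * eb * kap)).
  exact: (npg_bias_le mix (X l) phi1 g1 mu0 sc_le coerF B0 gm0 gm1 gm2 gm3 kap2 kapl R00 w0R _ H).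
have wtc l : enorm (wt l - wc) <= gm * enorm (Q *m x l).
  exact: (npg_target_dev_le mix phi1 g1 mu0 sc_le coerF zs QT kerQ sc0).
have tb : enorm (wc - invmx (fisher M piF theta) *m gJ) ^+ 2 <= 8 * K2 ^+ 2 * loss.
  exact: (npg_target_bias mix phi1 g1 mu0 la0 sc_le coerF QT coer kerQ Czs bell gJE).
have loss0 : 0 <= loss by exact: (value_loss_ge0 mix).
have HHep (k : R) : 0 <= k -> k * ep <= k * (H%:R ^+ 2 * ep).
  by move=> k0; rewrite ler_wpM2l// ler_peMl// epE; move: qcH qnH kp; clear; lra.
have ep0 : 0 <= ep by rewrite epE; move: qcH qnH kp; clear; lra.
have err0 : 0 <= err by rewrite /err mulr_ge0// sqr_ge0.
set ws := invmx _ *m gJ in dev tb *.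
have Psq : rollout M pi (H * B + H * B) s (fun l => enorm (epoch_dir M piF phi p H B theta x0 w0 l - wc) ^+ 2)
    <= (2 * kn * (z0 + 2 / an * cn) + 2 * gm ^+ 2 * (y1 + 2 / ac * kY)) * err.
  rewrite (split (fun w => enorm (w - wc) ^+ 2)).
  apply: (@le_trans _ _ (Rc (fun l => (2 * (z0 * qn ^+ H + 2 / an * cn * kap)) * n l ^+ 2 +
      (2 * gm ^+ 2) * enorm (Q *m x l) ^+ 2))).
    apply: (rollout_le piP) => l _ _.
    apply: (@le_trans _ _ (rollout M pi (H * B) (end_state s l) (fun l' =>
        2 * enorm (wl l l' - wt l) ^+ 2 + 2 * (gm * enorm (Q *m x l)) ^+ 2))).
      apply: (rollout_le piP) => l' _ _.
      rewrite -[wl l l' - wc](subrKA (wt l)); apply: le_trans (sqr_enormD _ _) _.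
      rewrite lerD2l ler_wpM2l// ler_pXn2r ?nnegrE ?enorm_ge0// mulr_ge0 ?enorm_ge0//.
    by rewrite rolloutD rollout_cst// rolloutZ exprMn; have := Zle l; clear; lra.
  rewrite /Rc !(rolloutD, rolloutZ) -/(Rc _) -/(Rc _).
  have t1 : 2 * (z0 * qn ^+ H + 2 / an * cn * kap) <= 2 * ((z0 + 2 / an * cn) * ep).
    have : 0 <= z0 * (qc ^+ H.-1 + kap) by apply: mulr_ge0 => //; exact: addr_ge0.
    have : 0 <= 2 / an * cn * (qc ^+ H.-1 + qn ^+ H) by apply: mulr_ge0 => //; exact: addr_ge0.
    by rewrite epE; clear; lra.
  have t2 : 2 * (z0 * qn ^+ H + 2 / an * cn * kap) * Rc (fun l => n l ^+ 2) <=
      2 * ((z0 + 2 / an * cn) * ep) * (kn * H%:R ^+ 2).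
    apply: ler_pM => //.
      by apply: mulr_ge0 => //; apply: addr_ge0; exact: mulr_ge0.
    by apply: (rollout_ge0 piP) => l _ _; exact: sqr_ge0.
  have t3 : 2 * gm ^+ 2 * Rc (fun l => enorm (Q *m x l) ^+ 2) <=
      2 * gm ^+ 2 * ((y1 + 2 / ac * kY) * err).
    apply: ler_wpM2l; first by rewrite mulr_ge0 ?sqr_ge0.
    apply: le_trans Yle _.
    have : 0 <= y1 * (qn ^+ H + kap) by apply: mulr_ge0 => //; exact: addr_ge0.
    have := HHep y1 y10.
    have : 0 <= 2 / ac * kY * (H%:R ^+ 2 * (qc ^+ H.-1 + qn ^+ H)).
      by apply: mulr_ge0 => //; apply: mulr_ge0; [exact: sqr_ge0|exact: addr_ge0].
    by rewrite /err epE; clear; lra.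
  by move: t2 t3; rewrite /err; clear; lra.
split.
  apply: (@le_trans _ _ (rollout M pi (H * B + H * B) s (fun l =>
      2 * enorm (epoch_dir M piF phi p H B theta x0 w0 l - wc) ^+ 2 + 2 * (8 * K2 ^+ 2 * loss)))).
    apply: (rollout_le piP) => l _ _; rewrite /dev.
    rewrite -[epoch_dir _ _ _ _ _ _ _ _ _ _ - ws](subrKA wc).
    by apply: le_trans (sqr_enormD _ _) _; rewrite lerD2l ler_wpM2l.
  rewrite rolloutD rollout_cst// rolloutZ.
  have : 0 <= Kb * (err + loss) by apply: mulr_ge0 => //; exact: addr_ge0.
  have : 0 <= 16 * K2 ^+ 2 * err by apply: mulr_ge0 => //; apply: mulr_ge0 => //; exact: sqr_ge0.
  have : 0 <= (2 * kn * (z0 + 2 / an * cn) + 2 * gm ^+ 2 * (y1 + 2 / ac * kY)) * loss.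
    by apply: mulr_ge0 => //; exact: addr_ge0.
  by move: Psq; rewrite /Ka; clear; lra.
move=> u; have u0 := enorm_ge0 u.
(* A square root of [npg_target_bias], with [8 <= 3 ^ 2]. *)
have sl : enorm (wc - ws) <= 3 * K2 * Num.sqrt loss.
  have sp := sqrtr_ge0 loss.
  have k3 : 0 <= 3 * K2 * Num.sqrt loss by apply: mulr_ge0 => //; exact: mulr_ge0.
  rewrite -(ler_pXn2r (n:=2))// ?nnegrE ?enorm_ge0//.
  apply: le_trans tb _; rewrite [leRHS]exprMn sqr_sqrtr// [(3 * K2) ^+ 2]exprMn.
  by have : 0 <= K2 ^+ 2 * loss; [apply: mulr_ge0 => //; exact: sqr_ge0|clear; lra].
pose v := td_dual M piF theta phi (invmx (fisher M piF theta) *m u).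
have Qv : Q *m v = v by exact: (td_dual_proj mix QT kerQ).
have nv : enorm v <= gm * enorm u.
  apply: le_trans (enorm_td_dual mix phi1 g1 sc_le _) _.
  have := enorm_fisher_inv mu0 coerF u => h.
  have g20 : 0 <= 2 * g by rewrite mulr_ge0.
  by have := ler_wpM2l g20 h; rewrite /gm; clear; lra.
(* Three biases: NPG iteration, critic, approximation. Linearity of the target in the critic turns
   the second into the critic bias tested on [v], which avoids the square root of its second
   moment. *)
have -> : rollout M pi (H * B + H * B) s (fun l => dotp u (dev l)) =
    Rc (fun l => rollout M pi (H * B) (end_state s l) (fun l' => dotp u (wl l l' - wt l))) +
    Rc (fun l => dotp v (x l)) + dotp u (wc - ws).
  rewrite /dev (split (fun w => dotp u (w - ws))).
  rewrite -[X in _ + _ + X](rollout_cst M piP (H * B) s) /Rc -!rolloutD.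
  congr rollout; apply: funext => l.
  have -> : dotp v (x l) = dotp u (wt l - wc).
    by rewrite (npg_target_dev mix phi zs sc0 u).
  rewrite -addrA -dotpDr -[X in _ = _ + X](rollout_cst M piP (H * B) (end_state s l)) -rolloutD.
  congr rollout; apply: funext => l'.
  by rewrite -dotpDr !subrKA.
apply: le_trans (ler_normD _ _) _.
have p1 : `|Rc (fun l => rollout M pi (H * B) (end_state s l) (fun l' => dotp u (wl l l' - wt l)))| <=
    enorm u * ((kn * (1 + z0 + 2 / an * eb)) * err).
  apply: le_trans (ler_norm_rollout M piP _ _ _) _.
  apply: (@le_trans _ _ (Rc (fun l => (enorm u * ((1 + z0) * qn ^+ H + 2 / an * eb * kap)) * n l ^+ 2))).
    apply: (rollout_le piP) => l _ _; by apply: le_trans (Cle l u) _; clear; lra.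
  rewrite /Rc rolloutZ -/(Rc _).
  have t1 : (1 + z0) * qn ^+ H + 2 / an * eb * kap <= (1 + z0 + 2 / an * eb) * ep.
    have : 0 <= (1 + z0) * (qc ^+ H.-1 + kap) by apply: mulr_ge0; exact: addr_ge0.
    have : 0 <= 2 / an * eb * (qc ^+ H.-1 + qn ^+ H) by apply: mulr_ge0 => //; exact: addr_ge0.
    by rewrite epE; clear; lra.
  have t0 : 0 <= (1 + z0) * qn ^+ H + 2 / an * eb * kap.
    by apply: addr_ge0; apply: mulr_ge0 => //; exact: addr_ge0.
  have t2 : ((1 + z0) * qn ^+ H + 2 / an * eb * kap) * Rc (fun l => n l ^+ 2) <=
      ((1 + z0 + 2 / an * eb) * ep) * (kn * H%:R ^+ 2).
    by apply: ler_pM => //; apply: (rollout_ge0 piP) => l _ _; exact: sqr_ge0.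
  by have := ler_wpM2l u0 t2; rewrite /err; clear; lra.
have p2 : `|Rc (fun l => dotp v (x l))| <= enorm u * ((gm * (y2 + 2 / ac * kb)) * err).
  apply: le_trans (Ble v Qv) _.
  have t1 : qc ^+ H.-1 * y2 + 2 / ac * (kb * kap * H%:R ^+ 2) <= (y2 + 2 / ac * kb) * err.
    have : 0 <= y2 * (qn ^+ H + kap) by apply: mulr_ge0 => //; exact: addr_ge0.
    have := HHep y2 y20.
    have : 0 <= 2 / ac * kb * (H%:R ^+ 2 * (qc ^+ H.-1 + qn ^+ H)).
      by apply: mulr_ge0 => //; apply: mulr_ge0; [exact: sqr_ge0|exact: addr_ge0].
    by rewrite /err epE; clear; lra.
  have t0 : 0 <= (y2 + 2 / ac * kb) * err by apply: mulr_ge0 => //; exact: addr_ge0.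
  apply: (@le_trans _ _ (enorm v * ((y2 + 2 / ac * kb) * err))).
    by apply: ler_wpM2l => //; exact: enorm_ge0.
  by have := ler_wpM2r t0 nv; clear; lra.
have p3 : `|dotp u (wc - ws)| <= enorm u * (3 * K2 * Num.sqrt loss).
  by apply: le_trans (dotp_norm_le _ _) _; rewrite ler_wpM2l.
have p12 := le_trans (ler_normD _ _) (lerD p1 p2).
apply: le_trans (lerD p12 p3) _.
have sp := sqrtr_ge0 loss.
have e1 : 0 <= enorm u * (Ka * (err + Num.sqrt loss)).
  by apply: mulr_ge0 => //; apply: mulr_ge0 => //; exact: addr_ge0.
have e2 : 0 <= enorm u * (3 * K2 * err) by apply: mulr_ge0 => //; apply: mulr_ge0 => //; exact: mulr_ge0.
have e3 : 0 <= enorm u * ((kn * (1 + z0 + 2 / an * eb) + gm * (y2 + 2 / ac * kb)) * Num.sqrt loss).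
  by apply: mulr_ge0 => //; apply: mulr_ge0 => //; exact: addr_ge0.
by move: e1 e2 e3; rewrite /Kb; clear; lra.
Qed.

(** * Policy gradient and performance difference *)

Section Gradients.
Variables (R : realType) (n : nat).
Implicit Types (f : 'cV[R]_n -> R) (x v w : 'cV[R]_n).

Lemma derive_grad f x v : differentiable f x -> 'D_v f x = dotp (grad f x) v.
Proof.
move=> df; rewrite deriveE// dotpE.
have {1}-> : v = \sum_i v i 0 *: delta_mx i 0.
  by rewrite {1}[v]matrix_sum_delta; apply: eq_bigr => i _; rewrite big_ord1.
rewrite linear_sum; apply: eq_bigr => i _.
by rewrite linearZ /= mxE deriveE// mulrC.
Qed.

Lemma line_derive f x w (t : R) : differentiable f (x + t *: w) ->
  is_derive t 1 (fun u : R => f (x + u *: w)) ('D_w f (x + t *: w)).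
Proof.
move=> df; have dv := diff_derivable (v := w) df.
have E : (fun h : R => h^-1 *: (f (x + (h *: 1 + t) *: w) - f (x + t *: w))) =
    (fun h : R => h^-1 *: (f (h *: w + (x + t *: w)) - f (x + t *: w))).
  apply: funext => h; congr (_ *: (f _ - _)).
  by rewrite [h *: 1]mulr1 scalerDl addrCA.
by apply: DeriveDef; rewrite /derivable /derive /= E.
Qed.

Lemma segment_MVT f x w : (forall u : R, 0 <= u <= 1 -> differentiable f (x + u *: w)) ->
  exists2 u : R, 0 <= u <= 1 & f (x + w) - f x = dotp (grad f (x + u *: w)) w.
Proof.
move=> df; pose ph (u : R) := f (x + u *: w).
have dph (u : R) : 0 <= u <= 1 -> is_derive u 1 ph ('D_w f (x + u *: w)).
  by move=> u01; exact/line_derive/df.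
have [| |c c01 e] := @MVT_segment R ph (fun u => 'D_w f (x + u *: w)) 0 1 ler01.
- by move=> u; rewrite in_itv/= => /andP[u0 u1]; apply: dph; rewrite !ltW.
- apply: derivable_within_continuous => u; rewrite in_itv/= => u01.
  by have [] := dph u u01.
exists c; first by rewrite in_itv in c01.
rewrite -derive_grad; last by apply: df; rewrite in_itv in c01.
by move: e; rewrite /ph scale1r scale0r addr0 subr0 mulr1.
Qed.

(** The mean value theorem gives [|L|] where an integral would give half of it; the absolute value
    is there because the sign of [L] is not assumed. *)
Lemma segment_smooth (Theta : set 'cV[R]_n) f (L : R) x w :
  (forall y, Theta y -> differentiable f y) ->
  (forall y z, Theta y -> Theta z -> enorm (grad f y - grad f z) <= L * enorm (y - z)) ->
  (forall u : R, 0 <= u <= 1 -> Theta (x + u *: w)) ->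
  `|f (x + w) - f x - dotp (grad f x) w| <= `|L| * enorm w ^+ 2.
Proof.
move=> df lip seg; have [|u /andP[u0 u1] ->] := @segment_MVT f x w.
  by move=> u u01; exact/df/seg.
rewrite -dotpBl; apply: le_trans (dotp_norm_le _ _) _.
have x_in : Theta x by have := seg 0; rewrite scale0r addr0 lexx ler01; apply.
have xu_in : Theta (x + u *: w) by apply: seg; rewrite u0.
rewrite expr2 mulrA; apply: ler_wpM2r; first exact: enorm_ge0.
apply: le_trans (lip _ _ xu_in x_in) _; rewrite addrAC subrr add0r enormZ ger0_norm//.
apply: (@le_trans _ _ (`|L| * (u * enorm w))).
  by apply: ler_wpM2r; [rewrite mulr_ge0 ?enorm_ge0|exact: ler_norm].
by rewrite ler_wpM2l// ler_piMl ?enorm_ge0.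
Qed.

Lemma derive_ln f x v : differentiable f x -> 0 < f x ->
  differentiable (fun t => ln (f t)) x /\ 'D_v (fun t => ln (f t)) x = (f x)^-1 * 'D_v f x.
Proof.
move=> df f0; have dl := is_derive1_ln f0.
have dln : differentiable (@ln R : R -> R^o) (f x) by apply/derivable1_diffP; case: dl.
have dc : differentiable (@ln R \o f) x by exact: differentiable_comp.
split=> //; rewrite deriveE// (diff_comp df dln) /= deriv1E; last exact/derivable1_diffP.
by rewrite derive1E (@derive_val _ _ _ _ _ _ _ dl) deriveE// mulrC.
Qed.
End Gradients.

Section MeanReward.
Variables (R : realType) (S A : finType) (M : mdp R S A).
Notation tr := (transition S A).

Lemma esa_stat_mean (p : S -> A -> R) (dd : S -> R) (f : S -> A -> R) :
  esa (occ dd p) (fun s a => f s a : R^o) = stat_mean M p dd (fun z => f z.1.1 z.1.2).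
Proof.
apply: eq_bigr => s _; rewrite mulr_sumr; apply: eq_bigr => a _.
by rewrite /= -mulr_suml -mulr_sumr kernel_sum1 mulr1 mulrA.
Qed.

Lemma avg_rewardE (p : S -> A -> R) : avg_reward M p = mean_reward M p (pol_stat M p).
Proof. exact: esa_stat_mean. Qed.

Lemma stationary_telescope (p : S -> A -> R) (dd : S -> R) (g : S -> R) :
  is_policy p -> is_stationary (pol_chain M p) dd ->
  stat_mean M p dd (fun z => g z.2) = stat_mean M p dd (fun z => g z.1.1).
Proof.
move=> pP [_ st]; rewrite (stat_mean_pair M p dd (fun _ u => g u)).
transitivity (\sum_s dd s * g s).
  by rewrite exchange_big/=; apply: eq_bigr => u _; rewrite -mulr_suml st.
apply: eq_bigr => s _; congr (_ * _); rewrite -[LHS](step_mean_cst M pP s).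
exact: eq_step_mean.
Qed.

(** Increments of any [V] have stationary mean zero, so the identity holds for arbitrary [V] and
    [c]. *)
Lemma performance_difference (p : S -> A -> R) (dd : S -> R) (V : S -> R) (c : R) :
  is_policy p -> is_stationary (pol_chain M p) dd ->
  mean_reward M p dd - c =
  stat_mean M p dd (fun z => reward M z.1.1 z.1.2 - c + (V z.2 - V z.1.1)).
Proof.
move=> pP dS; have h := stationary_telescope V pP dS.
rewrite stat_meanD [X in _ = _ + X]stat_meanB h subrr addr0 stat_meanD.
by rewrite [X in _ = _ + X](stat_mean_cst M pP (proj1 dS)).
Qed.
End MeanReward.

Section PolicyGradient.
Variables (R : realType) (S A : finType) (M : mdp R S A) (n : nat).
Notation tr := (transition S A).
Variables (Theta : set 'cV[R]_n) (pi : 'cV[R]_n -> S -> A -> R).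
Hypothesis pol : policy_class Theta pi.

Lemma score_derive theta s a v : Theta theta ->
  'D_v (fun t => pi t s a) theta = pi theta s a * dotp v (score pi theta s a).
Proof.
move=> Tt; have [_ /(_ _ Tt)[_ p0 df]] := pol.
have [dl e] := derive_ln v (df s a) (p0 s a).
by rewrite dotpC -derive_grad// e mulrA divff ?mul1r// gt_eqF.
Qed.

Lemma score_mean theta s v : Theta theta ->
  \sum_a pi theta s a * dotp v (score pi theta s a) = 0.
Proof.
move=> Tt; have [Topen Tall] := pol; have [_ _ df] := Tall _ Tt.
under eq_bigr do rewrite -score_derive//.
have -> : \sum_a 'D_v (fun t => pi t s a) theta = 'D_v (fun t => \sum_a pi t s a) theta.
  have : is_derive theta v (fun t => \sum_a pi t s a) (\sum_a 'D_v (fun t => pi t s a) theta).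
    elim: (index_enum A) => [|a r IH].
      rewrite big_nil (_ : (fun t => _) = cst 0); first exact: is_derive_cst.
      by apply: funext => t; rewrite big_nil.
    rewrite big_cons (_ : (fun t => _) = (fun t => pi t s a) + (fun t => \sum_(i <- r) pi t s i)).
      by apply: is_deriveD; exact/derivableP/diff_derivable.
    by apply: funext => t; rewrite big_cons.
  by move=> h; rewrite derive_val.
have -> : 'D_v (fun t => \sum_a pi t s a) theta = 'D_v (cst 1 : 'cV[R]_n -> R) theta; last first.
  exact: derive_cst.
apply: near_eq_derive; near=> t; have Ttt : Theta t by near: t; exact: open_nbhs_nbhs.
by have [pP _ _] := Tall _ Ttt; rewrite policy_sum1.
Unshelve. all: by end_near. Qed.

Variables (theta : 'cV[R]_n) (Cb : R) (V : S -> R).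
Hypothesis Tt : Theta theta.
Let J0 := mean_reward M (pi theta) (pol_stat M (pi theta)).
Hypothesis mix : mixing M (pi theta) (pol_stat M (pi theta)) Cb.
Hypothesis stat : forall t, Theta t -> is_stationary (pol_chain M (pi t)) (pol_stat M (pi t)).
Hypothesis bellman : forall s,
  V s = step_mean M (pi theta) s (fun z => reward M z.1.1 z.1.2 - J0 + V z.2).

Lemma score_stat_mean u :
  stat_mean M (pi theta) (pol_stat M (pi theta)) (fun z => dotp u (score pi theta z.1.1 z.1.2)) = 0.
Proof.
apply: big1 => s _; have -> : step_mean M (pi theta) s
    (fun z => dotp u (score pi theta z.1.1 z.1.2)) = 0; last by rewrite mulr0.
  rewrite -[RHS](score_mean s u Tt); apply: eq_bigr => a _.
  by rewrite /= -mulr_suml -mulr_sumr kernel_sum1 mulr1.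
Qed.

Let adv s a := reward M s a - J0 + \sum_s' kernel M s a s' * V s' - V s.

Lemma mean_reward_diff t : Theta t ->
  Jfun M pi t - Jfun M pi theta =
  \sum_s pol_stat M (pi t) s * \sum_a (pi t s a - pi theta s a) * adv s a.
Proof.
move=> Ttt; have [_ Tall] := pol; have [tP _ _] := Tall _ Ttt; have [thP _ _] := Tall _ Tt.
have base p : is_policy p -> forall s,
    step_mean M p s (fun z => reward M z.1.1 z.1.2 - J0 + (V z.2 - V z.1.1)) =
    \sum_a p s a * adv s a.
  move=> pP s; apply: eq_bigr => a _ /=.
  under eq_bigr do rewrite -mulrA.
  rewrite -mulr_sumr; congr (_ * _).
  rewrite (eq_bigr (fun s' => kernel M s a s' * V s' +
    kernel M s a s' * (reward M s a - J0 - V s))) => [|s' _]; last by ring.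
  by rewrite big_split /= -mulr_suml kernel_sum1 /adv; ring.
rewrite /Jfun !avg_rewardE -/J0 (performance_difference V J0 tP (stat Ttt)).
apply: eq_bigr => s _; congr (_ * _); rewrite base//.
under [RHS]eq_bigr do rewrite mulrBl.
rewrite sumrB -[LHS]subr0; congr (_ - _).
rewrite -(base _ thP).
rewrite (_ : (fun z => _) = fun z => (reward M z.1.1 z.1.2 - J0 + V z.2) + (-1) * V z.1.1); last first.
  by apply: funext => z; ring.
rewrite step_meanD -bellman.
have -> : step_mean M (pi theta) s (fun z => -1 * V z.1.1) = - V s.
  by rewrite -[RHS](step_mean_cst M thP s); apply: eq_step_mean => a s' /=; ring.
by rewrite subrr.
Qed.

(** Solve the Poisson equation at [theta] for the indicator of [s] and integrate it against the
    stationary law at [t]: only the difference of the two policies remains. *)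
Lemma pol_stat_close t s : Theta t ->
  `|pol_stat M (pi t) s - pol_stat M (pi theta) s| <=
  Cb * \sum_u \sum_a `|pi t u a - pi theta u a|.
Proof.
move=> Ttt; have [_ Tall] := pol; have [tP _ _] := Tall _ Ttt; have [thP _ _] := Tall _ Tt.
have [_ Cb0 _ poisson] := mix.
pose dt := pol_stat M (pi t); pose d0 := pol_stat M (pi theta).
have dtS : is_stationary (pol_chain M (pi t)) dt := stat Ttt.
have [[dt0 dt1] _] := dtS.
have [|g [g1 g2]] := poisson (fun u => (u == s)%:R) 1.
  by move=> u; case: eqP; rewrite ?normr1 ?normr0.
have pick (dd : S -> R) : \sum_u dd u * (u == s)%:R = dd s.
  by rewrite (bigD1 s)//= eqxx mulr1 big1 ?addr0// => u /negPf ->; rewrite mulr0.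
have E : dt s - d0 s = \sum_u dt u * \sum_a (pi t u a - pi theta u a) *
    \sum_w kernel M u a w * g w.
  have -> : dt s - d0 s = \sum_u dt u * (g u - \sum_w pol_chain M (pi theta) u w * g w).
    have e0 : d0 s = \sum_u dt u * d0 s by rewrite -mulr_suml dt1 mul1r.
    rewrite e0 -{1}(pick dt) -sumrB; apply: eq_bigr => u _.
    by rewrite g1 (pick d0) mulrBr.
  have st := stationary_telescope g tP dtS.
  have e1 : stat_mean M (pi t) dt (fun z => g z.1.1) = \sum_u dt u * g u.
    apply: eq_bigr => u _; congr (_ * _); rewrite -[RHS](step_mean_cst M tP u).
    exact: eq_step_mean.
  under eq_bigr do rewrite mulrBr; rewrite sumrB -e1 -st -sumrB.
  apply: eq_bigr => u _; rewrite -mulrBr; congr (_ * _).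
  rewrite -(step_mean_next M (pi theta) u g) -sumrB; apply: eq_bigr => a _ /=.
  by rewrite mulrBl !mulr_sumr; congr (_ - _); apply: eq_bigr => w _; rewrite mulrA.
rewrite -/dt -/d0 E; apply: le_trans (ler_norm_sum _ _ _) _; rewrite mulr_sumr.
apply: ler_sum => u _; rewrite normrM ger0_norm//.
have dt_le1 : dt u <= 1 by rewrite -dt1 (bigD1 u)//= lerDl sumr_ge0.
apply: le_trans (_ : `|\sum_a (pi t u a - pi theta u a) * \sum_w kernel M u a w * g w| <= _).
  by rewrite ler_piMl.
apply: le_trans (ler_norm_sum _ _ _) _; rewrite mulr_sumr.
apply: ler_sum => a _; rewrite normrM mulrC ler_wpM2r//.
apply: le_trans (ler_norm_sum _ _ _) _; rewrite -[leRHS]mul1r -(kernel_sum1 M u a) mulr_suml.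
apply: ler_sum => w _; rewrite normrM ger0_norm ?kernel_ge0// ler_wpM2l ?kernel_ge0//.
by have := g2 w; rewrite mulr1.
Qed.

Lemma line_cvg v : (fun h : R => h *: v + theta) @ 0^' --> theta.
Proof.
rewrite -[X in _ --> X](add0r theta); apply: cvgD; last exact: cvg_cst.
rewrite -[X in _ --> X](scale0r v); apply: cvgZr_tmp.
exact: nbhs_dnbhs.
Qed.

(** In [mean_reward_diff] every term carries a factor [pi t s a - pi theta s a], so the limit of the
    quotient needs only continuity of the stationary law, which [pol_stat_close] gives, and not its
    differentiability. *)
Lemma policy_gradient v : differentiable (Jfun M pi) theta ->
  dotp v (grad (Jfun M pi) theta) =
  stat_mean M (pi theta) (pol_stat M (pi theta)) (fun z =>
    (reward M z.1.1 z.1.2 - J0 + (V z.2 - V z.1.1)) * dotp v (score pi theta z.1.1 z.1.2)).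
Proof.
move=> dJ; rewrite dotpC -derive_grad//.
have [Topen Tall] := pol; have [thP p0 df] := Tall _ Tt.
have [_ Cb0 _ _] := mix.
pose l h := h *: v + theta.
have near_T : \forall h \near (0 : R)^', Theta (l h).
  by apply: (line_cvg v); exact: open_nbhs_nbhs.
have pi_cvg s a : pi (l h) s a @[h --> (0 : R)^'] --> pi theta s a.
  apply: (@cvg_comp _ _ _ l (fun t => pi t s a) _ (nbhs theta)); first exact: line_cvg.
  exact: (differentiable_continuous (df s a)).
have pi_der s a : h^-1 *: (pi (l h) s a - pi theta s a) @[h --> (0 : R)^'] -->
    'D_v (fun t => pi t s a) theta.
  exact: (diff_derivable (v := v) (df s a)).
have dist_cvg : (Cb * \sum_u \sum_a `|pi (l h) u a - pi theta u a|) @[h --> (0 : R)^'] --> (0 : R).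
  have z0 : Cb * \sum_(u : S) \sum_(a : A) (0 : R) = 0.
    by rewrite big1 ?mulr0// => u _; rewrite big1.
  rewrite -[X in _ --> X]z0; apply: cvgMl_tmp.
  apply: cvg_big => [|u _]; first exact: add_continuous.
  apply: cvg_big => [|a _]; first exact: add_continuous.
  have n0 : `|pi theta u a - pi theta u a| = 0 by rewrite subrr normr0.
  rewrite -[X in _ --> X]n0; apply: cvg_norm.
  by apply: cvgB; [exact: pi_cvg|exact: cvg_cst].
have d_cvg s : pol_stat M (pi (l h)) s @[h --> (0 : R)^'] --> pol_stat M (pi theta) s.
  pose e h := Cb * \sum_u \sum_a `|pi (l h) u a - pi theta u a|.
  apply: (@squeeze_cvgr _ _ _ _ (fun h => pol_stat M (pi theta) s - e h)
    (fun h => pol_stat M (pi theta) s + e h)).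
  - near=> h; have Tl : Theta (l h) by near: h.
    have := pol_stat_close s Tl; rewrite ler_norml -/(e h) => /andP[h1 h2].
    by apply/andP; split; lra.
  - rewrite -[X in _ --> X]subr0; apply: cvgB; [exact: cvg_cst|exact: dist_cvg].
  - rewrite -[X in _ --> X]addr0; apply: cvgD; [exact: cvg_cst|exact: dist_cvg].
have lim : (fun h => h^-1 *: (Jfun M pi (l h) - Jfun M pi theta)) @ (0 : R)^' -->
    \sum_s pol_stat M (pi theta) s * \sum_a 'D_v (fun t => pi t s a) theta * adv s a.
  apply: (@cvg_trans _ ((fun h => \sum_s pol_stat M (pi (l h)) s *
      \sum_a (h^-1 *: (pi (l h) s a - pi theta s a)) * adv s a) @ (0 : R)^')).
    apply: near_eq_cvg; near=> h; have Tl : Theta (l h) by near: h.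
    rewrite (mean_reward_diff Tl) scaler_sumr; apply: eq_bigr => s _.
    rewrite scalerAr; congr (_ * _); rewrite scaler_sumr; apply: eq_bigr => a _.
    by rewrite scalerAl.
  apply: cvg_big => [|s _]; first exact: add_continuous.
  apply: cvgM; first exact: d_cvg.
  apply: cvg_big => [|a _]; first exact: add_continuous.
  by apply: cvgMr_tmp; exact: pi_der.
rewrite /derive (cvg_lim _ lim)//.
apply: eq_bigr => s _; congr (_ * _); apply: eq_bigr => a _ /=.
rewrite score_derive//.
have -> : pi theta s a * dotp v (score pi theta s a) * adv s a =
  \sum_s' pi theta s a * dotp v (score pi theta s a) *
     (kernel M s a s' * (reward M s a - J0 - V s) + kernel M s a s' * V s').
  rewrite -mulr_sumr; congr (_ * _); rewrite big_split /= -mulr_suml kernel_sum1 /adv; ring.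
by apply: eq_bigr => s' _; ring.
Unshelve. all: by end_near. Qed.

End PolicyGradient.

(** * One epoch *)

Lemma pol_chain_dist (R : realType) (S A : finType) (M : mdp R S A) (p : S -> A -> R) s :
  is_policy p -> is_dist (pol_chain M p s).
Proof.
move=> pP; split.
  move=> u; apply: sumr_ge0 => a _; rewrite mulr_ge0 ?kernel_ge0//.
  exact: policy_ge0.
rewrite /pol_chain exchange_big/= -[RHS](policy_sum1 pP s); apply: eq_bigr => a _.
by rewrite -mulr_suml kernel_sum1 mul1r.
Qed.

Lemma moore_penrose_unit (R : realType) n (A : 'M[R]_n) : A \in unitmx ->
  moore_penrose A = invmx A.
Proof.
move=> Au; have ex : is_moore_penrose A (invmx A).
  by split; rewrite ?mulmxV ?mulVmx ?trmx1// ?mul1mx.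
have [h _ _ _] := @xgetPex _ 0 [set X | is_moore_penrose A X] (ex_intro _ _ ex).
rewrite /moore_penrose; set X := xget _ _ in h *.
have AX : A *m X = 1%:M by rewrite -[A *m X]mulmx1 -(mulmxV Au) mulmxA h.
by rewrite -[X]mul1mx -(mulVmx Au) -mulmxA AX mulmx1.
Qed.

Lemma mean_vector (R : realType) (S A : finType) (M : mdp R S A) n (p : S -> A -> R)
    (dd : S -> R) (e : S -> A -> 'cV[R]_n) :
  exists v : 'cV[R]_n, forall u,
    dotp u v = stat_mean M p dd (fun z => dotp u (e z.1.1 z.1.2)).
Proof.
exists (\sum_s dd s *: \sum_a \sum_s' (p s a * kernel M s a s') *: e s a) => u.
rewrite dotp_sumr; apply: eq_bigr => s _; rewrite dotpZr; congr (_ * _).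
rewrite dotp_sumr; apply: eq_bigr => a _; rewrite dotp_sumr; apply: eq_bigr => s' _.
by rewrite dotpZr.
Qed.

(** * Value functions of a unichain policy *)

Section Value.
Variables (R : realType) (S A : finType) (M : mdp R S A) (p : S -> A -> R) (ct ch : R).
Notation tr := (transition S A).
Hypotheses (pP : is_policy p) (uni : unichain (pol_chain M p)).
Hypothesis ctP : (ctar_chain (pol_chain M p) <= ct%:E)%E.
Hypothesis chP : (chit_chain (pol_chain M p) <= ch%:E)%E.
Hypotheses (ct0 : 0 <= ct) (ch0 : 0 <= ch).
Let Pd s := pol_chain_dist M s pP.

Lemma pol_stat_stationary : is_stationary (pol_chain M p) (pol_stat M p).
Proof. exact: stat_distP. Qed.

Lemma unichain_mixing : mixing M p (pol_stat M p) (2 * (ct + ch)).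
Proof.
split=> //; first by rewrite mulr_ge0// addr_ge0.
  exact: pol_stat_stationary.
move=> f b fb; have [hR [h [hRP hP]]] := exists_hit Pd uni.
exact: (poisson_solution Pd uni ctP chP hRP hP fb).
Qed.

(** Existence has to be shown for [value] to be more than a default: a Poisson solution for the mean
    reward, centered by its stationary mean, satisfies [is_value]. *)
Lemma value_bellman s :
  value M p s = step_mean M p s (fun z => reward M z.1.1 z.1.2 -
    mean_reward M p (pol_stat M p) + value M p z.2).
Proof.
have [_ _ [[d0 d1] _] poisson] := unichain_mixing.
suff ex : exists V, is_value M p V.
  have [bell _] : is_value M p (value M p) by exact: (@xgetPex _ _ [set V | is_value M p V] ex).
  rewrite [LHS]bell -avg_rewardE; apply: eq_bigr => a _.
  under [RHS]eq_bigr do rewrite -mulrA.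
  rewrite -mulr_sumr; congr (_ * _); rewrite /q_of.
  under [RHS]eq_bigr do rewrite /= mulrDr.
  by rewrite big_split /= -mulr_suml kernel_sum1 mul1r.
pose r u := step_mean M p u (fun z => reward M z.1.1 z.1.2).
have [|g [g1 _]] := poisson r 1.
  move=> u; rewrite ler_norml; apply/andP; split.
    rewrite -(step_mean_cst M pP u (-1)); apply: (step_mean_le pP) => a s' _ /=.
    by have /andP[? ?] := reward_ge0_le1 M u a; lra.
  rewrite -(step_mean_cst M pP u 1); apply: (step_mean_le pP) => a s' _ /=.
  by have /andP[] := reward_ge0_le1 M u a.
pose c := \sum_u pol_stat M p u * g u.
exists (fun u => g u - c); split.
  move=> u; have := g1 u; rewrite -/(stat_mean M p _ _) => e.
  have -> : \sum_a p u a * q_of M p (fun u => g u - c) u a =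
    step_mean M p u (fun z => (reward M z.1.1 z.1.2 + g z.2) +
      - (mean_reward M p (pol_stat M p) + c)).
    apply: eq_bigr => a _; under [RHS]eq_bigr do rewrite -mulrA.
    rewrite -mulr_sumr; congr (_ * _); rewrite /q_of avg_rewardE.
    rewrite (eq_bigr (fun s' => kernel M u a s' * g s' - kernel M u a s' * c)); last first.
      by move=> s' _; rewrite mulrBr.
    rewrite sumrB -mulr_suml kernel_sum1 /=.
    under [RHS]eq_bigr do rewrite !mulrDr.
    by rewrite !big_split /= -!mulr_suml kernel_sum1; ring.
  rewrite step_meanD step_meanD step_mean_cst// step_mean_next -/(r u).
  by move: e; rewrite -/(mean_reward M p (pol_stat M p)); lra.
under eq_bigr do rewrite mulrBr.
by rewrite sumrB -mulr_suml d1 mul1r subrr.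
Qed.

Lemma advantage_stat_mean (q : S -> A -> R) (dd : S -> R) :
  stat_mean M q dd (fun z => reward M z.1.1 z.1.2 - mean_reward M p (pol_stat M p) +
    (value M p z.2 - value M p z.1.1)) =
  stat_mean M q dd (fun z => advantage M p z.1.1 z.1.2).
Proof.
apply: eq_bigr => s _; congr (_ * _); apply: eq_bigr => a _ /=.
under eq_bigr do rewrite -mulrA.
rewrite -mulr_sumr -mulr_suml -mulr_sumr kernel_sum1 mulr1; congr (_ * _).
rewrite /advantage /qvalue /q_of avg_rewardE.
rewrite (eq_bigr (fun s' => kernel M s a s' * value M p s' + kernel M s a s' *
   (reward M s a - mean_reward M p (pol_stat M p) - value M p s))); last first.
  by move=> s' _; ring.
by rewrite big_split /= -mulr_suml kernel_sum1; ring.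
Qed.

End Value.

(** * The Lyapunov inequality of one epoch *)

Section EpochInequality.
Variables (R : realType) (S A : finType) (M : mdp R S A) (d : nat).
Notation tr := (transition S A).
Variables (Theta : set 'cV[R]_d) (pi : 'cV[R]_d -> S -> A -> R).
Variables (pistar : S -> A -> R) (dstar : S -> R) (G2 L mu g : R).
Hypothesis pol : policy_class Theta pi.
Hypothesis starP : is_policy pistar.
Hypothesis starS : is_stationary (pol_chain M pistar) dstar.
Hypothesis sc_le : forall theta s a, Theta theta -> enorm (score pi theta s a) <= g.
Hypothesis sc_lip : forall t1 t2 s a, Theta t1 -> Theta t2 ->
  enorm (score pi t1 s a - score pi t2 s a) <= G2 * enorm (t1 - t2).
Hypothesis smooth : smooth_on Theta (Jfun M pi) L.
Hypotheses (mu0 : 0 < mu) (g1 : 1 <= g).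
Let Es := stat_mean M pistar dstar.
Let Js := mean_reward M pistar dstar.
Definition cross_entropy (theta : 'cV[R]_d) : R := Es (fun z => - ln (pi theta z.1.1 z.1.2)).
Let Phi := cross_entropy.

Variables (theta : 'cV[R]_d).
Hypothesis Tt : Theta theta.
Let gradJ := grad (Jfun M pi) theta.
Let F := fisher M pi theta.
Let ws := invmx F *m gradJ.
Hypothesis Funit : F \in unitmx.
Hypothesis coerF : forall v : 'cV[R]_d, mu * enorm v ^+ 2 <= dotp v (F *m v).
Hypothesis F_le : forall v : 'cV[R]_d, enorm (F *m v) <= g ^+ 2 * enorm v.
Variable (al : R).
Hypothesis al0 : 0 < al.
Hypothesis alL : 8 * `|L| * al <= mu.

Lemma cross_entropy_step w (psi : 'cV[R]_d) :
  (forall u, dotp u psi = Es (fun z => dotp u (score pi theta z.1.1 z.1.2))) ->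
  (forall u : R, 0 <= u <= 1 -> Theta (theta + (u * al) *: w)) ->
  Phi (theta + al *: w) <= Phi theta - al * dotp w psi + `|G2| * (al ^+ 2 * enorm w ^+ 2).
Proof.
move=> psiE seg; have [_ Tall] := pol.
rewrite psiE /Phi /cross_entropy.
set K := `|G2| * _; rewrite -[K](stat_mean_cst M starP (proj1 starS)) -mulNr.
rewrite -stat_meanZ -!stat_meanD {}/K.
apply: (stat_mean_le M starP (proj1 starS)) => z.
have := @segment_smooth R d Theta (fun t => ln (pi t z.1.1 z.1.2)) G2 theta (al *: w).
have df y : Theta y -> differentiable (fun t => ln (pi t z.1.1 z.1.2)) y.
  move=> Ty; have [_ p0 df] := Tall _ Ty.
  by have [] := derive_ln 0 (df z.1.1 z.1.2) (p0 z.1.1 z.1.2).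
move=> /(_ df (fun t1 t2 => @sc_lip t1 t2 z.1.1 z.1.2)) => h.
have {}h := h (fun u u01 => ltac:(by rewrite scalerA; exact: seg)).
move: h; rewrite -/(score pi theta z.1.1 z.1.2) enormZ (gtr0_norm al0) exprMn dotpZr.
rewrite ler_norml => /andP[h _]; rewrite (dotpC w); lra.
Qed.

Lemma objective_step w :
  (forall u : R, 0 <= u <= 1 -> Theta (theta + (u * al) *: w)) ->
  Jfun M pi theta + al * dotp gradJ w - `|L| * (al ^+ 2 * enorm w ^+ 2) <=
  Jfun M pi (theta + al *: w).
Proof.
move=> seg; have [df lip] := smooth.
have := @segment_smooth R d Theta (Jfun M pi) L theta (al *: w) df lip.
move=> h; have {}h := h (fun u u01 => ltac:(by rewrite scalerA; exact: seg)).
move: h; rewrite -/gradJ enormZ (gtr0_norm al0) exprMn dotpZr.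
by rewrite ler_norml => /andP[h _]; lra.
Qed.

Variables (N : nat) (s : S) (w : seq tr -> 'cV[R]_d) (v e : R).
Hypothesis thP : is_policy (pi theta).
Let Ro Fn := rollout M (pi theta) N s Fn.
Hypothesis seg : forall l, size l = N -> feasible_from M s l ->
  forall u : R, 0 <= u <= 1 -> Theta (theta + (u * al) *: w l).
Hypothesis var_le : Ro (fun l => enorm (w l - ws) ^+ 2) <= v.
Hypothesis bias_le : forall u, `|Ro (fun l => dotp u (w l - ws))| <= enorm u * e.
Hypotheses (v0 : 0 <= v) (e0 : 0 <= e).

Let kJ := 4 * `|G2| / mu.
(* The weight of J lets its ascent absorb the term in |w*|^2 of the cross-entropy
   step. *)
Definition lyapunov (t : 'cV[R]_d) : R := al^-1 * Phi t - kJ * Jfun M pi t.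
Let K3 := g + 2 * `|G2| * al + (4 * `|G2| * al / mu) * (g ^+ 4 / mu + 2 * `|L| * al).

(** Of the gain [mu * enorm ws ^ 2], a quarter pays for the bias by Young's inequality and a quarter
    for the curvature, as [8 * |L| * al <= mu]; half is left. *)
Lemma expected_ascent :
  al * (mu / 2 * enorm ws ^+ 2 - g ^+ 4 / mu * e ^+ 2 - 2 * `|L| * al * v) <=
  Ro (fun l => Jfun M pi (theta + al *: w l)) - Jfun M pi theta.
Proof.
have Fws : F *m ws = gradJ by rewrite /ws mulmxA mulmxV// mul1mx.
have c1 : `|L| * al <= mu / 8 by move: alL; lra.
have step : Ro (fun l => (Jfun M pi theta + al * dotp gradJ ws) + (al * dotp gradJ (w l - ws) +
    - (2 * `|L| * al ^+ 2) * (enorm ws ^+ 2)) + (- (2 * `|L| * al ^+ 2)) * enorm (w l - ws) ^+ 2) <=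
    Ro (fun l => Jfun M pi (theta + al *: w l)).
  apply: (rollout_le thP) => l lN fl; apply: le_trans (objective_step (seg lN fl)).
  have h1 : enorm (w l) ^+ 2 <= 2 * enorm (w l - ws) ^+ 2 + 2 * enorm ws ^+ 2.
    by rewrite -{1}(subrK ws (w l)); exact: sqr_enormD.
  have h2 : 0 <= `|L| * al ^+ 2 by rewrite mulr_ge0 ?sqr_ge0.
  by have := ler_wpM2l h2 h1; rewrite dotpBr; lra.
rewrite lerBrDl; apply: le_trans step; rewrite /Ro !rolloutD !rolloutZ !rollout_cst// -/(Ro _) -/(Ro _).
have b1 := bias_le gradJ.
have coer := coerF ws; rewrite Fws dotpC in coer.
have nJ : enorm gradJ <= g ^+ 2 * enorm ws by rewrite -Fws.
have b2 : - Ro (fun l => dotp gradJ (w l - ws)) <= enorm gradJ * e.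
  by move: b1; rewrite ler_norml lerNl => /andP[].
have b3 : enorm gradJ * e <= g ^+ 2 * enorm ws * e by rewrite ler_wpM2r.
have am : g ^+ 2 * enorm ws * e <= mu / 4 * enorm ws ^+ 2 + g ^+ 4 / mu * e ^+ 2.
  rewrite -subr_ge0.
  have -> : mu / 4 * enorm ws ^+ 2 + g ^+ 4 / mu * e ^+ 2 - g ^+ 2 * enorm ws * e =
    mu^-1 * (mu / 2 * enorm ws - g ^+ 2 * e) ^+ 2 by field; rewrite gt_eqF.
  by rewrite mulr_ge0 ?sqr_ge0// invr_ge0 ltW.
have c2 : `|L| * al * enorm ws ^+ 2 <= mu / 8 * enorm ws ^+ 2 by rewrite ler_wpM2r ?sqr_ge0.
have la : 0 <= 2 * `|L| * al by rewrite !mulr_ge0// ltW.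
have c3 := ler_wpM2l la var_le.
have fin : mu / 2 * enorm ws ^+ 2 - g ^+ 4 / mu * e ^+ 2 - 2 * `|L| * al * v <=
  dotp gradJ ws + Ro (fun l => dotp gradJ (w l - ws)) - 2 * `|L| * al * enorm ws ^+ 2
   - 2 * `|L| * al * Ro (fun l => enorm (w l - ws) ^+ 2) by lra.
have := ler_wpM2l (ltW al0) fin; rewrite expr2; lra.
Qed.

Lemma suboptimality_step (loss : R) : 0 <= loss ->
  compat_loss M pi (occ dstar pistar) ws theta <= loss ->
  (forall s, value M (pi theta) s = step_mean M (pi theta) s (fun z => reward M z.1.1 z.1.2 -
    mean_reward M (pi theta) (pol_stat M (pi theta)) + value M (pi theta) z.2)) ->
  Js - Jfun M pi theta <= lyapunov theta - Ro (fun l => lyapunov (theta + al *: w l)) +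
    Num.sqrt (2 * loss) + K3 * (e + e ^+ 2 + v).
Proof.
move=> loss0 lossP bell.
have [psi psiE] := mean_vector M pistar dstar (score pi theta).
have JE : Jfun M pi theta = mean_reward M (pi theta) (pol_stat M (pi theta)) by exact: avg_rewardE.
have psi_le : enorm psi <= g.
  apply: enorm_dual => [|u]; first exact: le_trans g1.
  rewrite psiE; apply: le_trans (ler_norm _) _.
  apply: (stat_mean_norm M starP (proj1 starS)) => z.
  by apply: le_trans (dotp_norm_le _ _) _; rewrite mulrC ler_wpM2r ?enorm_ge0// sc_le.
(* The gap minus [dotp ws psi] is the mean, under the optimal policy, of the advantage minus its
   compatible approximation; by Jensen its square is at most [2 * loss]. *)
have gap : Js - Jfun M pi theta <= Num.sqrt (2 * loss) + dotp ws psi.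
  rewrite JE (performance_difference (value M (pi theta)) _ starP starS) advantage_stat_mean.
  rewrite psiE -lerBlDr -stat_meanB.
  apply: le_trans (ler_norm _) _.
  rewrite -(ler_pXn2r (n:=2))// ?nnegrE ?sqrtr_ge0// sqr_sqrtr ?mulr_ge0// real_normK ?num_real//.
  apply: le_trans (stat_mean_sqr_le M starP (proj1 starS) _) _.
  have -> : stat_mean M pistar dstar (fun z => (advantage M (pi theta) z.1.1 z.1.2 -
      dotp ws (score pi theta z.1.1 z.1.2)) ^+ 2) =
      2 * compat_loss M pi (occ dstar pistar) ws theta.
    rewrite /compat_loss (esa_stat_mean M _ _ (fun s a => (advantage M (pi theta) s a -
      dotp ws (score pi theta s a)) ^+ 2)) mulrA divff ?mul1r//.
  by rewrite ler_wpM2l.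
have ent : Ro (fun l => Phi (theta + al *: w l)) <= Phi theta - al * dotp ws psi + al * (g * e) +
    `|G2| * (al ^+ 2 * (2 * v + 2 * enorm ws ^+ 2)).
  apply: (@le_trans _ _ (Ro (fun l => (Phi theta - al * dotp ws psi) + ((- al) * dotp psi (w l - ws) +
      `|G2| * al ^+ 2 * (2 * enorm ws ^+ 2)) + (2 * `|G2| * al ^+ 2) * enorm (w l - ws) ^+ 2))).
    apply: (rollout_le thP) => l lN fl; apply: le_trans (cross_entropy_step psiE (seg lN fl)) _.
    have h1 : enorm (w l) ^+ 2 <= 2 * enorm (w l - ws) ^+ 2 + 2 * enorm ws ^+ 2.
      by rewrite -{1}(subrK ws (w l)); exact: sqr_enormD.
    have h2 : 0 <= `|G2| * al ^+ 2 by rewrite mulr_ge0 ?sqr_ge0.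
    by have := ler_wpM2l h2 h1; rewrite dotpBr !(dotpC psi); lra.
  rewrite /Ro !rolloutD !rolloutZ !rollout_cst// -/(Ro _) -/(Ro _).
  have b1 := bias_le psi.
  have b2 : - Ro (fun l => dotp psi (w l - ws)) <= g * e.
    apply: (@le_trans _ _ (enorm psi * e)); last by rewrite ler_wpM2r.
    by move: b1; rewrite ler_norml lerNl => /andP[].
  have b3 := ler_wpM2l (ltW al0) b2.
  have h2 : 0 <= `|G2| * al ^+ 2 by rewrite mulr_ge0 ?sqr_ge0.
  have b4 := ler_wpM2l h2 var_le; lra.
have asc := expected_ascent.
set EJ := Ro (fun l => Jfun M pi (theta + al *: w l)) in asc.
have lyE : Ro (fun l => lyapunov (theta + al *: w l)) =
    al^-1 * Ro (fun l => Phi (theta + al *: w l)) - kJ * EJ.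
  by rewrite /lyapunov /Ro rolloutB !rolloutZ.
rewrite lyE /lyapunov.
have ent' : al^-1 * Ro (fun l => Phi (theta + al *: w l)) <= al^-1 * Phi theta - dotp ws psi + g * e +
    `|G2| * (al * (2 * v + 2 * enorm ws ^+ 2)).
  have ia : 0 <= al^-1 by rewrite invr_ge0 ltW.
  have := ler_wpM2l ia ent; congr (_ <= _); field; rewrite gt_eqF//.
have kJ0 : 0 <= kJ by rewrite /kJ divr_ge0 ?mulr_ge0// ltW.
have asc' := ler_wpM2l kJ0 asc.
(* The choice of [kJ]: the weighted ascent of [J] equals exactly the [enorm ws ^ 2] term of the
   cross-entropy. *)
have kJal : kJ * (al * (mu / 2 * enorm ws ^+ 2)) = 2 * `|G2| * al * enorm ws ^+ 2.
  by rewrite /kJ; field; rewrite gt_eqF.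
have eE : K3 * (e + e ^+ 2 + v) = g * e + 2 * `|G2| * al * v +
   kJ * (al * (g ^+ 4 / mu * e ^+ 2 + 2 * `|L| * al * v)) +
   (2 * `|G2| * al * (e + e ^+ 2) + g * (e ^+ 2 + v) +
    kJ * (al * (g ^+ 4 / mu * (e + v) + 2 * `|L| * al * (e + e ^+ 2)))).
  by rewrite /K3 /kJ; field; rewrite gt_eqF.
have e20 := sqr_ge0 e.
have g0 : 0 <= g by exact: le_trans g1.
have r0 : 0 <= 2 * `|G2| * al * (e + e ^+ 2) + g * (e ^+ 2 + v) +
    kJ * (al * (g ^+ 4 / mu * (e + v) + 2 * `|L| * al * (e + e ^+ 2))).
  have al' := ltW al0; have mu' := ltW mu0.
  have gm : 0 <= g ^+ 4 / mu by rewrite divr_ge0// exprn_ge0.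
  have t1 : 0 <= 2 * `|G2| * al by rewrite !mulr_ge0.
  have t2 : 0 <= 2 * `|L| * al by rewrite !mulr_ge0.
  apply: addr_ge0; [apply: addr_ge0|apply: mulr_ge0 => //; apply: mulr_ge0 => //; apply: addr_ge0].
  - by apply: mulr_ge0 => //; exact: addr_ge0.
  - by apply: mulr_ge0 => //; exact: addr_ge0.
  - by apply: mulr_ge0 => //; exact: addr_ge0.
  - by apply: mulr_ge0 => //; exact: addr_ge0.
rewrite eE; move: gap ent' asc' kJal r0; lra.
Qed.

End EpochInequality.

(** * The whole run *)

Definition ffun_nil (T : Type) : {ffun 'I_0 -> T} := [ffun i : 'I_0 => False_rect T (notF (ltn_ord i))].

Section Adaptive.
Variables (R : realType) (S A : finType) (M : mdp R S A).
Notation tr := (transition S A).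

(** The analogue of [rollout] for a policy that depends on the history [z]. *)
Fixpoint adaptive (pol : seq tr -> S -> A -> R) n (z : seq tr) (s : S) (F : seq tr -> R) : R :=
  if n is n'.+1 then
    step_mean M (pol z) s (fun t => adaptive pol n' (rcons z t) t.2 F)
  else F z.

Lemma adaptive_rollout pol p n r z s F :
  (forall l, (size l < n)%N -> pol (z ++ l) = p) ->
  adaptive pol (n + r) z s F =
  rollout M p n s (fun l => adaptive pol r (z ++ l) (end_state s l) F).
Proof.
elim: n z s => [|n IH] z s h; first by rewrite /= cats0.
rewrite addSn /=; have -> : pol z = p by rewrite -[z]cats0; exact: h.
apply: eq_step_mean => a s'; rewrite IH.
  by congr rollout; apply: funext => l; rewrite cat_rcons.
by move=> l hl; rewrite cat_rcons; apply: h.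
Qed.

Lemma transitions_fcons n s0 (x : {ffun 'I_n.+1 -> S}) a0 (a : {ffun 'I_n -> A}) :
  transitions (fcons s0 x) (fcons a0 a) = (s0, a0, x ord0) :: transitions x a.
Proof.
rewrite /transitions enum_ordSl /= /cur_state /next_state fcons_widen0 fcons0 fconsS.
congr cons; rewrite -map_comp; apply: eq_map => i /=.
by rewrite fcons_widen !fconsS.
Qed.

Lemma size_transitions n (x : {ffun 'I_n.+1 -> S}) (a : {ffun 'I_n -> A}) :
  size (transitions x a) = n.
Proof. by rewrite size_map size_enum_ord. Qed.

(** With an arbitrary history [z], the first transition of the path can be moved into [z], and
    induction applies to the rest. *)
Lemma path_sum_adaptive pol n z s F :
  \sum_(x : {ffun 'I_n.+1 -> S}) \sum_(a : {ffun 'I_n -> A})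
    (x ord0 == s)%:R *
    \prod_(t < n) (pol (z ++ take t (transitions x a)) (cur_state x t) (a t) *
       kernel M (cur_state x t) (a t) (next_state x t)) * F (z ++ transitions x a) =
  adaptive pol n z s F.
Proof.
elim: n z s => [|n IH] z s /=.
  rewrite big_ffun_cons (bigD1 s)//= [X in _ + X]big1 ?addr0.
    rewrite (big_ffun0 _ [ffun _ => s]) (big_ffun0 _ (ffun_nil A)).
    rewrite fcons0 eqxx big_ord0 !mul1r.
    by rewrite /transitions enum_ord0 /= cats0.
  move=> u us; rewrite big1// => y _; rewrite big1// => a _.
  by rewrite fcons0 (negPf us) !mul0r.
rewrite big_ffun_cons (bigD1 s)//= [X in _ + X]big1 ?addr0; last first.
  move=> u us; rewrite big1// => y _; rewrite big1// => a _.
  by rewrite fcons0 (negPf us) !mul0r.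
under eq_bigr do rewrite big_ffun_cons.
rewrite exchange_big/=; apply: eq_bigr => a0 _.
under [RHS]eq_bigr do rewrite -IH mulr_sumr.
rewrite [RHS]exchange_big/=; apply: eq_bigr => y _.
under [RHS]eq_bigr do rewrite mulr_sumr.
rewrite [RHS]exchange_big/=; apply: eq_bigr => a _.
rewrite (bigD1 (y ord0))//= [X in _ = _ + X]big1 ?addr0; last first.
  by move=> u uy; rewrite eq_sym (negPf uy) !mul0r mulr0.
rewrite fcons0 !eqxx !mul1r transitions_fcons big_ord_recl /= cats0.
rewrite /cur_state /next_state fcons_widen0 fconsS fcons0 -!mulrA cat_rcons.
congr (_ * (_ * (_ * _))); apply: eq_bigr => t _.
by rewrite !fconsS fcons_widen cat_rcons.
Qed.

(** [updates_stay] speaks of complete runs of length [T]; a history ending earlier must first be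
    prolonged to one. *)
Lemma feasible_extend (p : S -> A -> R) n s : is_policy p ->
  exists l, size l = n /\ feasible_from M s l.
Proof.
move=> pP; elim: n s => [|n IH] s; first by exists [::].
have [a _] : exists a : A, True.
  apply: contrapT => h; have := policy_sum1 pP s; rewrite big1 => [/esym/eqP|a _].
    by rewrite oner_eq0.
  by case: h; exists a.
have [s' ks] : exists s', 0 < kernel M s a s'.
  apply: contrapT => h; have := kernel_sum1 M s a; rewrite big1 => [/esym/eqP|s' _].
    by rewrite oner_eq0.
  apply/eqP; rewrite eq_le kernel_ge0 andbT leNgt; apply/negP => ks; apply: h.
  by exists s'.
have [l [ln fl]] := IH s'; exists ((s, a, s') :: l); split => /=; first by rewrite ln.
by rewrite eqxx ks.
Qed.

Lemma feasible_path n l s : size l = n -> feasible_from M s l ->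
  exists (x : {ffun 'I_n.+1 -> S}) (a : {ffun 'I_n -> A}),
    [/\ transitions x a = l, x ord0 = s &
      forall t, 0 < kernel M (cur_state x t) (a t) (next_state x t)].
Proof.
elim: n l s => [|n IH] [|[[s0 a0] s1] l] s //=.
  move=> _ _; exists [ffun _ => s], (ffun_nil A); split; last by case.
    by rewrite /transitions enum_ord0.
  by rewrite ffunE.
move=> [ln] /and3P[/eqP <- k /(IH _ _ ln)[x [a [tl x0 h]]]].
exists (fcons s0 x), (fcons a0 a); split.
- by rewrite transitions_fcons tl x0.
- by rewrite fcons0.
- move=> t; case: (unliftP ord0 t) => [i|] ->.
    by rewrite /cur_state /next_state fcons_widen !fconsS; exact: h.
  by rewrite /cur_state /next_state fcons_widen0 fcons0 fconsS x0.
Qed.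

End Adaptive.

(** * Epochs of a run *)

Section Run.
Variables (R : realType) (S A : finType) (M : mdp R S A) (d m : nat).
Notation tr := (transition S A).
Variables (Theta : set 'cV[R]_d) (pi : 'cV[R]_d -> S -> A -> R) (phi : S -> 'cV[R]_m).
Variables (p : nac_steps R) (i0 : nac_init R d m) (H B : nat).
Let N := (2 * H * B)%N.
Hypotheses (H0 : (0 < H)%N) (B0 : (0 < B)%N).
Notation theta_ z k := (nac_theta M pi phi p i0 H B z k).

Lemma N_gt0 : (0 < N)%N. Proof. by rewrite /N !muln_gt0 H0 B0. Qed.

Lemma nac_dir_prefix l1 l2 k th : (N * k.+1 <= size l1)%N ->
  nac_dir M pi phi p i0 H B (l1 ++ l2) k th = nac_dir M pi phi p i0 H B l1 k th.
Proof.
move=> h; have hs : ((2 * H * k + H + H) * B <= size l1)%N.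
  by rewrite (leq_trans _ h)// /N; apply: eq_leq; ring.
rewrite /nac_dir npg_iter_prefix// critic_iter_prefix//.
by rewrite (leq_trans _ hs)// leq_mul2r leq_addr orbT.
Qed.

Lemma nac_theta_prefix l1 l2 k : (N * k <= size l1)%N -> theta_ (l1 ++ l2) k = theta_ l1 k.
Proof.
elim: k => //= k IH h; have h' : (N * k <= size l1)%N.
  by rewrite (leq_trans _ h)// leq_mul2l leqnSn orbT.
by rewrite IH// nac_dir_prefix.
Qed.

Lemma nac_dir_epoch l1 l2 k th : size l1 = (N * k)%N ->
  nac_dir M pi phi p i0 H B (l1 ++ l2) k th =
  epoch_dir M pi phi p H B th (xi0 i0 k) (omega0 i0 k) l2.
Proof.
move=> h; have hs : size l1 = (2 * H * k * B)%N by rewrite h /N; ring.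
by rewrite /nac_dir npg_iter_shift// critic_iter_shift.
Qed.

Lemma nac_theta_epoch l1 l2 k : size l1 = (N * k)%N ->
  theta_ (l1 ++ l2) k.+1 = theta_ l1 k +
    alpha p *: epoch_dir M pi phi p H B (theta_ l1 k) (xi0 i0 k) (omega0 i0 k) l2.
Proof.
by move=> h /=; rewrite nac_theta_prefix ?h// nac_dir_epoch.
Qed.

Definition history_policy (z : seq tr) : S -> A -> R := pi (theta_ z (size z %/ N)).

(** [run_prob] computes the policies from the whole trajectory, but the parameter in force at step
    [t] depends only on the transitions before [t], so it agrees with [history_policy]. *)
Lemma run_expectation T (F : seq tr -> R) :
  \sum_(x : {ffun 'I_T.+1 -> S}) \sum_(a : {ffun 'I_T -> A})
    run_prob M pi phi p i0 H B x a * F (transitions x a) =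
  \sum_s init M s * adaptive M history_policy T [::] s F.
Proof.
under [RHS]eq_bigr do rewrite -path_sum_adaptive mulr_sumr.
rewrite [RHS]exchange_big/=; apply: eq_bigr => x _.
under [RHS]eq_bigr do rewrite mulr_sumr.
rewrite [RHS]exchange_big/=; apply: eq_bigr => a _.
rewrite (bigD1 (x ord0))//= [X in _ = _ + X]big1 ?addr0; last first.
  by move=> s sx; rewrite eq_sym (negPf sx) !mul0r mulr0.
rewrite eqxx mul1r /run_prob mulrA; congr (_ * _ * _); apply: eq_bigr => t _.
congr (_ * _); rewrite /history_policy size_take size_transitions ltn_ord.
rewrite -{1}(cat_take_drop t (transitions x a)) nac_theta_prefix//.
by rewrite size_take size_transitions ltn_ord mulnC leq_trunc_div.
Qed.

Variables (K : nat).
Let T := (K * N)%N.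
Variable (cap : R).
Hypothesis stay : updates_stay M Theta pi phi i0 cap K H B T.
Hypothesis adm : admissible_steps cap p.
Hypothesis pol : policy_class Theta pi.

Lemma updates_in_Theta s0 z l k (u : R) : 0 < init M s0 -> (k < K)%N ->
  size z = (N * k)%N -> size l = N -> feasible_from M s0 (z ++ l) ->
  Theta (theta_ z k) -> 0 <= u <= 1 ->
  Theta (theta_ z k + (u * alpha p) *:
    epoch_dir M pi phi p H B (theta_ z k) (xi0 i0 k) (omega0 i0 k) l).
Proof.
move=> i0p kK zk lN fl Tz u01.
have [_ /(_ _ Tz)[pP _ _]] := pol.
have [l' [ls fl']] := feasible_extend M (T - N * k.+1) (end_state s0 (z ++ l)) pP.
have fZ : feasible_from M s0 (z ++ (l ++ l')) by rewrite catA feasible_from_cat fl.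
have sZ : size (z ++ (l ++ l')) = T.
  rewrite !size_cat zk lN ls addnA -mulnSr subnKC// /T mulnC leq_mul2r.
  by rewrite kK orbT.
have [x [a [tx x0 h]]] := feasible_path sZ fZ.
have fe : feasible M x a by split; [rewrite x0|exact: h].
have := stay adm fe kK u01; rewrite /= tx.
rewrite nac_theta_prefix ?zk// nac_dir_epoch// -(nac_dir_epoch _ _ zk) catA nac_dir_prefix.
  by rewrite nac_dir_epoch.
by rewrite size_cat zk lN mulnSr.
Qed.

Variables (Js c k0 : R) (lya : 'cV[R]_d -> R).
Hypothesis lya_ge : forall th, Theta th -> 0 <= lya th + k0.
Hypothesis epoch_step : forall k th s, Theta th ->
  (forall l, size l = N -> feasible_from M s l -> forall u : R, 0 <= u <= 1 ->
    Theta (th + (u * alpha p) *: epoch_dir M pi phi p H B th (xi0 i0 k) (omega0 i0 k) l)) ->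
  rollout M (pi th) N s (fun l => \sum_(z <- l) (Js - reward M z.1.1 z.1.2) +
    N%:R * lya (th + alpha p *: epoch_dir M pi phi p H B th (xi0 i0 k) (omega0 i0 k) l)) <=
  N%:R * lya th + c.

(** Induction on the number [j] of remaining epochs with potential [N * (lya + k0)]; the potential
    left at the end is dropped, being nonnegative. *)
Lemma adaptive_telescope j s0 z k : 0 < init M s0 -> (k + j)%N = K ->
  size z = (N * k)%N -> feasible_from M s0 z -> Theta (theta_ z k) ->
  adaptive M history_policy (j * N) z (end_state s0 z)
    (fun Z => \sum_(t <- Z) (Js - reward M t.1.1 t.1.2)) <=
  \sum_(t <- z) (Js - reward M t.1.1 t.1.2) + N%:R * (lya (theta_ z k) + k0) + j%:R * c.
Proof.
move=> i0p; elim: j z k => [|j IH] z k kj zk fz Tz.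
  by rewrite /= mul0r addr0 lerDl mulr_ge0// lya_ge.
have kK : (k < K)%N by rewrite -kj addnS ltnS leq_addr.
have [_ /(_ _ Tz)[pP _ _]] := pol.
rewrite mulSn (@adaptive_rollout _ _ _ M _ (pi (theta_ z k))); last first.
  move=> l hl; rewrite /history_policy size_cat zk mulnC divnMDl ?N_gt0//.
  by rewrite divn_small// addn0 nac_theta_prefix ?zk.
pose th' l := theta_ z k + alpha p *: epoch_dir M pi phi p H B (theta_ z k) (xi0 i0 k) (omega0 i0 k) l.
have seg l : size l = N -> feasible_from M (end_state s0 z) l -> forall u : R, 0 <= u <= 1 ->
    Theta (theta_ z k + (u * alpha p) *:
      epoch_dir M pi phi p H B (theta_ z k) (xi0 i0 k) (omega0 i0 k) l).
  move=> lN fl u u01; apply: (updates_in_Theta i0p kK zk lN _ Tz u01).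
  by rewrite feasible_from_cat fz.
apply: (@le_trans _ _ (rollout M (pi (theta_ z k)) N (end_state s0 z) (fun l =>
    (\sum_(t <- l) (Js - reward M t.1.1 t.1.2) + N%:R * lya (th' l)) +
    (\sum_(t <- z) (Js - reward M t.1.1 t.1.2) + N%:R * k0 + j%:R * c)))).
  apply: (rollout_le pP) => l lN fl.
  have th'E : theta_ (z ++ l) k.+1 = th' l by exact: nac_theta_epoch.
  have := IH (z ++ l) k.+1; rewrite end_state_cat th'E big_cat /= => h.
  apply: le_trans (h _ _ _ _) _; last by lra.
  - by rewrite addSnnS.
  - by rewrite size_cat zk lN mulnSr.
  - by rewrite feasible_from_cat fz.
  - by have := seg l lN fl 1; rewrite mul1r lexx ler01; apply.
rewrite rolloutD rollout_cst//.
have := epoch_step (k := k) Tz seg; rewrite -natr1; lra.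
Qed.

Lemma run_bound : Theta (theta0 i0) ->
  \sum_(x : {ffun 'I_T.+1 -> S}) \sum_(a : {ffun 'I_T -> A})
    run_prob M pi phi p i0 H B x a *
    \sum_(t <- transitions x a) (Js - reward M t.1.1 t.1.2) <=
  N%:R * (lya (theta0 i0) + k0) + K%:R * c.
Proof.
move=> T0; rewrite (run_expectation T (fun Z => \sum_(t <- Z) (Js - reward M t.1.1 t.1.2))).
have [i_ge0 i1] := init_dist M.
rewrite -[leRHS]mul1r -{1}i1 mulr_suml; apply: ler_sum => s _.
have [->|is0] := eqVneq (init M s) 0; first by rewrite !mul0r.
rewrite ler_wpM2l//.
have ip : 0 < init M s by rewrite lt_neqAle eq_sym is0 i_ge0.
have := @adaptive_telescope K s [::] 0 ip; rewrite add0n muln0 big_nil add0r.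
move=> /(_ erefl erefl isT T0) h; exact: h.
Qed.
End Run.

(** The constant [K3] of [suboptimality_step]. *)
Definition ascent_const (R : realType) (G2 L mu g al : R) : R :=
  g + 2 * `|G2| * al + (4 * `|G2| * al / mu) * (g ^+ 4 / mu + 2 * `|L| * al).

Lemma sum_recenter (R : realType) (T : Type) (l : seq T) (f : T -> R) a b :
  \sum_(z <- l) (a - f z) = (size l)%:R * (a - b) - \sum_(z <- l) (f z - b).
Proof.
elim: l => [|z l IH]; first by rewrite !big_nil mul0r subr0.
by rewrite !big_cons IH /= -natr1; ring.
Qed.

Section Epoch.
Variables (R : realType) (S A : finType) (M : mdp R S A) (d m : nat).
Notation tr := (transition S A).
Variables (Theta : set 'cV[R]_d) (pi : 'cV[R]_d -> S -> A -> R) (phi : S -> 'cV[R]_m).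
Variables (pistar : S -> A -> R) (dstar : S -> R) (G2 L mu lambda g R0 K1 : R).
Variables (p : nac_steps R) (H B : nat) (ct ch : R).
Hypothesis pol : policy_class Theta pi.
Hypothesis starP : is_policy pistar.
Hypothesis starS : is_stationary (pol_chain M pistar) dstar.
Hypothesis uni : forall theta, Theta theta -> unichain (pol_chain M (pi theta)).
Hypothesis phi1 : forall s, enorm (phi s) <= 1.
Hypothesis coer : forall theta x, Theta theta -> in_ker_orth (critic_mx M (pi theta) phi) x ->
  lambda * enorm x ^+ 2 <= dotp x (critic_mx M (pi theta) phi *m x).
Hypothesis sc_le : forall theta s a, Theta theta -> enorm (score pi theta s a) <= g.
Hypothesis sc_lip : forall t1 t2 s a, Theta t1 -> Theta t2 ->
  enorm (score pi t1 s a - score pi t2 s a) <= G2 * enorm (t1 - t2).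
Hypothesis fish : forall theta, Theta theta -> psd (fisher M pi theta - mu%:M).
Hypothesis smooth : smooth_on Theta (Jfun M pi) L.
Hypotheses (mu0 : 0 < mu) (g1 : 1 <= g) (K10 : 0 <= K1).
Hypothesis spec : epoch_dir_spec m d lambda mu g R0 p K1.
Hypotheses (H0 : (0 < H)%N) (B0 : (0 < B)%N).
Hypotheses (al0 : 0 < alpha p) (alL : 8 * `|L| * alpha p <= mu).
Hypotheses (ct0 : 0 <= ct) (ch0 : 0 <= ch).
Hypothesis ctP : forall theta, Theta theta -> (ctar_chain (pol_chain M (pi theta)) <= ct%:E)%E.
Hypothesis chP : forall theta, Theta theta -> (chit_chain (pol_chain M (pi theta)) <= ch%:E)%E.
Let Cb := 2 * (ct + ch).
Hypothesis small1 : 4 * (3 * (m%:R + 2)) * batch_err Cb B * H%:R <= 1.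
Hypothesis small2 : batch_err Cb B * (2 * (d%:R + 2) * (1 + g ^+ 2) ^+ 2) <= gamma p * mu / 2.
Let err := H%:R ^+ 2 * epoch_err lambda mu Cb p H B.
Hypothesis err0 : 0 <= err.
Variables (eb ea : R).
Hypotheses (eb0 : 0 <= eb) (ea0 : 0 <= ea).
Hypothesis ebP : forall theta, Theta theta ->
  compat_loss M pi (occ dstar pistar) (npg M pi theta) theta <= eb.
Hypothesis eaP : forall theta, Theta theta -> exists zeta,
  value_loss M pi theta phi (value M (pi theta)) zeta <= ea.
Let N := (2 * H * B)%N.
Let Js := mean_reward M pistar dstar.
Let lya := lyapunov M pi pistar dstar G2 mu (alpha p).
Let e := K1 * (err + Num.sqrt ea).
Let v := K1 * (err + ea).

Lemma fisher_coercive theta u : Theta theta ->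
  mu * enorm u ^+ 2 <= dotp u (fisher M pi theta *m u).
Proof.
move=> Tt; have [_ /(_ u)] := fish Tt.
by rewrite mulmxBl dotpBr mul_scalar_mx dotpZr -enorm_sqr subr_ge0.
Qed.

(** [Js'] stands for [Jstar], the supremum over the class, which may be smaller than the mean reward
    of [pistar]. *)
Lemma epoch_suboptimality Js' theta s x0 w0 : Js' <= Js -> Theta theta ->
  enorm x0 <= R0 -> enorm w0 <= R0 ->
  (forall l, size l = N -> feasible_from M s l -> forall u : R, 0 <= u <= 1 ->
    Theta (theta + (u * alpha p) *: epoch_dir M pi phi p H B theta x0 w0 l)) ->
  rollout M (pi theta) N s (fun l => \sum_(z <- l) (Js' - reward M z.1.1 z.1.2) +
    N%:R * lya (theta + alpha p *: epoch_dir M pi phi p H B theta x0 w0 l)) <=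
  N%:R * lya theta +
    (N%:R * (Num.sqrt (2 * eb) + ascent_const G2 L mu g (alpha p) * (e + e ^+ 2 + v)) + 2 * Cb).
Proof.
move=> JsP Tt x0P w0P seg.
have [_ /(_ _ Tt)[thP _ _]] := pol.
have mix := unichain_mixing thP (uni Tt) (ctP Tt) (chP Tt) ct0 ch0.
have bell := value_bellman thP (uni Tt) (ctP Tt) (chP Tt) ct0 ch0.
have coerF u := fisher_coercive u Tt.
have Fu := fisher_unit mu0 coerF.
have scT s' a : enorm (score pi theta s' a) <= g by exact: sc_le.
have F_le := enorm_fisher mix g1 scT.
have stat t : Theta t -> is_stationary (pol_chain M (pi t)) (pol_stat M (pi t)).
  by move=> Tt'; have [_ /(_ _ Tt')[tP _ _]] := pol; exact: (pol_stat_stationary tP (uni Tt')).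
have gJE u := policy_gradient pol Tt mix stat bell u (proj1 smooth _ Tt).
have [zeta zP] := eaP Tt.
have NE : (H * B + H * B)%N = N by rewrite /N; ring.
have [] := spec mix phi1 scT coerF (score_stat_mean M pol Tt)
  (fun x => @coer theta x Tt) bell gJE B0 H0 x0P w0P small1 small2 s zeta.
rewrite NE -/err => var_le bias_le.
have loss0 : 0 <= value_loss M pi theta phi (value M (pi theta)) zeta.
  rewrite /value_loss mulr_ge0// sumr_ge0// => s' _; rewrite mulr_ge0 ?sqr_ge0//.
  by have [[]] := stat _ Tt.
have var_le' : rollout M (pi theta) N s (fun l => enorm (epoch_dir M pi phi p H B theta x0 w0 l -
    invmx (fisher M pi theta) *m grad (Jfun M pi) theta) ^+ 2) <= v.
  by apply: le_trans var_le _; rewrite ler_wpM2l// lerD2l.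
have bias_le' u : `|rollout M (pi theta) N s (fun l => dotp u (epoch_dir M pi phi p H B theta x0 w0 l -
    invmx (fisher M pi theta) *m grad (Jfun M pi) theta))| <= enorm u * e.
  apply: le_trans (bias_le u) _; rewrite ler_wpM2l ?enorm_ge0// ler_wpM2l// lerD2l.
  by rewrite ler_wsqrtr.
have v0 : 0 <= v by apply: mulr_ge0 => //; exact: addr_ge0.
have e0 : 0 <= e by apply: mulr_ge0 => //; apply: addr_ge0 => //; exact: sqrtr_ge0.
have loss_le : compat_loss M pi (occ dstar pistar)
    (invmx (fisher M pi theta) *m grad (Jfun M pi) theta) theta <= eb.
  by have := ebP Tt; rewrite /npg moore_penrose_unit.
have main := suboptimality_step pol starP starS sc_le sc_lip smooth mu0 g1 Tt Fu coerF F_le al0 alL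
  thP seg var_le' bias_le' v0 e0 eb0 loss_le bell.
have r1 (z : tr) : `|reward M z.1.1 z.1.2| <= 1.
  by have /andP[r0 r1] := reward_ge0_le1 M z.1.1 z.1.2; rewrite ger0_norm.
have [_ _ _ poisson] := mix.
have dev := rollout_dev_mean thP poisson r1 N s.
have JE : Jfun M pi theta = mean_reward M (pi theta) (pol_stat M (pi theta)) by exact: avg_rewardE.
set w := epoch_dir M pi phi p H B theta x0 w0 in main *.
apply: (@le_trans _ _ (rollout M (pi theta) N s (fun l => N%:R * (Js' - Jfun M pi theta) +
    (-1 * \sum_(z <- l) (reward M z.1.1 z.1.2 -
      stat_mean M (pi theta) (pol_stat M (pi theta)) (fun z : tr => reward M z.1.1 z.1.2)) +
    N%:R * lya (theta + alpha p *: w l))))).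
  apply: (rollout_le thP) => l lN _.
  by rewrite addrA lerD2r (sum_recenter _ _ _ (Jfun M pi theta)) lN mulN1r JE.
rewrite !rolloutD !rolloutZ rollout_cst//.
have dev' := ler_normlW dev; rewrite mulr1 in dev'.
have gap : Js' - Jfun M pi theta <= Js - Jfun M pi theta by rewrite lerD2r.
have := ler_wpM2l (ler0n R N) (le_trans gap main).
rewrite -/lya -/(ascent_const _ _ _ _ _).
have : - rollout M (pi theta) N s (fun l => \sum_(z <- l) (reward M z.1.1 z.1.2 -
      stat_mean M (pi theta) (pol_stat M (pi theta)) (fun z : tr => reward M z.1.1 z.1.2))) <= 2 * Cb.
  by move: dev; rewrite ler_norml mulr1 lerNl => /andP[].
move: (rollout _ _ _ _ _) => X; move: (rollout _ _ _ _ _) => Y.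
move: (ascent_const _ _ _ _ _ * _) (Num.sqrt (2 * eb)) (lya theta) (Jfun M pi theta) => a b c0 j.
lra.
Qed.
End Epoch.

Lemma chit_chain_ge0 (R : realType) (S : finType) (P : S -> S -> R) :
  (forall s, is_dist (P s)) -> unichain P -> (0 <= chit_chain P)%E.
Proof.
move=> Pd uni; have [hR [_ [hRP _]]] := exists_hit Pd uni.
have [[s0 _] _] := uni; have [_ _ /(_ s0) h0] := hRP.
rewrite leNgt; apply/negP => neg.
have [ch ch0 chP] : exists2 ch : R, ch < 0 & (chit_chain P <= ch%:E)%E.
  case: (chit_chain P) neg => [r| |] //; first by rewrite lte_fin; exists r.
  by exists (-1); rewrite ?ltrN10// leNye.
by have := hR_le Pd chP hRP s0; rewrite leNgt (lt_le_trans ch0).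
Qed.

(** * Expected regret from an epoch inequality *)

Section Regret.
Variables (R : realType) (S A : finType) (M : mdp R S A) (d m : nat).
Notation tr := (transition S A).
Variables (Theta : set 'cV[R]_d) (pi : 'cV[R]_d -> S -> A -> R) (phi : S -> 'cV[R]_m).
Variables (i0 : nac_init R d m) (pistar : S -> A -> R) (dstar : S -> R).
Variables (p : nac_steps R) (cap : R) (K H B T : nat).
Hypothesis pol : policy_class Theta pi.
Hypothesis T0 : Theta (theta0 i0).
Hypothesis opt : optimal_policy M Theta pi pistar dstar.
Hypothesis uni : forall theta, Theta theta -> unichain (pol_chain M (pi theta)).
Hypotheses (H0 : (0 < H)%N) (B0 : (0 < B)%N) (TE : T = (2 * K * H * B)%N).
Hypothesis stay : updates_stay M Theta pi phi i0 cap K H B T.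
Hypothesis adm : admissible_steps cap p.
Let N := (2 * H * B)%N.

Lemma Jfun_bounds theta : Theta theta -> 0 <= Jfun M pi theta <= 1.
Proof.
move=> Tt; have [_ /(_ _ Tt)[thP _ _]] := pol.
have [dP _] := pol_stat_stationary thP (uni Tt).
by rewrite /Jfun avg_rewardE; exact: mean_reward_ge0_le1.
Qed.

Lemma Jstar_le : Jstar M Theta pi <= mean_reward M pistar dstar.
Proof.
have [_ _ best] := opt; apply: ge_sup; first by exists (Jfun M pi (theta0 i0)), (theta0 i0).
move=> _ [theta Tt <-]; apply: le_trans (best _ Tt) _.
by rewrite (esa_stat_mean M _ _ (reward M)).
Qed.

Lemma Jstar_le1 : Jstar M Theta pi <= 1.
Proof.
have [starP [dP _] _] := opt; apply: le_trans Jstar_le _.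
by have /andP[] := mean_reward_ge0_le1 M starP dP.
Qed.

Lemma expected_regret_le c k0 (lya : 'cV[R]_d -> R) :
  (forall th, Theta th -> 0 <= lya th + k0) ->
  (forall k th s, Theta th ->
    (forall l, size l = N -> feasible_from M s l -> forall u : R, 0 <= u <= 1 ->
      Theta (th + (u * alpha p) *: epoch_dir M pi phi p H B th (xi0 i0 k) (omega0 i0 k) l)) ->
    rollout M (pi th) N s (fun l => \sum_(z <- l) (Jstar M Theta pi - reward M z.1.1 z.1.2) +
      N%:R * lya (th + alpha p *: epoch_dir M pi phi p H B th (xi0 i0 k) (omega0 i0 k) l)) <=
    N%:R * lya th + c) ->
  expected_regret M Theta pi phi p i0 H B T <= N%:R * (lya (theta0 i0) + k0) + K%:R * c.
Proof.
move=> lya_ge step; have TE' : T = (K * (2 * H * B))%N by rewrite TE; ring.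
move: stay; rewrite {}TE' => stay'.
apply: le_trans (run_bound H0 B0 stay' adm pol lya_ge step T0).
rewrite /expected_regret; apply: ler_sum => x _; apply: ler_sum => a _.
by rewrite /transitions big_map big_enum.
Qed.

(** The same telescoping with the zero potential. *)
Lemma expected_regret_le_horizon : expected_regret M Theta pi phi p i0 H B T <= T%:R.
Proof.
have := @expected_regret_le N%:R 0 (fun=> 0).
have NK : (K * N)%N = T by rewrite TE /N; ring.
rewrite /= addr0 mulr0 !add0r -natrM NK => h; apply: h => // k th s Tt _.
have [_ /(_ _ Tt)[thP _ _]] := pol.
rewrite -[leRHS](rollout_cst M thP N s); apply: (rollout_le thP) => l lN _.
rewrite addr0 -lN -sum1_size natr_sum; apply: ler_sum => z _.
have /andP[r0 _] := reward_ge0_le1 M z.1.1 z.1.2.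
by have := Jstar_le1; lra.
Qed.

End Regret.

(** * Rates *)

Lemma one_sub_pow_le (R : realType) (a : R) n : a <= 1 -> (1 - a) ^+ n <= expR (- (a * n%:R)).
Proof.
move=> a1; rewrite mulrC -mulrN expRM_natl lerXn2r ?nnegrE ?expR_ge0 ?subr_ge0//.
exact: expR_ge1Dx.
Qed.

(** [192 = 12 * 4 ^ 2], since [1 + 2 * C <= 4 * C]. *)
Lemma batch_err_le (R : realType) (C b1 t : R) B : 0 < b1 -> 0 < t -> b1 * t <= B%:R ->
  1 <= 2 * C -> batch_err (2 * C) B <= 192 / b1 * (C ^+ 2 / t).
Proof.
move=> b10 t0 tB C1.
have bt : 0 < b1 * t by exact: mulr_gt0.
have -> : 192 / b1 * (C ^+ 2 / t) = 12 * (4 * C) ^+ 2 / (b1 * t).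
  by field; rewrite !gt_eqF.
apply: ler_pM.
- by rewrite mulr_ge0// sqr_ge0.
- by rewrite invr_ge0.
- by rewrite ler_wpM2l// lerXn2r ?nnegrE//; lra.
- by rewrite lef_pV2 ?posrE// (lt_le_trans bt).
Qed.

(** [h0] makes both contraction exponents at least [l = ln T], so both powers are of order [1 / T];
    the exponent [H.-1] costs the factor [expR 1]. *)
Lemma epoch_err_le (R : realType) (lambda mu C b1 h0 l t : R) (p : nac_steps R) H B :
  0 < b1 -> 1 <= t -> 0 <= l -> expR (- l) = (t ^+ 2)^-1 -> b1 * t <= B%:R ->
  (0 < H)%N -> h0 * l <= H%:R -> 1 <= 2 * C ->
  0 <= beta p * lambda / 2 <= 1 -> 0 <= gamma p * mu / 2 <= 1 ->
  1 <= beta p * lambda / 2 * h0 -> 1 <= gamma p * mu / 2 * h0 ->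
  epoch_err lambda mu (2 * C) p H B <= (4 * (expR 1 + 1) + 192 / b1) * (C ^+ 2 / t).
Proof.
move=> b10 t1 l0 lt tB H0 lH C1 /andP[a0 a1] /andP[g0 g1] ah gh.
have t0 : 0 < t by exact: lt_le_trans t1.
have be := batch_err_le b10 t0 tB C1.
have inv_le : (t ^+ 2)^-1 <= 4 * (C ^+ 2 / t).
  have c1 : 1 <= 4 * C ^+ 2.
    have -> : 4 * C ^+ 2 = (2 * C) ^+ 2 by ring.
    by rewrite -(expr1n _ 2) lerXn2r ?nnegrE//; lra.
  apply: (@le_trans _ _ t^-1).
    by rewrite lef_pV2 ?posrE ?exprn_gt0// expr2 ler_peMl// ltW.
  by rewrite mulrA -[leLHS]mul1r ler_wpM2r// invr_ge0 ltW.
have q1 : (1 - beta p * lambda / 2) ^+ H.-1 <= expR 1 * (t ^+ 2)^-1.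
  apply: le_trans (one_sub_pow_le _ a1) _; rewrite -lt -expRD ler_expR.
  have -> : H.-1%:R = H%:R - 1 :> R by rewrite -{2}(prednK H0) -natr1 addrK.
  have := ler_wpM2l a0 lH; have := ler_wpM2r l0 ah; move: a1.
  move: (beta p * lambda / 2) => a ? ? ?; lra.
have q2 : (1 - gamma p * mu / 2) ^+ H <= (t ^+ 2)^-1.
  apply: le_trans (one_sub_pow_le _ g1) _; rewrite -lt ler_expR.
  by have := ler_wpM2l g0 lH; have := ler_wpM2r l0 gh; move: (gamma p * mu / 2) => a; lra.
rewrite /epoch_err; have := expR_ge0 (1 : R) => e1.
have := ler_wpM2l e1 inv_le; lra.
Qed.

(** With [err] and [Num.sqrt ea] at most 1, the squares are dominated by first powers. The slack
    [1 / t ^ 2] added to [ea] costs [1 / t] under the root. *)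
Lemma dynamics_error_le (R : realType) (K1 t err ea e v : R) :
  0 <= K1 -> 1 <= t -> 0 <= err -> err <= 1 -> 0 <= ea -> Num.sqrt ea <= 1 ->
  e = K1 * (err + Num.sqrt (ea + (t ^+ 2)^-1)) -> v = K1 * (err + (ea + (t ^+ 2)^-1)) ->
  e + e ^+ 2 + v <= (2 * K1 + 3 * K1 ^+ 2) * (err + Num.sqrt ea + t^-1).
Proof.
move=> K10 t1 err0 err1 ea0 sa1 eE vE; have t0 : 0 < t by exact: lt_le_trans t1.
set X := err + _ + _; have sa0 := sqrtr_ge0 ea.
have it0 : 0 < t^-1 by rewrite invr_gt0.
have it1 : t^-1 <= 1 by rewrite invf_le1.
have it2 : t^-1 ^+ 2 <= t^-1 by rewrite expr2 ler_piMl// ltW.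
have sqE : ea = Num.sqrt ea ^+ 2 by rewrite sqr_sqrtr.
have sa2 : Num.sqrt ea ^+ 2 <= Num.sqrt ea by rewrite expr2 ler_piMl.
have sq : Num.sqrt (ea + (t ^+ 2)^-1) <= Num.sqrt ea + t^-1.
  have X0 : 0 <= Num.sqrt ea + t^-1 by apply: addr_ge0 => //; exact: ltW.
  rewrite -[leRHS](ger0_norm X0) -sqrtr_sqr ler_wsqrtr// sqrrD -sqE -exprVn.
  by rewrite addrAC lerDl mulrn_wge0// mulr_ge0// ltW.
have X0 : 0 <= X by rewrite /X; lra.
have X3 : X <= 3 by rewrite /X; lra.
have e0 : 0 <= e by rewrite eE; apply: mulr_ge0 => //; apply: addr_ge0 => //; exact: sqrtr_ge0.
have eX : e <= K1 * X by rewrite eE ler_wpM2l// /X -addrA lerD2l.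
have vX : v <= K1 * X.
  by rewrite vE ler_wpM2l// /X -addrA lerD2l -exprVn; move: it2 sa2; rewrite -sqE; lra.
have e2X : e ^+ 2 <= 3 * K1 ^+ 2 * X.
  apply: (@le_trans _ _ ((K1 * X) ^+ 2)); first by rewrite lerXn2r ?nnegrE ?mulr_ge0.
  have -> : (K1 * X) ^+ 2 = K1 ^+ 2 * X * X by ring.
  have := ler_wpM2l (mulr_ge0 (sqr_ge0 K1) X0) X3; lra.
lra.
Qed.

(** As [C], [D] and [l] are at least 1/2 and [t] at least 1, every lower-order monomial is absorbed
    by the final rate [W]. *)
Lemma weight_bounds (R : realType) (C D l t sa sb W : R) :
  1 <= 2 * C -> 1 <= 2 * D -> 1 <= 2 * l -> 1 <= t -> 0 <= sa -> 0 <= sb ->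
  W = l ^+ 2 * (t ^+ 2 * (sb + sa) + t * (C * C * D + D)) ->
  [/\ t <= 32 * W, t * l <= 16 * W, t * C <= 16 * W, l ^+ 2 * (t * (C * C)) <= 2 * W &
      t ^+ 2 * sb <= 4 * W /\ t ^+ 2 * sa <= 4 * W].
Proof.
move=> C1 D1 l1 t1 sa0 sb0 WE; set u := C * C * D in WE.
have [t0 C0 l0 D0] : [/\ 0 <= t, 0 <= C, 0 <= l & 0 <= D] by split; lra.
have CC : 1 <= 4 * (C * C).
  have -> : 4 * (C * C) = (2 * C) * (2 * C) by ring.
  by rewrite -[leLHS]mulr1; apply: ler_pM.
have uC : C * C <= 2 * u by have := ler_wpM2l (mulr_ge0 C0 C0) D1; rewrite /u; lra.
have CC2 : C <= 2 * (C * C) by have := ler_wpM2l C0 C1; lra.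
have l2 : l <= 2 * l ^+ 2 by have := ler_wpM2l l0 l1; rewrite expr2; lra.
have l4 : 1 <= 4 * l ^+ 2 by lra.
have u8 : 1 <= 8 * u by lra.
have ll0 := sqr_ge0 l; have tt0 := sqr_ge0 t.
have llt0 := mulr_ge0 ll0 t0.
have x1 := mulr_ge0 tt0 sb0; have x2 := mulr_ge0 tt0 sa0; have x3 := mulr_ge0 t0 D0.
have W1 : l ^+ 2 * (t * u) <= W.
  by rewrite WE ler_wpM2l// !mulrDr; move: x1 x2 x3; clear; lra.
have x5 : 0 <= l ^+ 2 * (t * (u + D)) by rewrite mulr_ge0// mulr_ge0// addr_ge0// /u mulr_ge0// mulr_ge0.
have h1 := ler_wpM2r x1 l4; have h2 := ler_wpM2r x2 l4.
have y1 := mulr_ge0 ll0 x1; have y2 := mulr_ge0 ll0 x2.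
have h3 := ler_wpM2l t0 l4; have h4 := ler_wpM2l llt0 u8; have h5 := ler_wpM2l t0 l2.
have h6 := ler_wpM2l llt0 uC; have h7 := ler_wpM2l t0 CC2.
have h8 := ler_wpM2r (mulr_ge0 t0 (mulr_ge0 C0 C0)) l4.
split; last by split; move: h1 h2 y1 y2 x5; rewrite WE; clear; lra.
- by move: h3 h4 W1; clear; lra.
- by move: h4 h5 W1; clear; lra.
- by move: h6 h7 h8 W1; clear; lra.
- by move: h6 W1; clear; lra.
Qed.

(** Here [n] is the epoch length, [k] the number of epochs, [t = sqrt T], [l = ln T], [D] bounds the
    target constant, [C] is [D] plus the hitting bound, and [c1] bounds the initial potential. *)
Lemma regret_arith (R : realType) (n k c1 k1 k2 C D l t eb ea K1 K3 E0 err e v : R) :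
  0 < k1 -> 1 <= 2 * C -> 1 <= 2 * D -> 1 <= 2 * l -> 1 <= t -> 0 <= n -> 0 <= k ->
  k * n = t ^+ 2 -> k1 * (t / l) <= k <= k2 * (t / l) ->
  0 <= c1 -> 0 <= K1 -> 0 <= K3 -> 0 <= E0 -> 0 <= eb -> 0 <= ea -> Num.sqrt ea <= 1 ->
  0 <= err -> err <= E0 * l ^+ 2 * (C ^+ 2 / t) -> err <= 1 ->
  e = K1 * (err + Num.sqrt (ea + (t ^+ 2)^-1)) -> v = K1 * (err + (ea + (t ^+ 2)^-1)) ->
  n * c1 + k * (n * (Num.sqrt (2 * eb) + K3 * (e + e ^+ 2 + v)) + 2 * (2 * C)) <=
  (16 * (c1 / k1) + 8 + K3 * (2 * K1 + 3 * K1 ^+ 2) * (2 * E0 + 36) + 128 * `|k2|) * l ^+ 2 *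
    (t ^+ 2 * (Num.sqrt eb + Num.sqrt ea) + t * (C * C * D + D)).
Proof.
move=> k10 C1 D1 l1 t1 n0 k0 kn /andP[kL kU] c10 K10 K30 E00 eb0 ea0 sa1 err0 errE err1 eE vE.
have t0 : 0 < t by exact: lt_le_trans t1.
have l0 : 0 < l by lra.
have dyn := dynamics_error_le K10 t1 err0 err1 ea0 sa1 eE vE.
set X := _ + _ + t^-1 in dyn.
have sb0 := sqrtr_ge0 eb; have sa0 := sqrtr_ge0 ea.
set W := l ^+ 2 * (t ^+ 2 * (Num.sqrt eb + Num.sqrt ea) + t * (C * C * D + D)).
have [W3 tlW tCW CCW [sbW saW]] := weight_bounds C1 D1 l1 t1 sa0 sb0 (erefl W).
have tt0 := sqr_ge0 t.
have A : n * c1 <= 16 * (c1 / k1) * W.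
  (* The epoch length is [t ^ 2 / k], and [k] is at least [k1 * t / l]. *)
  have nk : n * k1 <= t * l.
    have := ler_wpM2l n0 kL; rewrite [n * k]mulrC kn => h.
    have := ler_wpM2l (ltW (divr_gt0 l0 t0)) h.
    have -> : l / t * (n * (k1 * (t / l))) = n * k1 by field; rewrite !gt_eqF.
    by have -> : l / t * t ^+ 2 = t * l by field; rewrite gt_eqF.
  have -> : n * c1 = c1 / k1 * (n * k1) by field; rewrite gt_eqF.
  have c0 : 0 <= c1 / k1 by rewrite divr_ge0// ltW.
  by rewrite [16 * _]mulrC -[leRHS]mulrA ler_wpM2l// (le_trans nk).
have Bb : t ^+ 2 * Num.sqrt (2 * eb) <= 2 * (t ^+ 2 * Num.sqrt eb).
  rewrite mulrCA ler_wpM2l// sqrtrM// ler_wpM2r//.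
  rewrite -[leRHS]ger0_norm// -sqrtr_sqr ler_wsqrtr//; lra.
have TX : t ^+ 2 * X <= (2 * E0) * W + t ^+ 2 * Num.sqrt ea + 32 * W.
  have -> : t ^+ 2 * X = t ^+ 2 * err + t ^+ 2 * Num.sqrt ea + t.
    by rewrite /X; field; rewrite gt_eqF.
  have h := ler_wpM2l tt0 errE.
  have hE : t ^+ 2 * (E0 * l ^+ 2 * (C ^+ 2 / t)) = E0 * (l ^+ 2 * (t * (C * C))).
    by field; rewrite gt_eqF.
  rewrite hE in h; have h3 := ler_wpM2l E00 CCW.
  by move: h h3 W3; clear; lra.
have Dd : k * C <= 32 * `|k2| * W.
  have h : t / l <= 2 * t.
    by rewrite ler_pdivrMr//; have := ler_wpM2l (ltW t0) l1; clear; lra.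
  have h' : k <= `|k2| * (2 * t).
    apply: (le_trans kU); apply: ler_pM => //; last exact: ler_norm.
      by have := le_trans k0 kU; rewrite pmulr_lge0// divr_gt0.
    by rewrite divr_ge0// ltW.
  have C0 : 0 <= C by move: C1; clear; lra.
  have h2 := ler_wpM2r C0 h'.
  by move: h2 (ler_wpM2l (normr_ge0 k2) tCW); clear; lra.
have K40 : 0 <= K3 * (2 * K1 + 3 * K1 ^+ 2).
  by nonneg.
have dyn' := ler_wpM2l K30 dyn.
set K4 := K3 * (2 * K1 + _) in K40 *.
have F : k * (n * (Num.sqrt (2 * eb) + K3 * (e + e ^+ 2 + v)) + 2 * (2 * C)) <=
   t ^+ 2 * Num.sqrt (2 * eb) + K4 * (t ^+ 2 * X) + 4 * (k * C).
  have -> : k * (n * (Num.sqrt (2 * eb) + K3 * (e + e ^+ 2 + v)) + 2 * (2 * C)) =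
    k * n * Num.sqrt (2 * eb) + k * n * (K3 * (e + e ^+ 2 + v)) + 4 * (k * C) by ring.
  by rewrite kn; move: (ler_wpM2l tt0 dyn'); rewrite /K4; clear; lra.
have G := ler_wpM2l K40 TX.
have GG := ler_wpM2l K40 saW.
rewrite -mulrA -/W; move: A F G GG sbW Bb Dd; clear; lra.
Qed.

(** The first bracket is the constant of [regret_arith]. The second enlarges it so that, whenever
    the bound is below [T], the batch and epoch errors are small enough. *)
Definition rate_const (R : realType) (G2 L mu g p0 b1 h2 k1 k2 K1 : R) (d m : nat)
    (p : nac_steps R) : R :=
  let kb := 192 / b1 in
  let E0 := h2 ^+ 2 * (4 * (expR 1 + 1) + kb) in
  (16 * (((alpha p)^-1 * `|ln p0| + 4 * `|G2| / mu) / k1) + 8 +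
   ascent_const G2 L mu g (alpha p) * (2 * K1 + 3 * K1 ^+ 2) * (2 * E0 + 36) + 128 * `|k2|) +
  (2 * E0 + 12 * (m%:R + 2) * (kb * (4 * `|h2|)) +
   (2 * (d%:R + 2) * (1 + g ^+ 2) ^+ 2) * (kb * (16 / (gamma p * mu))) + 4).

Lemma summands_le (R : realType) (x1 x2 x3 x4 x5 E c : R) :
  0 <= x1 -> 0 <= x2 -> 0 <= x3 -> 0 <= x4 -> 0 <= x5 -> 0 <= E ->
  c = (x1 + 8 + x2 + x3) + (2 * E + x4 + x5 + 4) ->
  [/\ 4 <= c, x4 <= c, x5 <= c, 2 * E <= c & x1 + 8 + x2 + x3 <= c].
Proof. by move=> *; subst c; split; lra. Qed.

Lemma scale_bounds (R : realType) (C D l t r : R) :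
  1 <= 2 * C -> 1 <= 2 * D -> 1 <= 2 * l -> 1 <= t -> r = l ^+ 2 * (C * C * D / t) ->
  [/\ 0 <= r, 0 <= C ^+ 2 / t, C ^+ 2 / t <= 8 * r, C ^+ 2 / t * l <= 4 * r &
      l ^+ 2 * (C ^+ 2 / t) <= 2 * r].
Proof.
move=> C1 D1 l1 t1 rE; have ll0 := sqr_ge0 l; have CC0 := sqr_ge0 C.
have t0 : 0 < t by exact: lt_le_trans t1.
have Ct0 : 0 <= C ^+ 2 / t by rewrite divr_ge0// ltW.
have l2 : l <= 2 * l ^+ 2.
  have l0 : 0 <= l by lra.
  by have := ler_wpM2l l0 l1; rewrite expr2; lra.
have l4 : 1 <= 4 * l ^+ 2 by lra.
have Ct : C ^+ 2 / t <= 2 * (C * C * D / t).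
  by have := ler_wpM2l Ct0 D1; rewrite expr2; lra.
have h2 := ler_wpM2l ll0 Ct; have h3 := ler_wpM2l Ct0 l2; have h4 := ler_wpM2l Ct0 l4.
have h5 := mulr_ge0 ll0 Ct0.
by rewrite rE; split => //; move: h2 h3 h4 h5; clear; lra.
Qed.

(** Each summand of a bound that is at most [t ^ 2] is itself at most [t ^ 2]; divide by [t ^ 2]. *)
Lemma nontrivial_regime (R : realType) (c sa sb u D l t : R) :
  4 <= c -> 0 <= sa -> 0 <= sb -> 0 <= u -> 0 <= D -> 1 <= 2 * l -> 1 <= t ->
  c * l ^+ 2 * (t ^+ 2 * (sb + sa) + t * (u + D)) <= t ^+ 2 ->
  sa <= 1 /\ c * (l ^+ 2 * (u / t)) <= 1.
Proof.
move=> c4 sa0 sb0 u0 D0 l1 t1 small; have t0 : 0 < t by exact: lt_le_trans t1.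
have l4 : 1 <= 4 * l ^+ 2.
  have l0 : 0 <= l by lra.
  by have := ler_wpM2l l0 l1; rewrite expr2; lra.
have tt0 : 0 < t ^+ 2 by exact: exprn_gt0.
have cl1 : 1 <= c * l ^+ 2 by have := ler_wpM2r (sqr_ge0 l) c4; lra.
have cl0 : 0 <= c * l ^+ 2 by lra.
have x1 := mulr_ge0 (ltW tt0) sa0; have x2 := mulr_ge0 (ltW tt0) sb0.
have x3 := mulr_ge0 (ltW t0) u0; have x4 := mulr_ge0 (ltW t0) D0.
split; rewrite -(ler_pM2l tt0) mulr1.
  apply: le_trans small; rewrite -[leLHS]mul1r; apply: ler_pM => //; move: x1 x2 x3 x4; clear; lra.
apply: le_trans small.
have -> : t ^+ 2 * (c * (l ^+ 2 * (u / t))) = c * l ^+ 2 * (t * u) by field; rewrite gt_eqF.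
by apply: ler_wpM2l => //; move: x1 x2 x3 x4; clear; lra.
Qed.

(** * The regret bound for finite constants *)

Section FiniteRegret.
Variables (R : realType) (d m : nat).
Variables (G2 L mu lambda g R0 cap p0 b1 h0 h2 k1 k2 K1 : R) (p : nac_steps R).
Hypotheses (mu0 : 0 < mu) (la0 : 0 < lambda) (g1 : 1 <= g) (K10 : 0 <= K1).
Hypothesis spec : epoch_dir_spec m d lambda mu g R0 p K1.
Hypothesis adm : admissible_steps cap p.
Hypothesis alL : 8 * `|L| * alpha p <= mu.
Hypotheses (p00 : 0 < p0) (b10 : 0 < b1) (k10 : 0 < k1).
Hypotheses (bl : beta p * lambda / 2 <= 1) (gm : gamma p * mu / 2 <= 1).
Hypotheses (bh : 1 <= beta p * lambda / 2 * h0) (gh : 1 <= gamma p * mu / 2 * h0).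

Variables (S A : finType) (M : mdp R S A).
Variables (Theta : set 'cV[R]_d) (pi : 'cV[R]_d -> S -> A -> R) (phi : S -> 'cV[R]_m).
Variables (i0 : nac_init R d m) (pistar : S -> A -> R) (dstar : S -> R).
Hypothesis pol : policy_class Theta pi.
Hypothesis T0 : Theta (theta0 i0).
Hypothesis pi0 : forall s a, p0 <= pi (theta0 i0) s a.
Hypothesis init_le : forall k, enorm (xi0 i0 k) <= R0 /\ enorm (omega0 i0 k) <= R0.
Hypothesis phi1 : forall s, enorm (phi s) <= 1.
Hypothesis opt : optimal_policy M Theta pi pistar dstar.
Hypothesis uni : forall theta, Theta theta -> unichain (pol_chain M (pi theta)).
Hypothesis coer : forall theta x, Theta theta -> in_ker_orth (critic_mx M (pi theta) phi) x ->
  lambda * enorm x ^+ 2 <= dotp x (critic_mx M (pi theta) phi *m x).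
Hypothesis sc_le : forall theta s a, Theta theta -> enorm (score pi theta s a) <= g.
Hypothesis sc_lip : forall t1 t2 s a, Theta t1 -> Theta t2 ->
  enorm (score pi t1 s a - score pi t2 s a) <= G2 * enorm (t1 - t2).
Hypothesis fish : forall theta, Theta theta -> psd (fisher M pi theta - mu%:M).
Hypothesis smooth : smooth_on Theta (Jfun M pi) L.

Variables (K H B T : nat).
Hypotheses (K0 : (0 < K)%N) (H0 : (0 < H)%N) (B0 : (0 < B)%N) (TE : T = (2 * K * H * B)%N).
Let l : R := ln T%:R.
Let t : R := Num.sqrt T%:R.
Hypothesis KP : k1 * (t / l) <= K%:R <= k2 * (t / l).
Hypothesis BP : b1 * t <= B%:R.
Hypothesis HP : h0 * l <= H%:R <= h2 * l.
Hypothesis stay : updates_stay M Theta pi phi i0 cap K H B T.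

Variables (D ch eb ea : R).
Hypotheses (D1 : 1 <= 2 * D) (ch0 : 0 <= ch) (eb0 : 0 <= eb) (ea0 : 0 <= ea).
Hypothesis ctP : forall theta, Theta theta -> (ctar_chain (pol_chain M (pi theta)) <= D%:E)%E.
Hypothesis chP : forall theta, Theta theta -> (chit_chain (pol_chain M (pi theta)) <= ch%:E)%E.
Hypothesis ebP : forall theta, Theta theta ->
  compat_loss M pi (occ dstar pistar) (npg M pi theta) theta <= eb.
Hypothesis eaP : forall theta (r : R), Theta theta -> 0 < r -> exists zeta,
  value_loss M pi theta phi (value M (pi theta)) zeta <= ea + r.

(** [T] is even and positive, and [ln 2 >= 1 / 2]. *)
Lemma half_le_ln_horizon : 1 <= 2 * l.
Proof.
have T2 : 2 <= T%:R :> R by rewrite ler_nat TE -!mulnA leq_pmulr// !muln_gt0 K0 H0.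
have T0' : 0 < T%:R :> R by lra.
have : ln 2 <= l by rewrite ler_ln ?posrE.
suff : 1 <= 2 * ln (2 : R) by lra.
have h : ln (2^-1 : R) <= - 2^-1.
  have := @le_ln1Dx R (- 2^-1); have -> : 1 + - 2^-1 = 2^-1 :> R by lra.
  by apply; lra.
by rewrite lnV ?posrE// in h; lra.
Qed.

Lemma finite_regret_le : expected_regret M Theta pi phi p i0 H B T <=
  rate_const G2 L mu g p0 b1 h2 k1 k2 K1 d m p * l ^+ 2 *
    (t ^+ 2 * (Num.sqrt eb + Num.sqrt ea) + t * ((D + ch) * (D + ch) * D + D)).
Proof.
set c := rate_const _ _ _ _ _ _ _ _ _ _ _ _ _.
set C := D + ch; set u := C * C * D; set rhs := (X in _ <= X).
have l1 := half_le_ln_horizon.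
have T1 : 1 <= T%:R :> R by rewrite ler1n TE !muln_gt0 K0 H0 B0.
have tT : t ^+ 2 = T%:R by rewrite sqr_sqrtr.
have t1 : 1 <= t by rewrite -sqrtr1 ler_wsqrtr.
have t0 : 0 < t by exact: lt_le_trans t1.
have l0 : 0 < l by lra.
have lE : expR (- l) = (t ^+ 2)^-1 by rewrite expRN lnK ?tT// posrE; lra.
have C1 : 1 <= 2 * C by move: D1 ch0; rewrite /C; lra.
have C0 : 0 <= C by lra.
have [/andP[al0 _] /andP[be0 _] _ /andP[ga0 _]] := adm.
set kb := 192 / b1.
set E0 := h2 ^+ 2 * (4 * (expR 1 + 1) + kb).
set K3 := ascent_const G2 L mu g (alpha p).
set c1 := (alpha p)^-1 * `|ln p0| + 4 * `|G2| / mu.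
set kc := 2 * (d%:R + 2) * (1 + g ^+ 2) ^+ 2.
have cE : c = (16 * (c1 / k1) + 8 + K3 * (2 * K1 + 3 * K1 ^+ 2) * (2 * E0 + 36) + 128 * `|k2|) +
  (2 * E0 + 12 * (m%:R + 2) * (kb * (4 * `|h2|)) + kc * (kb * (16 / (gamma p * mu))) + 4) by [].
have kJ0 : 0 <= 4 * `|G2| / mu by rewrite divr_ge0 ?mulr_ge0// ltW.
have c10 : 0 <= c1 by rewrite /c1 addr_ge0// mulr_ge0// invr_ge0 ltW.
have g0 : 0 <= g by exact: le_trans g1.
have K30 : 0 <= K3.
  have al0' := ltW al0; have mu0' := ltW mu0.
  rewrite /K3 /ascent_const; apply: addr_ge0; first by apply: addr_ge0; rewrite // !mulr_ge0.
  apply: mulr_ge0; first by rewrite divr_ge0// !mulr_ge0.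
  by apply: addr_ge0; [rewrite divr_ge0// exprn_ge0|rewrite !mulr_ge0].
have e1 := expR_ge0 (1 : R).
have kb0 : 0 <= kb by apply: mulr_ge0; [exact: ler0n|rewrite invr_ge0 ltW].
have E00 : 0 <= E0.
  by apply: mulr_ge0; [exact: sqr_ge0|move: kb0 e1; move: (kb) => x; lra].
have p1 : 0 <= 16 * (c1 / k1) by rewrite mulr_ge0// divr_ge0// ltW.
have p2 : 0 <= K3 * (2 * K1 + 3 * K1 ^+ 2) * (2 * E0 + 36).
  apply: mulr_ge0; last by lra.
  by apply: mulr_ge0 => //; rewrite addr_ge0 ?mulr_ge0 ?sqr_ge0.
have p3 : 0 <= 128 * `|k2| by rewrite mulr_ge0.
have p4 : 0 <= 12 * (m%:R + 2) * (kb * (4 * `|h2|)).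
  by apply: mulr_ge0; [rewrite mulr_ge0// addr_ge0|apply: mulr_ge0 => //; rewrite mulr_ge0].
have kc0 : 0 <= kc by apply: mulr_ge0; [rewrite mulr_ge0// addr_ge0|exact: sqr_ge0].
have gmu0 : 0 < gamma p * mu by exact: mulr_gt0.
have p5 : 0 <= kc * (kb * (16 / (gamma p * mu))).
  by apply: mulr_ge0 => //; apply: mulr_ge0 => //; rewrite divr_ge0// ltW.
have sb0 := sqrtr_ge0 eb; have sa0 := sqrtr_ge0 ea.
have ll0 := sqr_ge0 l.
have D0 : 0 <= D by move: D1; lra.
have u0 : 0 <= u by rewrite /u; apply: mulr_ge0 => //; exact: mulr_ge0.
have [c4 p4c p5c E0c mainc] := summands_le p1 p2 p3 p4 p5 E00 cE.
have reg_le : expected_regret M Theta pi phi p i0 H B T <= T%:R.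
  exact: (expected_regret_le_horizon pol T0 opt H0 B0 TE stay adm).
(* Either the bound exceeds T, which always bounds the regret, or the batches are
   long enough for both inner loops to contract and eps_app <= 1. *)
have [big|small] := leP (T%:R) rhs; first exact: le_trans big.
have sm : rhs <= t ^+ 2 by rewrite tT; exact: ltW.
have [sa1 cr] := nontrivial_regime c4 sa0 sb0 u0 D0 l1 t1 sm.
pose r := l ^+ 2 * (u / t).
have [r0 Ct0 Ct8 lCt llCt] := scale_bounds C1 D1 l1 t1 (erefl r).
have coef a : a <= c -> a * r <= 1.
  by move=> ac; apply: le_trans cr; rewrite ler_wpM2r.
have be := batch_err_le b10 t0 BP C1; rewrite -/kb in be.
have ber0 : 0 <= batch_err (2 * C) B.
  by rewrite /batch_err divr_ge0// mulr_ge0// sqr_ge0.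
have [hL hU] : h0 * l <= H%:R /\ H%:R <= h2 * l by apply/andP.
have h20 : 0 <= h2 by have := le_trans (ler0n R H) hU; rewrite pmulr_lge0.
have small1 : 4 * (3 * (m%:R + 2)) * batch_err (2 * C) B * H%:R <= 1.
  have c12 : 0 <= 12 * (m%:R + 2) :> R by rewrite mulr_ge0// addr_ge0.
  have s1 : batch_err (2 * C) B * H%:R <= kb * (4 * `|h2|) * r.
    apply: (@le_trans _ _ (kb * (C ^+ 2 / t) * (h2 * l))); first exact: ler_pM.
    have -> : kb * (C ^+ 2 / t) * (h2 * l) = kb * h2 * (C ^+ 2 / t * l) by ring.
    have -> : kb * (4 * `|h2|) * r = kb * h2 * (4 * r) by rewrite ger0_norm//; ring.
    by rewrite ler_wpM2l// mulr_ge0.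
  apply: le_trans (coef _ p4c); rewrite [leLHS](_ : _ = 12 * (m%:R + 2) * (batch_err (2 * C) B * H%:R)); last by ring.
  by rewrite -[leRHS]mulrA ler_wpM2l.
have small2 : batch_err (2 * C) B * kc <= gamma p * mu / 2.
  have s2 := ler_wpM2r kc0 (le_trans be (ler_wpM2l kb0 Ct8)).
  apply: (le_trans s2).
  have -> : kb * (8 * r) * kc = (gamma p * mu / 2) * (kc * (kb * (16 / (gamma p * mu))) * r).
    by field; rewrite !gt_eqF.
  rewrite -[leRHS]mulr1; apply: ler_wpM2l; first by rewrite divr_ge0// ltW.
  exact: coef.
have bl0 : 0 <= beta p * lambda / 2 by rewrite divr_ge0// mulr_ge0// ltW.
have gm0 : 0 <= gamma p * mu / 2 by rewrite divr_ge0// ltW.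
have ee : epoch_err lambda mu (2 * C) p H B <= (4 * (expR 1 + 1) + kb) * (C ^+ 2 / t).
  by apply: (epoch_err_le (h0 := h0) (l := l)) => //; [exact: ltW|rewrite bl0|rewrite gm0].
have ee0 : 0 <= epoch_err lambda mu (2 * C) p H B.
  by apply: addr_ge0 => //; rewrite addr_ge0// exprn_ge0// subr_ge0.
pose err := H%:R ^+ 2 * epoch_err lambda mu (2 * C) p H B.
have err0 : 0 <= err by rewrite mulr_ge0// sqr_ge0.
have errE : err <= E0 * l ^+ 2 * (C ^+ 2 / t).
  have -> : E0 * l ^+ 2 * (C ^+ 2 / t) =
    (h2 * l) ^+ 2 * ((4 * (expR 1 + 1) + kb) * (C ^+ 2 / t)) by rewrite /E0; ring.
  by apply: ler_pM => //; rewrite lerXn2r ?nnegrE// mulr_ge0// ltW.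
have err1 : err <= 1.
  apply: (le_trans errE).
  apply: (@le_trans _ _ (2 * E0 * r)); last exact: coef.
  by have := ler_wpM2l E00 llCt; rewrite [E0 * (l ^+ 2 * _)]mulrA [E0 * (2 * r)]mulrCA [2 * (E0 * r)]mulrA.
have [starP starS _] := opt.
have ea'0 : 0 <= ea + (t ^+ 2)^-1 by rewrite addr_ge0// invr_ge0 sqr_ge0.
(* The infimum in [eps_app] need not be attained; a slack of [1 / T] is harmless. *)
have eaP' theta : Theta theta -> exists zeta,
    value_loss M pi theta phi (value M (pi theta)) zeta <= ea + (t ^+ 2)^-1.
  by move=> Tt; apply: eaP => //; rewrite invr_gt0 exprn_gt0.
pose e := K1 * (err + Num.sqrt (ea + (t ^+ 2)^-1)).
pose v := K1 * (err + (ea + (t ^+ 2)^-1)).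
pose lya := lyapunov M pi pistar dstar G2 mu (alpha p).
have ce0 theta : Theta theta -> 0 <= cross_entropy M pi pistar dstar theta.
  move=> Tt; have [_ /(_ _ Tt)[thP th0 _]] := pol.
  rewrite -(stat_mean_cst M starP (proj1 starS) 0).
  apply: (stat_mean_le M starP (proj1 starS)) => z.
  rewrite oppr_ge0 ln_le0// -(policy_sum1 thP z.1.1) (bigD1 z.1.2)//= lerDl sumr_ge0// => a _.
  exact: ltW.
have Jb := Jfun_bounds pol uni.
(* The cross-entropy is nonnegative and [J] is at most 1. *)
have lya_ge theta : Theta theta -> 0 <= lya theta + 4 * `|G2| / mu.
  move=> Tt; have /andP[J0 J1] := Jb _ Tt; rewrite /lya /lyapunov -addrA addr_ge0//.
    by rewrite mulr_ge0 ?ce0// invr_ge0 ltW.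
  by rewrite addrC subr_ge0 -[leRHS]mulr1 ler_wpM2l.
(* [p0] bounds the initial cross-entropy by [|ln p0|]. *)
have lya_le : lya (theta0 i0) + 4 * `|G2| / mu <= c1.
  have /andP[J0 J1] := Jb _ T0; rewrite /lya /lyapunov lerD2r.
  apply: (@le_trans _ _ ((alpha p)^-1 * cross_entropy M pi pistar dstar (theta0 i0))).
    by rewrite gerBl mulr_ge0.
  rewrite ler_wpM2l ?invr_ge0 ?(ltW al0)// -[leRHS](stat_mean_cst M starP (proj1 starS)).
  apply: (stat_mean_le M starP (proj1 starS)) => z.
  rewrite -normrN; apply: le_trans (ler_norm _); rewrite lerN2.
  have p0z := pi0 z.1.1 z.1.2.
  by rewrite ler_ln// posrE; exact: lt_le_trans p0z.
have step := epoch_suboptimality pol starP starS uni phi1 coer sc_le sc_lip fish smooth mu0 g1 K10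
  spec H0 B0 al0 alL D0 ch0 ctP chP small1 small2 err0 eb0 ea'0 ebP eaP'.
have bnd := expected_regret_le pol T0 H0 B0 TE stay adm lya_ge.
apply: le_trans (bnd _ _) _.
  move=> k theta s Tt seg; have [x0P w0P] := init_le k.
  exact: (step _ theta s _ _ (Jstar_le T0 opt) Tt x0P w0P seg).
have kn : K%:R * (2 * H * B)%:R = t ^+ 2 :> R by rewrite tT -natrM TE; congr (_%:R); ring.
have main := regret_arith k10 C1 D1 l1 t1 (ler0n R (2 * H * B)) (ler0n R K) kn KP c10 K10 K30 E00
  eb0 ea0 sa1 err0 errE err1 (erefl e) (erefl v).
apply: le_trans (le_trans _ main) _.
  by rewrite lerD2r ler_wpM2l.
rewrite /rhs; apply: ler_wpM2r; last exact: ler_wpM2r.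
by apply: addr_ge0; apply: mulr_ge0; rewrite ?sqr_ge0 ?addr_ge0// ltW.
Qed.

End FiniteRegret.

(** If any constant is infinite, so is the right side. For [Ch] this relies on [0 < Ct], since
    [0 * +oo = 0]. *)
Lemma le_extended_rate (R : realType) (r a T t : R) (Ct Ch eb ea : \bar R) :
  0 < a -> 0 < T -> 0 < t -> (0 < Ct)%E -> (0 <= Ch)%E -> (0 <= eb)%E -> (0 <= ea)%E ->
  (forall D ch b e : R, Ct = D%:E -> Ch = ch%:E -> eb = b%:E -> ea = e%:E ->
    r <= a * (T * (Num.sqrt b + Num.sqrt e) + t * ((D + ch) * (D + ch) * D + D))) ->
  (r%:E <= a%:E * (T%:E * (sqrte eb + sqrte ea) +
     t%:E * ((Ct + Ch) * (Ct + Ch) * Ct + Ct)))%E.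
Proof.
move=> a0 T0 t0 Ct0 Ch0 eb0 ea0 fin.
have top X : X = +oo%E -> (r%:E <= a%:E * X)%E by move=> ->; rewrite gt0_muley ?lte_fin ?leey.
have x1 : (0 <= T%:E * (sqrte eb + sqrte ea))%E.
  by rewrite mule_ge0 ?lee_fin ?adde_ge0 ?sqrte_ge0 ?ltW.
have nNy (X : \bar R) : (0 <= X)%E -> X != -oo%E by move=> h; rewrite -ltNye (lt_le_trans (ltNyr 0)).
case: Ct Ct0 fin => [D| |] // Ct0 fin; last first.
  by apply: top; rewrite addye ?nNy// !mulyy addye ?nNy// gt0_muley ?lte_fin// addey ?nNy.
case: Ch Ch0 fin => [ch| |] // Ch0 fin; last first.
  by apply: top; rewrite addey// mulyy gt0_mulye// addye// gt0_muley ?lte_fin// addey ?nNy.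
rewrite -EFinD -!EFinM.
case: eb eb0 x1 fin => [b| |] // eb0 x1 fin; last first.
  by apply: top; rewrite /= addye ?nNy ?sqrte_ge0// gt0_muley ?lte_fin// addye.
case: ea ea0 x1 fin => [e| |] // ea0 x1 fin; last first.
  by apply: top; rewrite /= addey// gt0_muley ?lte_fin// addye.
by rewrite /= -EFinD -!EFinM lee_fin; exact: fin.
Qed.

Lemma eps_bias_ge0 (R : realType) (S A : finType) (M : mdp R S A) (d : nat)
    (Theta : set 'cV[R]_d) (pi : 'cV[R]_d -> S -> A -> R) pistar dstar theta :
  is_policy pistar -> is_dist dstar -> Theta theta ->
  (0 <= eps_bias M Theta pi (occ dstar pistar))%E.
Proof.
move=> starP [d0 _] Tt; apply: le_trans (ereal_sup_ubound _); last by exists theta.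
rewrite lee_fin mulr_ge0// /esa sumr_ge0// => s _; rewrite sumr_ge0// => a _.
by rewrite mulr_ge0 ?sqr_ge0// mulr_ge0//; exact: policy_ge0.
Qed.

Section ValueLoss.
Variables (R : realType) (S A : finType) (M : mdp R S A) (d m : nat).
Variables (Theta : set 'cV[R]_d) (pi : 'cV[R]_d -> S -> A -> R) (phi : S -> 'cV[R]_m).
Variable theta : 'cV[R]_d.
Hypothesis Tt : Theta theta.
Hypothesis d0 : forall s, 0 <= pol_stat M (pi theta) s.
Let losses := [set 2^-1 * \sum_s pol_stat M (pi theta) s *
  (value M (pi theta) s - dotp zeta (phi s)) ^+ 2 | zeta in [set: 'cV[R]_m]].

Lemma losses_lb : lbound losses 0.
Proof.
by move=> _ [zeta _ <-]; rewrite mulr_ge0// sumr_ge0// => s _; rewrite mulr_ge0 ?sqr_ge0.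
Qed.

Lemma losses_neq0 : losses !=set0.
Proof. by eexists; exists (0 : 'cV[R]_m). Qed.

Lemma eps_app_ge0 : (0 <= eps_app M Theta pi phi)%E.
Proof.
apply: le_trans (ereal_sup_ubound _); last by exists theta.
by rewrite lee_fin; apply: lb_le_inf; [exact: losses_neq0|exact: losses_lb].
Qed.

Lemma eps_app_adherent (ea r : R) : (eps_app M Theta pi phi <= ea%:E)%E -> 0 < r ->
  exists zeta, value_loss M pi theta phi (value M (pi theta)) zeta <= ea + r.
Proof.
move=> eaP r0.
have inf_le : inf losses <= ea.
  by rewrite -lee_fin; apply: le_trans eaP; apply: ereal_sup_ubound; exists theta.
have [|_ [zeta _ <-] lt] := @inf_adherent _ losses r r0.
  by split; [exact: losses_neq0|exists 0; exact: losses_lb].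
by exists zeta; apply: (le_trans (ltW lt)); rewrite lerD2r.
Qed.

End ValueLoss.
(** Each argument of a minimum secures one requirement of the epoch estimates, and
    [beta * cbeta = 1] fixes [cbeta]. *)
Lemma step_sizes (R : realType) (d m : nat) (L mu lambda g R0 cap : R) :
  0 < mu -> 0 < lambda -> lambda <= 1 -> 1 <= g -> 0 <= R0 -> 0 < cap ->
  exists (p : nac_steps R) (K1 h0 : R),
    [/\ admissible_steps cap p, 8 * `|L| * alpha p <= mu,
        0 <= K1 /\ epoch_dir_spec m d lambda mu g R0 p K1, 0 < h0 &
        [/\ beta p * lambda / 2 <= 1, gamma p * mu / 2 <= 1,
            1 <= beta p * lambda / 2 * h0 & 1 <= gamma p * mu / 2 * h0]].
Proof.
move=> mu0 la0 la1 g1 R00 cap0.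
have g0 : 0 < g by exact: lt_le_trans g1.
have g40 : 0 < g ^+ 4 by exact: exprn_gt0.
have L0 : 0 < 8 * (`|L| + 1) by have := normr_ge0 L; lra.
pose al := Num.min cap (mu / (8 * (`|L| + 1))); pose be := Num.min cap (lambda / 4).
pose ga := Num.min (Num.min cap 1) (Num.min (mu / g ^+ 4) mu^-1).
have al0 : 0 < al by rewrite lt_min cap0 divr_gt0.
have be0 : 0 < be by rewrite lt_min cap0 divr_gt0.
have ga0 : 0 < ga by rewrite !lt_min cap0 ltr01 divr_gt0// invr_gt0.
have [al_le be_le ga_le] : [/\ al <= cap, be <= cap & ga <= cap].
  by split; rewrite !ge_min lexx.
have alE : al <= mu / (8 * (`|L| + 1)) by rewrite ge_min lexx orbT.
have beE : be <= lambda / 4 by rewrite ge_min lexx orbT.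
have ga1 : ga <= 1 by rewrite !ge_min lexx orbT.
have ga2 : ga <= mu / g ^+ 4 by rewrite !ge_min lexx !orbT.
have ga3 : ga <= mu^-1 by rewrite !ge_min lexx !orbT.
have gamu : ga * mu <= 1 by rewrite -ler_pdivlMr// mul1r.
have [K1 K1P] : exists K1 : R, 0 <= K1 /\
    epoch_dir_spec m d lambda mu g R0 (NacSteps al be be^-1 ga) K1.
  apply: epoch_dir_bounds => //=.
  - lra.
  - by rewrite mulfV// gt_eqF.
  - by rewrite -ler_pdivlMr.
have bl0 : 0 < be * lambda by exact: mulr_gt0.
have gm0 : 0 < ga * mu by exact: mulr_gt0.
have x0 : 0 < 2 / (be * lambda) by exact: divr_gt0.
have y0 : 0 < 2 / (ga * mu) by exact: divr_gt0.
(* The two summands of [h0] are the inverses of the contraction rates of the critic and of the NPG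
   iteration. *)
exists (NacSteps al be be^-1 ga), K1, (2 / (be * lambda) + 2 / (ga * mu)); split => //=.
- by split; rewrite /= ?al0 ?be0 ?ga0 ?invr_gt0.
- move: alE; rewrite ler_pdivlMr// => h.
  by have := normr_ge0 L; lra.
- exact: addr_gt0.
split.
- have : be * lambda <= lambda / 4 * 1 by apply: ler_pM => //; exact: ltW.
  lra.
- lra.
- rewrite [leLHS](_ : _ = be * lambda / 2 * (2 / (be * lambda))); last by field; rewrite !gt_eqF.
  by rewrite ler_wpM2l ?divr_ge0 ?(ltW bl0)// lerDl ltW.
- rewrite [leLHS](_ : _ = ga * mu / 2 * (2 / (ga * mu))); last by field; rewrite !gt_eqF.
  by rewrite ler_wpM2l ?divr_ge0 ?(ltW gm0)// lerDr ltW.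
Qed.

Unset Implicit Arguments.

(* The constants hidden by the soft-O (h0, c, q) depend only on the parameters
   quantified before them; they are uniform in the MDP, the policy class and
   the features. *)
Theorem theorem1 (R : realType) (d m : nat)
    (G1 G2 L mu lambda : R) (hmu : 0 < mu) (hlambda : 0 < lambda)
    (* initialization: lower bound on pi_theta0, bound on the initial iterates;
       cap on the stepsizes *)
    (p0 R0 cap : R) (hp0 : 0 < p0) (hcap : 0 < cap) :
  exists2 h0 : R, 0 < h0 &
  forall k1 k2 b1 b2 h1 h2 : R, 0 < k1 -> 0 < b1 -> h0 <= h1 ->
  exists (c : R) (q : nat), 0 < c /\
  forall (S A : finType) (M : mdp R S A)
    (Theta : set 'cV[R]_d) (pi : 'cV[R]_d -> S -> A -> R)
    (phi : S -> 'cV[R]_m) (i0 : nac_init R d m)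
    (pistar : S -> A -> R) (dstar : S -> R),
  policy_class Theta pi ->
  Theta (theta0 i0) ->
  (forall s a, p0 <= pi (theta0 i0) s a) ->
  (forall k, enorm (xi0 i0 k) <= R0 /\ enorm (omega0 i0 k) <= R0) ->
  (forall s, enorm (phi s) <= 1) ->
  \rank (feature_mx phi) = m ->
  optimal_policy M Theta pi pistar dstar ->
  (* (1) *)
  (forall theta, Theta theta -> unichain (pol_chain M (pi theta))) ->
  (* (2) *)
  (forall theta x, Theta theta ->
     in_ker_orth (critic_mx M (pi theta) phi) x ->
     lambda * enorm x ^+ 2 <= dotp x (critic_mx M (pi theta) phi *m x)) ->
  (* (3) *)
  bounded_lipschitz_score Theta pi G1 G2 ->
  (* (4) *)
  (forall theta, Theta theta -> psd (fisher M pi theta - mu%:M)) ->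
  (* (5) *)
  smooth_on Theta (Jfun M pi) L ->
  (* excludes the degenerate case where every policy of the class has a single
     recurrent state; otherwise C_tar >= 1/2 *)
  (0 < C_tar M Theta pi)%E ->
  forall K H B T : nat, (0 < K)%N -> (0 < H)%N -> (0 < B)%N ->
  T = (2 * K * H * B)%N ->
  is_Theta k1 k2 K%:R (Num.sqrt T%:R / ln T%:R) ->
  is_Theta b1 b2 B%:R (Num.sqrt T%:R) ->
  is_Theta h1 h2 H%:R (ln T%:R) ->
  updates_stay M Theta pi phi i0 cap K H B T ->
  exists2 p : nac_steps R, admissible_steps cap p &
  let nustar := occ dstar pistar in
  let Ctar := C_tar M Theta pi in
  let C := (Ctar + C_hit M Theta pi)%E in
  ((expected_regret M Theta pi phi p i0 H B T)%:E <=
   (c * ln T%:R ^+ q)%:E *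
     (T%:R%:E * (sqrte (eps_bias M Theta pi nustar) +
                 sqrte (eps_app M Theta pi phi)) +
      (Num.sqrt T%:R)%:E * (C * C * Ctar + Ctar)))%E.
Proof.
(* Normalization to [lambda <= 1] and a score bound at least 1; both only weaken the hypotheses. *)
have la0 : 0 < Num.min lambda 1 by rewrite lt_min hlambda ltr01.
have g1 : 1 <= 1 + `|G1| by rewrite lerDl.
have la1 : Num.min lambda 1 <= 1 by rewrite ge_min lexx orbT.
have [p [K1 [h0 [adm alL [K10 spec] h00 [bl gm bh gh]]]]] :=
  @step_sizes R d m L mu (Num.min lambda 1) (1 + `|G1|) `|R0| cap hmu la0 la1 g1 (normr_ge0 R0) hcap.
exists h0 => // k1 k2 b1 b2 h1 h2 k10 b10 h01.
set c0 := rate_const G2 L mu (1 + `|G1|) p0 b1 h2 k1 k2 K1 d m p.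
(* The power 2 of the logarithm comes from the factor [H ^ 2] in the epoch error. *)
exists (`|c0| + 1), 2%N; split; first by rewrite ltr_wpDl.
move=> S A M Theta pi phi i0 pistar dstar pol T0 pi0 init_le phi1 _ opt uni coer [sc_le sc_lip]
  fish smooth Ctar0 K H B T K0 H0 B0 TE KP BP HP stay.
exists p => //; cbv zeta.
have l1 : 1 <= 2 * ln T%:R :> R by exact: half_le_ln_horizon K0 H0 B0 TE.
have l0 : 0 < ln T%:R :> R by lra.
have T00 : 0 < T%:R :> R by rewrite ltr0n TE !muln_gt0 K0 H0 B0.
have [starP starS _] := opt.
have Pd theta : Theta theta -> forall s, is_dist (pol_chain M (pi theta) s).
  by move=> Tt s; apply: pol_chain_dist; have [_ /(_ _ Tt)[]] := pol.
have dP theta : Theta theta -> forall s, 0 <= pol_stat M (pi theta) s.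
  move=> Tt; have [_ /(_ _ Tt)[thP _ _]] := pol.
  by have [[]] := pol_stat_stationary thP (uni _ Tt).
apply: le_extended_rate => //.
- by rewrite mulr_gt0 ?exprn_gt0// ltr_wpDl.
- by rewrite sqrtr_gt0.
- apply: le_trans (chit_chain_ge0 (Pd _ T0) (uni _ T0)) _.
  by apply: ereal_sup_ubound; exists (theta0 i0).
- exact: eps_bias_ge0 starP (proj1 starS) T0.
- exact: eps_app_ge0 T0 (dP _ T0).
move=> D ch eb ea DE chE ebE eaE.
have ctP theta : Theta theta -> (ctar_chain (pol_chain M (pi theta)) <= D%:E)%E.
  by move=> Tt; rewrite -DE; apply: ereal_sup_ubound; exists theta.
have chP theta : Theta theta -> (chit_chain (pol_chain M (pi theta)) <= ch%:E)%E.
  by move=> Tt; rewrite -chE; apply: ereal_sup_ubound; exists theta.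
(* A positive supremum has a positive member, to which [target_ge_half] applies. *)
have D1 : 1 <= 2 * D.
  have [_ [theta Tt <-] pos] := ereal_sup_gt Ctar0.
  have [hR [h [hRP hP]]] := exists_hit (Pd _ Tt) (uni _ Tt).
  by have := target_ge_half (Pd _ Tt) (uni _ Tt) (ctP _ Tt) hRP hP pos; lra.
have ch0 : 0 <= ch.
  by rewrite -lee_fin; apply: le_trans (chP _ T0); exact: chit_chain_ge0 (Pd _ T0) (uni _ T0).
have eb0 : 0 <= eb by rewrite -lee_fin -ebE; exact: eps_bias_ge0 starP (proj1 starS) T0.
have ea0 : 0 <= ea by rewrite -lee_fin -eaE; exact: eps_app_ge0 T0 (dP _ T0).
have HP' : h0 * ln T%:R <= H%:R <= h2 * ln T%:R.
  have /andP[h1H ->] := HP; rewrite andbT; by apply: le_trans h1H; rewrite ler_wpM2r ?(ltW l0).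
have c_le : c0 * ln T%:R ^+ 2 <= (`|c0| + 1) * ln T%:R ^+ 2.
  by rewrite ler_wpM2r ?sqr_ge0//; have := ler_norm c0; lra.
have tT : Num.sqrt T%:R ^+ 2 = T%:R :> R by rewrite sqr_sqrtr// ltW.
set X := (X in _ <= _ * X).
have X0 : 0 <= X.
  have DC : 0 <= D + ch by lra.
  apply: addr_ge0; first by rewrite mulr_ge0// addr_ge0 ?sqrtr_ge0.
  by apply: mulr_ge0; [exact: sqrtr_ge0|apply: addr_ge0; [rewrite !mulr_ge0//|]; lra].
apply: (le_trans _ (ler_wpM2r X0 c_le)); rewrite /X -[Y in Y * (Num.sqrt eb + _)]tT.
apply: (finite_regret_le hmu la0 g1 K10 spec adm alL hp0 b10 k10 bl gm bh gh pol T0 pi0 _ phi1 opt uni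
  _ _ sc_lip fish smooth K0 H0 B0 TE KP _ HP' stay D1 ch0 eb0 ea0 ctP chP).
- move=> k; have [x0 w0] := init_le k; have := ler_norm R0.
  by split; [exact: le_trans x0 _|exact: le_trans w0 _].
- move=> theta x Tt xP; apply: le_trans (coer _ _ Tt xP).
  by rewrite ler_wpM2r ?sqr_ge0// ge_min lexx.
- move=> theta s a Tt; apply: le_trans (sc_le _ s a Tt) _.
  by have := ler_norm G1; lra.
- by have /andP[] := BP.
- move=> theta Tt; rewrite -lee_fin -ebE; apply: ereal_sup_ubound; by exists theta.
- move=> theta r Tt r0; apply: (eps_app_adherent Tt (dP _ Tt)) => //; by rewrite eaE.
Qed.
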